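(* Let $d\ge1$ and let $k$ be an isotropic kernel on $\mathbb S^d$ induced by some $\psi\in\Psi_{d+2}$ or by some $\psi\in\Psi_{d+1}^+$. Then the following statements are equivalent: (i) $k$ is characteristic. (ii) $k$ is universal. (iii) $k$ is strictly positive definite on $\mathbb S^d$, that is, $\psi\in\Psi_d^+$.
   Context: A kernel on a set $X$ is a symmetric function $k:X\times X\to\mathbb R$ with $\sum_{i,j=1}^na_ia_jk(x_i,x_j)\ge0$ for all $n$, $a_i\in\mathbb R$, $x_i\in X$; it is strictly positive definite if equality implies $a_1=\dots=a_n=0$ whenever $x_1,\dots,x_n$ are mutually distinct. $\mathbb S^d$ is the unit sphere in $\mathbb R^{d+1}$ and $\theta(x,y)=\arccos\langle x,y\rangle$ the geodesic distance on it. $\Psi_d$ is the class of all continuous functions $\psi:[0,\pi]\to\mathbb R$ such that $k(x,y)=\psi(\theta(x,y))$ is a kernel on $\mathbb S^d$ (the isotropic kernel on $\mathbb S^d$ induced by $\psi$); $\Psi_d^+\subset\Psi_d$ is the class of those $\psi$ for which this kernel on $\mathbb S^d$ is strictly positive definite. One has $\Psi_{d+1}\subset\Psi_d$ and $\Psi_{d+1}^+\subset\Psi_d^+$. A continuous kernel on $\mathbb S^d$ with reproducing kernel Hilbert space $H$ is universal if $H$ is dense in $C(\mathbb S^d)$ in the supremum norm. A bounded measurable kernel with RKHS $H$ is characteristic if $P\mapsto\int k(\cdot,x)\,\mathrm dP(x)\in H$ (Pettis integral) is injective on the set of Borel probability measures on $\mathbb S^d$. *)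

(* Defs.v *)
From HB Require Import structures.
From mathcomp Require Import all_boot all_order all_algebra.
From mathcomp Require Import all_classical all_reals all_analysis.
Set Implicit Arguments.
Unset Strict Implicit.
Unset Printing Implicit Defensive.
Import Order.TTheory GRing.Theory Num.Theory.
Import numFieldNormedType.Exports.
Local Open Scope classical_set_scope.
Local Open Scope ring_scope.

Definition is_kernel (R : realType) (X : Type) (k : X -> X -> R) : Prop :=
  (forall x y, k x y = k y x) /\
  forall (n : nat) (a : 'I_n -> R) (x : 'I_n -> X),
    0 <= \sum_(i < n) \sum_(j < n) a i * a j * k (x i) (x j).

Definition strictly_positive_definite (R : realType) (X : Type)
    (k : X -> X -> R) : Prop :=
  is_kernel k /\
  forall (n : nat) (a : 'I_n -> R) (x : 'I_n -> X), injective x ->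
    \sum_(i < n) \sum_(j < n) a i * a j * k (x i) (x j) = 0 ->
    forall i, a i = 0.

(* A Hilbert space of functions with reproducing kernel k; by Moore-Aronszajn
   every kernel has exactly one.  The inner product is only constrained on the carrier; its values on other
   functions play no role. *)
Record rkhs (R : realType) (X : Type) (k : X -> X -> R) := RKHS {
  rkhs_carrier : set (X -> R);
  rkhs_dot : (X -> R) -> (X -> R) -> R;
  rkhs_zero : rkhs_carrier (fun=> 0);
  rkhs_linear : forall (a : R) f g, rkhs_carrier f -> rkhs_carrier g ->
    rkhs_carrier (fun x => a * f x + g x);
  rkhs_dotC : forall f g, rkhs_carrier f -> rkhs_carrier g ->
    rkhs_dot f g = rkhs_dot g f;
  rkhs_dot_linear : forall (a : R) f g h,
    rkhs_carrier f -> rkhs_carrier g -> rkhs_carrier h ->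
    rkhs_dot (fun x => a * f x + g x) h = a * rkhs_dot f h + rkhs_dot g h;
  rkhs_dot_ge0 : forall f, rkhs_carrier f -> 0 <= rkhs_dot f f;
  rkhs_dot_eq0 : forall f, rkhs_carrier f -> rkhs_dot f f = 0 ->
    f = (fun=> 0);
  rkhs_complete : forall u : nat -> X -> R, (forall n, rkhs_carrier (u n)) ->
    (forall e : R, 0 < e -> exists N : nat, forall m n : nat,
      (N <= m)%N -> (N <= n)%N ->
      Num.sqrt (rkhs_dot (u m \- u n) (u m \- u n)) < e) ->
    exists2 f, rkhs_carrier f &
      (fun n => Num.sqrt (rkhs_dot (u n \- f) (u n \- f))) @ \oo --> (0 : R);
  rkhs_kernel : forall x, rkhs_carrier (fun y => k y x);
  rkhs_reproducing : forall f x, rkhs_carrier f ->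
    rkhs_dot f (fun y => k y x) = f x }.

Definition rkhs_norm (R : realType) (X : Type) (k : X -> X -> R)
    (H : rkhs k) (f : X -> R) : R :=
  Num.sqrt (rkhs_dot H f f).

Definition universal (R : realType) (X : topologicalType) (k : X -> X -> R)
    (H : rkhs k) : Prop :=
  continuous (fun p : X * X => k p.1 p.2) /\
  (forall h, rkhs_carrier H h -> continuous h) /\
  forall f : X -> R, continuous f -> forall e : R, 0 < e ->
    exists2 h, rkhs_carrier H h & forall x, `|f x - h x| <= e.

Definition continuous_functional (R : realType) (X : Type) (k : X -> X -> R)
    (H : rkhs k) (L : (X -> R) -> R) : Prop :=
  (forall (a : R) f g, rkhs_carrier H f -> rkhs_carrier H g ->
     L (fun x => a * f x + g x) = a * L f + L g) /\
  exists C : R, forall f, rkhs_carrier H f -> `|L f| <= C * rkhs_norm H f.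

(* h is the Pettis integral of the H-valued map x |-> k(., x) against P. *)
Definition is_kernel_embedding (R : realType) (disp : measure_display)
    (X : measurableType disp) (k : X -> X -> R) (H : rkhs k)
    (P : probability X R) (h : X -> R) : Prop :=
  rkhs_carrier H h /\
  forall L, continuous_functional H L ->
    P.-integrable setT (fun x => (L (fun y => k y x))%:E) /\
    L h = \int[P]_x L (fun y => k y x).

(* For a bounded measurable kernel the Pettis integral exists and is unique,
   so [is_kernel_embedding H] is the graph of a total map on probability
   measures and the last clause is its injectivity. *)
Definition characteristic (R : realType) (disp : measure_display)
    (X : measurableType disp) (k : X -> X -> R) (H : rkhs k) : Prop :=
  (exists M : R, forall x y, `|k x y| <= M) /\
  measurable_fun setT (fun p : X * X => k p.1 p.2) /\
  forall (P Q : probability X R) (h : X -> R),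
    is_kernel_embedding H P h -> is_kernel_embedding H Q h ->
    forall A, measurable A -> P A = Q A.

Definition inner (R : realType) (n : nat) (x y : 'rV[R]_n) : R :=
  \sum_(i < n) x ord0 i * y ord0 i.

(* As a [set_type], the sphere carries the subspace topology. *)
Definition sphere (R : realType) (d : nat) : Type :=
  set_type [set x : 'rV[R]_d.+1 | inner x x = 1].

HB.instance Definition _ (R : realType) (d : nat) :=
  Topological.copy (sphere R d) (set_type [set x : 'rV[R]_d.+1 | inner x x = 1]).

Lemma inner_pole (R : realType) (d : nat) :
  (delta_mx ord0 ord0 : 'rV[R]_d.+1) \in
    [set x : 'rV[R]_d.+1 | inner x x = 1].
Proof.
rewrite inE /= /inner (bigD1 ord0) //= !mxE !eqxx mulr1 big1 ?addr0 // => i i0.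
by rewrite !mxE (negbTE i0) mulr0.
Qed.

(* Generated sigma-algebras are only available on pointed types. *)
HB.instance Definition _ (R : realType) (d : nat) :=
  isPointed.Build (sphere R d) (SigSub (inner_pole R d)).

Definition borel_sphere (R : realType) (d : nat) :
    measurableType (@open (sphere R d)).-sigma :=
  g_sigma_algebraType (@open (sphere R d)).

Definition geodesic (R : realType) (d : nat) (x y : sphere R d) : R :=
  acos (inner (val x) (val y)).

Definition isotropic_kernel (R : realType) (d : nat) (psi : R -> R)
    (x y : sphere R d) : R :=
  psi (geodesic x y).

(* Elements of Psi_d are functions on [0, pi]; they are represented by
   functions on R whose values outside [0, pi] play no role. *)
Definition Psi (R : realType) (d : nat) : set (R -> R) :=
  [set psi | {within `[0, pi], continuous psi} /\
             is_kernel (@isotropic_kernel R d psi)].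

Definition Psi_plus (R : realType) (d : nat) : set (R -> R) :=
  [set psi | Psi d psi /\
             strictly_positive_definite (@isotropic_kernel R d psi)].

(* Main.v *)
Require Import Defs.
From mathcomp Require Import all_boot all_order all_algebra.
From mathcomp Require Import all_classical all_reals all_analysis.
From mathcomp Require Import finmap measurable_realfun.
From mathcomp Require Import zify ring lra.

(* Write k(x, y) = g(<x, y>).  Both hypotheses say that k is positive
   semidefinite on S^(d+1), and this together with strict positive definiteness
   on S^d implies universality.  A section k(x, .) with x in S^(d+1), restricted
   to the equator S^d, is a uniform limit of elements of H.  Averaging these
   sections over S^(d+1) with the weights <w, x>^n <z, x>^(2i), z the pole and w
   in the hyperplane of S^d, gives functions of y in the closure of H that are
   polynomials in <w, y> of degree n, whose leading coefficient lam n i g does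
   not depend on w.  If for each n some lam n i g is nonzero, all powers
   <w, .>^n are in the closure of H, which is then C(S^d).  If for some n all
   lam n i g vanish, then g(t) + (-1)^n g(-t) is orthogonal, for the projection
   of the uniform measure to an axis, to polynomials of every degree n + 2i, so
   it is a polynomial of degree less than n; then x |-> k(x, .) + (-1)^n k(-x, .)
   has finite rank on a great circle and k is not strictly positive definite.

   The mean over the sphere is not a Haar measure: it is a limit of finitely
   supported probability measures that nearly minimise the energy of the kernel
   exp <x, y>; by the parallelogram identity they are nearly invariant under
   reflections. *)

Set Implicit Arguments.
Unset Strict Implicit.
Unset Printing Implicit Defensive.
Import Order.TTheory GRing.Theory Num.Theory.
Import numFieldNormedType.Exports.
Local Open Scope classical_set_scope.
Local Open Scope ring_scope.

(** * Uniform closures and the Stone-Weierstrass theorem *)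

Section UniformClosure.
Context {R : realType} {T : Type}.
Implicit Types (B : set (T -> R)) (f g h : T -> R).

(** In terms of Gegenbauer expansions, universality on S^d asks that every coefficient of the
    profile be positive, while strict positive definiteness asks for much less. The extra dimension
    bridges this gap: for a kernel on S^(d+1), the coefficient of order n on S^d is a positive
    combination of the coefficients of orders n + 2i on S^(d+1). If one of the former vanishes, all
    of the latter do, and only finitely many coefficients of the parity of n remain. The weights <z,
    x>^(2i) express this by moments, without spherical harmonics.

    The other implications are soft. A null quadratic form is a finite signed measure that
    integrates every element of H to 0, against density. Equal embeddings give equal integrals on H,
    hence on all continuous functions. Since a characteristic kernel compares only measures of equal
    mass, a null combination is replaced by its difference with a mirror image. *)

Definition uclosure B : set (T -> R) :=
  [set f | forall e : R, 0 < e -> exists2 h, B h & forall x, `|f x - h x| <= e].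

Lemma sub_uclosure B : B `<=` uclosure B.
Proof. by move=> f Bf e e0; exists f => // x; rewrite subrr normr0 ltW. Qed.

Lemma uclosure_id B f : uclosure (uclosure B) f -> uclosure B f.
Proof.
move=> Bf e e0; have e2 : 0 < e / 2 by rewrite divr_gt0.
have [g Bg fg] := Bf _ e2; have [h Bh gh] := Bg _ e2.
exists h => // x; rewrite (splitr e) -(subrKA (g x)).
by rewrite (le_trans (ler_normD _ _))// lerD.
Qed.

Definition lin_closed B := forall (a : R) f g, B f -> B g -> B (fun x => a * f x + g x).

Lemma uclosure_lin B : lin_closed B -> lin_closed (uclosure B).
Proof.
move=> linB a f g Bf Bg e e0.
have e1 : 0 < e / (`|a| + 1) by rewrite divr_gt0 // ltr_wpDl.
have e2 : 0 < e / (`|a| + 1) / 2 by rewrite divr_gt0.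
have [f' Bf' ff'] := Bf _ e2; have e3 : 0 < e / 2 by rewrite divr_gt0.
have [g' Bg' gg'] := Bg _ e3.
exists (fun x => a * f' x + g' x); first exact: linB.
move=> x; have -> : a * f x + g x - (a * f' x + g' x) =
  a * (f x - f' x) + (g x - g' x) by ring.
rewrite (le_trans (ler_normD _ _))// (splitr e) lerD // normrM.
apply: le_trans (_ : (`|a| + 1) * (e / (`|a| + 1) / 2) <= _).
  by rewrite ler_pM // lerDl.
by rewrite mulrA mulrCA divff ?mulr1// gt_eqF // ltr_wpDl.
Qed.

Lemma lin_closed0 B f : lin_closed B -> B f -> B (fun=> 0).
Proof.
move=> linB Bf; suff -> : (fun=> 0) = (fun x => (-1) * f x + f x) :> (T -> R).
  exact: linB.
by apply/funext => x; rewrite mulN1r addNr.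
Qed.

Lemma lin_closed_sum B (I : Type) (r : seq I) (P : pred I) (c : I -> R) (F : I -> T -> R) :
  lin_closed B -> B (fun=> 0) -> (forall i, P i -> B (F i)) ->
  B (fun x => \sum_(i <- r | P i) c i * F i x).
Proof.
move=> linB B0 BF; elim: r => [|i r IH].
  by rewrite (_ : (fun _ => _) = fun=> 0)//; apply/funext => x; rewrite big_nil.
have [Pi|Pi] := boolP (P i); last first.
  rewrite (_ : (fun _ => _) = fun x => \sum_(i <- r | P i) c i * F i x)//.
  by apply/funext => x; rewrite big_cons (negbTE Pi).
rewrite (_ : (fun _ => _) = fun x => c i * F i x + \sum_(i <- r | P i) c i * F i x).
  by apply: linB => //; exact: BF.
by apply/funext => x; rewrite big_cons Pi.
Qed.

End UniformClosure.

(** Here [s] is half of [|c|]. One step multiplies the error [|c| - u] by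
    [1 - (|c| + u) / 2 <= 1 - s], and [(1 - s)(1 + (n + 1) s) <= 1 + n s]. The invariant bounds the
    error by [|c| / (1 + n |c| / 2)], hence uniformly in [c], although the contraction factor tends
    to 1 at [c = 0]. *)
Lemma abs_approx_step (R : realType) (c u s : R) (n : nat) :
  0 <= s -> s <= 2^-1 -> 2 * s = `|c| ->
  0 <= u <= `|c| -> (`|c| - u) * (1 + n%:R * s) <= `|c| ->
  let u' := u + (c ^+ 2 - u ^+ 2) / 2 in
  0 <= u' <= `|c| /\ (`|c| - u') * (1 + n.+1%:R * s) <= `|c|.
Proof.
move=> s0 s1 sc /andP[u0 uc] H /=.
rewrite -(real_normK (num_real c)) -sc in uc H *.
have n0 : (0 : R) <= n%:R by [].
rewrite -[n.+1%:R]natr1; set N := n%:R in H n0 *.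
have d0 : 0 <= 2 * s - u by rewrite subr_ge0.
have e0 : 0 <= 1 - (2 * s + u) / 2 by lra.
split.
  apply/andP; split.
    have -> : u + ((2 * s) ^+ 2 - u ^+ 2) / 2 = u + (2 * s - u) * (2 * s + u) / 2 by ring.
    by rewrite addr_ge0// divr_ge0// mulr_ge0// addr_ge0// mulr_ge0.
  rewrite -subr_ge0.
  have -> : 2 * s - (u + ((2 * s) ^+ 2 - u ^+ 2) / 2) = (2 * s - u) * (1 - (2 * s + u) / 2) by field.
  exact: mulr_ge0.
have -> : 2 * s - (u + ((2 * s) ^+ 2 - u ^+ 2) / 2) = (2 * s - u) * (1 - (2 * s + u) / 2) by field.
have A : (1 - (2 * s + u) / 2) * (1 + (N + 1) * s) <= 1 + N * s.
  have B : (1 - (2 * s + u) / 2) * (1 + (N + 1) * s) <= (1 - s) * (1 + (N + 1) * s).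
    rewrite ler_wpM2r //; last lra.
    by rewrite addr_ge0// mulr_ge0// addr_ge0.
  apply: le_trans B _.
  have -> : (1 - s) * (1 + (N + 1) * s) = 1 + N * s - (N + 1) * (s * s) by ring.
  by rewrite gerBl mulr_ge0 ?addr_ge0 ?mulr_ge0.
rewrite -mulrA; apply: le_trans H.
exact: ler_wpM2l.
Qed.

Section StoneWeierstrass.
Context {R : realType} {T : ptopologicalType}.
Hypothesis cptT : compact [set: T].
Implicit Types (B : set (T -> R)) (f g h : T -> R).

Lemma compact_fun_bounded f : continuous f -> exists2 C : R, 0 < C & forall x, `|f x| <= C.
Proof.
move=> cf.
have cimg : compact (f @` setT).
  by apply: continuous_compact => //; exact: continuous_subspaceT.
have [M [_ HM]] := compact_bounded cimg.
exists (`|M| + 1); first by rewrite ltr_wpDl.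
move=> x; apply: HM; last by exists x.
by rewrite (le_lt_trans (ler_norm _))// ltrDl.
Qed.

(** That [k] agrees at each point with some [h i] transfers to [k] any value or upper bound common
    to all the [h i]. Applied to negated functions, this also yields finite infima. *)
Lemma lattice_finite_sup (L : set (T -> R)) (I : eqType) (i0 : I) (s : seq I) (h : I -> T -> R) :
  (forall f g, L f -> L g -> L (fun x => Num.max (f x) (g x))) ->
  (forall i, i \in i0 :: s -> L (h i)) ->
  exists2 k, L k & (forall i, i \in i0 :: s -> forall x, h i x <= k x) /\
     (forall x, exists2 i, i \in i0 :: s & k x = h i x).
Proof.
move=> Lmax; elim: s i0 => [|j s IH] i0 Lh.
  exists (h i0); first by apply: Lh; rewrite mem_head.
  by split=> [i|x]; [rewrite inE => /eqP ->|exists i0; rewrite ?mem_head].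
have [|k Lk [k1 k2]] := IH j; first by move=> i si; apply: Lh; rewrite in_cons si orbT.
exists (fun x => Num.max (h i0 x) (k x)).
  by apply: Lmax => //; apply: Lh; rewrite mem_head.
split=> [i|x].
  rewrite in_cons => /orP[/eqP -> x|si x]; rewrite le_max ?lexx //.
  by rewrite k1 ?orbT.
case: (leP (h i0 x) (k x)) => hk; last by exists i0; rewrite ?mem_head.
by have [i si ->] := k2 x; exists i => //; rewrite in_cons si orbT.
Qed.

Lemma stone_lattice (L : set (T -> R)) f :
  (forall f g, L f -> L g -> L (fun x => Num.max (f x) (g x))) ->
  (forall f g, L f -> L g -> L (fun x => Num.min (f x) (g x))) ->
  (forall h, L h -> continuous h) -> L !=set0 -> continuous f ->
  (forall x y, exists2 h, L h & h x = f x /\ h y = f y) ->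
  uclosure L f.
Proof.
move=> Lmax Lmin Lc [h0 Lh0] cf two e e0.
have [x0|noT] := pselect (exists x0 : T, True); last first.
  by exists h0 => // x; exfalso; apply: noT; exists x.
have copen (u v : T -> R) : continuous u -> continuous v -> open [set x | u x < v x].
  move=> cu cv.
  rewrite (_ : [set x | _] = (fun x => v x - u x) @^-1` [set y | 0 < y]); last first.
    by apply/seteqP; split=> x /=; rewrite subr_gt0.
  apply: open_comp; last exact: open_gt.
  by move=> x _; apply: cvgB; [exact: cv|exact: cu].
have ce (u : T -> R) (c : R) : continuous u -> continuous (fun x => u x + c).
  by move=> cu x; apply: cvgD; [exact: cu|exact: cvg_cst].
(* For fixed [x], a function interpolating [f] at [x] and [y] exceeds [f - e] near [y]; a finite
   supremum exceeds it everywhere and still equals [f x] at [x]. *)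
have stepA x : exists2 h, L h & h x = f x /\ forall y, f y - e < h y.
  have /choice[h hP] : forall y, exists h, [/\ L h, h x = f x & h y = f y].
    by move=> y; have [h Lh [hx hy]] := two x y; exists h.
  have := cptT; rewrite compact_cover => /(_ T setT (fun y => [set z | f z - e < h y z])).
  case=> [y _||D _ Dc].
  - by apply: copen; [exact: ce|apply: Lc; case: (hP y)].
  - move=> y _; exists y => //=; case: (hP y) => _ _ ->.
    by rewrite ltrBlDr ltrDl.
  have [i0 iD0 _] := Dc x I.
  have [|k Lk [k1 k2]] := @lattice_finite_sup L T i0 (enum_fset D) h Lmax.
    by move=> i _; case: (hP i).
  exists k => //; split; first by have [i _ ->] := k2 x; case: (hP i).
  move=> y; have [i iD fi] := Dc y I.
  by apply: lt_le_trans fi _; apply: k1; rewrite in_cons iD orbT.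
have /choice[h hP] : forall x, exists h, [/\ L h, h x = f x & forall y, f y - e < h y].
  by move=> x; have [h Lh [hx hy]] := stepA x; exists h.
(* The functions of the first step lie below [f + e] near their own [x]; a finite infimum lies below
   it everywhere. *)
have := cptT; rewrite compact_cover => /(_ T setT (fun x => [set z | h x z < f z + e])).
case=> [y _||D _ Dc].
- by apply: copen; [apply: Lc; case: (hP y)|exact: ce].
- by move=> y _; exists y => //=; case: (hP y) => _ -> _; rewrite ltrDl.
have [x _] := x0; have [i0 iD0 _] := Dc x I.
have [f' g' | i _|k Lk [k1 k2]] :=
    @lattice_finite_sup [set u | L (fun x => - u x)] T i0 (enum_fset D) (fun i x => - h i x).
- move=> Lf' Lg' /=; rewrite (_ : (fun x => _) = fun x => Num.min (- f' x) (- g' x)); last first.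
    by apply/funext => z; rewrite oppr_max.
  exact: Lmin.
- rewrite /= (_ : (fun x => _) = h i); first by case: (hP i).
  by apply/funext => z; rewrite opprK.
exists (fun x => - k x) => // z; rewrite ler_norml; apply/andP; split; last first.
  have [i _ ->] := k2 z; rewrite opprK; have [_ _ /(_ z)] := hP i; lra.
have [i iD /= fi] := Dc z I.
have := k1 i; rewrite in_cons iD orbT => /(_ isT z); lra.
Qed.

(* [|c|] is the uniform limit on [|c| <= 1] of the polynomials defined by
   [u' = u + (c^2 - u^2)/2], with error at most [2 / (n + 1)]. *)
Lemma uclosure_norm B f :
  lin_closed B -> (forall f g, B f -> B g -> B (fun x => f x * g x)) ->
  (forall h, B h -> continuous h) -> B (fun=> 0) -> uclosure B f -> uclosure B (fun x => `|f x|).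
Proof.
move=> linB mulB cB B0 Bf; apply: uclosure_id => e e0.
have [b Bb fb] := Bf _ e0; exists (fun x => `|b x|); last first.
  by move=> x; apply: le_trans (ler_dist_dist _ _) (fb x).
have [C C0 bC] := compact_fun_bounded (cB _ Bb).
pose c x := b x / C.
have Bc : B c.
  have := linB C^-1 b _ Bb B0; congr B.
  by apply/funext => x; rewrite /c addr0 mulrC.
have c1 x : `|c x| <= 1 by rewrite normrM normfV (gtr0_norm C0) ler_pdivrMr// mul1r.
suff Lc : uclosure B (fun x => `|c x|).
  move=> {e e0 fb} e e0.
  have [|h Bh ch] := Lc (e / C); first exact: divr_gt0.
  exists (fun x => C * h x).
    have := linB C h _ Bh B0; congr B.
    by apply/funext => x; rewrite addr0.
  move=> x; have -> : `|b x| = C * `|c x|.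
    by rewrite normrM normfV (gtr0_norm C0) mulrCA divff ?mulr1 ?gt_eqF.
  rewrite -mulrBr normrM (gtr0_norm C0).
  by rewrite -ler_pdivlMl// mulrC; exact: ch.
pose u := fix u n x := if n is n'.+1 then u n' x + (c x ^+ 2 - u n' x ^+ 2) / 2 else 0.
have Bu n : B (u n).
  elim: n => [//|n IH].
  have -> : u n.+1 = fun x => (- 2^-1) * (u n x * u n x) + (2^-1 * (c x * c x) + u n x).
    by apply/funext => x /=; field.
  by apply: (linB) => //; [exact: mulB|apply: linB => //; exact: mulB].
have uP n x : 0 <= u n x <= `|c x| /\ (`|c x| - u n x) * (1 + n%:R * (`|c x| / 2)) <= `|c x|.
  elim: n => [|n [IH1 IH2]]; first by rewrite /= lexx normr_ge0 subr0 mul0r addr0 mulr1.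
  apply: (@abs_approx_step _ (c x) (u n x) (`|c x| / 2) n) => //.
  - by rewrite ler_pdivrMr// mulVf ?c1 // pnatr_eq0.
  - by rewrite mulrCA divff ?mulr1 // pnatr_eq0.
move=> {e e0 fb} e e0.
pose n := (Num.truncn (2 / e)).+1.
have ne : 2 / e < n%:R by rewrite /n truncnS_gt.
exists (u n) => // x.
have [/andP[u0 uc] H] := uP n x.
rewrite ger0_norm ?subr_ge0//.
have [->|cx0] := eqVneq (`|c x|) 0; first by apply: le_trans (ltW e0); rewrite gerBl.
have cx : 0 < `|c x| by rewrite lt_def cx0 /=.
rewrite ltr_pdivrMr// in ne.
have A : 0 <= `|c x| - u n x by rewrite subr_ge0.
set r := `|c x| - u n x in A H *.
rewrite leNgt; apply/negP => re.
have : `|c x| < r * (1 + n%:R * (`|c x| / 2)).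
  apply: lt_le_trans (_ : r * (n%:R * (`|c x| / 2)) <= _); last first.
    by rewrite ler_wpM2l// lerDr.
  have -> : r * (n%:R * (`|c x| / 2)) = (n%:R * r / 2) * `|c x| by field.
  rewrite -[ltLHS]mul1r ltr_pM2r// ltr_pdivlMr// mul1r (lt_trans ne)//.
  by rewrite ltr_pM2l.
by move=> /lt_le_trans/(_ H); rewrite ltxx.
Qed.

(** [B] is asked to separate only the points that [f] separates, so that functions factoring through
    one coordinate are covered too. The closure of [B] is a lattice because it contains absolute
    values, and an affine function of a separating [h] interpolates [f] at two points. *)
Theorem stone_weierstrass B f :
  lin_closed B -> (forall f g, B f -> B g -> B (fun x => f x * g x)) ->
  (forall h, B h -> continuous h) -> B (fun=> 1) -> continuous f ->
  (forall x y, f x != f y -> exists2 h, B h & h x != h y) ->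
  uclosure B f.
Proof.
move=> linB mulB cB B1 cf sep.
have B0 : B (fun=> 0) := lin_closed0 linB B1.
have linL := uclosure_lin linB.
have L0 := sub_uclosure B0; have L1 := sub_uclosure B1.
have Labs h := @uclosure_norm B h linB mulB cB B0.
have LZ a h : uclosure B h -> uclosure B (fun x => a * h x).
  move=> Lh; have := linL a h _ Lh L0; congr uclosure.
  by apply/funext => x; rewrite addr0.
have LD g h : uclosure B g -> uclosure B h -> uclosure B (fun x => g x + h x).
  move=> Lg Lh; have := linL 1 g h Lg Lh; congr uclosure.
  by apply/funext => x; rewrite mul1r.
have cL h : uclosure B h -> continuous h.
  move=> Lh x; apply/cvgrPdist_le => /= e e0.
  have e3 : 0 < e / 3 by rewrite divr_gt0.
  have [b Bb hb] := Lh _ e3.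
  have /cvgrPdist_le /(_ _ e3) := cB _ Bb x; apply: filterS => y bxy.
  have -> : h x - h y = (h x - b x) + (b x - b y) - (h y - b y) by ring.
  apply: le_trans (ler_normB _ _) _; apply: le_trans (lerD (ler_normD _ _) (lexx _)) _.
  by move: (hb x) (hb y) bxy; lra.
apply: uclosure_id; apply: stone_lattice => //.
- move=> g h Lg Lh.
  have := LZ 2^-1 _ (LD _ _ (LD _ _ Lg Lh) (Labs _ (linL (-1) _ _ Lh Lg))).
  congr (_ _ _); apply/funext => x.
  by rewrite maxr_absE mulrC mulN1r [_ + g x]addrC.
- move=> g h Lg Lh.
  have := LZ 2^-1 _ (linL (-1) _ _ (Labs _ (linL (-1) _ _ Lh Lg)) (LD _ _ Lg Lh)).
  congr (_ _ _); apply/funext => x.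
  by rewrite minr_absE mulrC !mulN1r [_ + g x]addrC [_ + (_ + _)]addrC.
- by exists (fun=> 0).
- move=> x y; have [fxy|fxy] := eqVneq (f x) (f y).
    exists (fun=> f x); last by split => //; rewrite fxy.
    have := LZ (f x) _ L1; congr (_ _ _); apply/funext => z.
    by rewrite mulr1.
  have [h Bh hxy] := sep _ _ fxy.
  pose a := (f x - f y) / (h x - h y).
  exists (fun z => a * h z + (f x - a * h x) * 1).
    by apply: LD; [apply: LZ; exact: sub_uclosure|exact: LZ].
  by rewrite mulr1 /a; split; field; rewrite subr_eq0.
Qed.

End StoneWeierstrass.

(** * The sphere *)

Section Inner.
Context {R : realType} {n : nat}.
Implicit Types (x y z : 'rV[R]_n) (a : R).

Lemma innerC x y : inner x y = inner y x.
Proof. by apply: eq_bigr => i _; rewrite mulrC. Qed.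

Lemma innerDl x y z : inner (x + y) z = inner x z + inner y z.
Proof. by rewrite -big_split; apply: eq_bigr => i _; rewrite mxE mulrDl. Qed.

Lemma innerZl a x y : inner (a *: x) y = a * inner x y.
Proof. by rewrite /inner mulr_sumr; apply: eq_bigr => i _; rewrite mxE mulrA. Qed.

Lemma innerNl x y : inner (- x) y = - inner x y.
Proof. by rewrite -scaleN1r innerZl mulN1r. Qed.

Lemma innerBl x y z : inner (x - y) z = inner x z - inner y z.
Proof. by rewrite innerDl innerNl. Qed.

Lemma innerDr x y z : inner z (x + y) = inner z x + inner z y.
Proof. by rewrite innerC innerDl !(innerC z). Qed.

Lemma innerZr a x y : inner y (a *: x) = a * inner y x.
Proof. by rewrite innerC innerZl (innerC y). Qed.

Lemma innerNr x y : inner y (- x) = - inner y x.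
Proof. by rewrite innerC innerNl (innerC y). Qed.

Lemma innerBr x y z : inner z (x - y) = inner z x - inner z y.
Proof. by rewrite innerDr innerNr. Qed.

Lemma inner_ge0 x : 0 <= inner x x.
Proof. by rewrite /inner sumr_ge0 // => i _; rewrite -expr2 sqr_ge0. Qed.

Lemma inner_eq0 x : (inner x x == 0) = (x == 0).
Proof.
apply/idP/eqP => [|->]; last first.
  by rewrite /inner big1 // => i _; rewrite mxE mul0r.
rewrite psumr_eq0 => [/allP H|i _]; last by rewrite -expr2 sqr_ge0.
apply/rowP => i; apply/eqP; rewrite mxE.
by have := H i (mem_index_enum _); rewrite /= mulf_eq0 orbb.
Qed.

Lemma inner0l x : inner 0 x = 0.
Proof. by rewrite -(scale0r 0) innerZl mul0r. Qed.

Lemma inner0r x : inner x 0 = 0.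
Proof. by rewrite innerC inner0l. Qed.

Lemma inner_gt0 x : (0 < inner x x) = (x != 0).
Proof. by rewrite lt_def inner_eq0 inner_ge0 andbT. Qed.

Lemma inner_delta x i : inner x (delta_mx ord0 i) = x ord0 i.
Proof.
rewrite /inner (bigD1 i) //= mxE !eqxx mulr1 big1 ?addr0// => j ji.
by rewrite mxE (negbTE ji) mulr0.
Qed.

(** The reflection in the hyperplane orthogonal to [a], which need not be a unit vector. For [a = 0]
    it is the identity, so [refl (x - y)] carries [x] to [y] also when [x = y]. *)
Definition refl (a : 'rV[R]_n) x := x - (2 * inner x a / inner a a) *: a.

Lemma inner_refl (a : 'rV[R]_n) x y : inner (refl a x) (refl a y) = inner x y.
Proof.
have [->|a0] := eqVneq a 0; first by rewrite /refl !scaler0 !subr0.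
rewrite /refl innerBl !innerBr !innerZl !innerZr (innerC a y).
by field; rewrite inner_eq0.
Qed.

Lemma inner_refl_sym (a : 'rV[R]_n) x y : inner (refl a x) y = inner x (refl a y).
Proof. by rewrite /refl innerBl innerBr innerZl innerZr (innerC a y); ring. Qed.

Lemma refl_orth (a : 'rV[R]_n) x : inner x a = 0 -> refl a x = x.
Proof. by move=> xa; rewrite /refl xa mulr0 mul0r scale0r subr0. Qed.

Lemma refl_swap x y : inner x x = inner y y -> refl (x - y) x = y.
Proof.
move=> xy; have [->|xy0] := eqVneq x y; first by rewrite /refl subrr scaler0 subr0.
rewrite /refl (_ : _ / _ = 1) ?scale1r ?subKr //.
have -> : 2 * inner x (x - y) = inner (x - y) (x - y).
  by rewrite innerBl !innerBr -xy (innerC y x); ring.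
by rewrite divff// inner_eq0 subr_eq0.
Qed.

Lemma refl_invol (a : 'rV[R]_n) x : refl a (refl a x) = x.
Proof.
have [->|a0] := eqVneq a 0; first by rewrite /refl !scaler0 !subr0.
have aa : inner a a != 0 by rewrite inner_eq0.
rewrite {1}/refl (_ : _ / _ = - (2 * inner x a / inner a a)).
  by rewrite scaleNr opprK /refl subrK.
by rewrite /refl innerBl innerZl; field.
Qed.

End Inner.

Lemma continuous_sum_ffun (R : realType) (X : topologicalType) (I : Type) (r : seq I)
    (F : I -> X -> R) :
  (forall i, continuous (F i)) -> continuous (fun x => \sum_(i <- r) F i x).
Proof.
move=> cF; elim: r => [|i r IH] x.
  rewrite (_ : (fun _ => _) = fun=> 0); first exact: cvg_cst.
  by apply/funext => y; rewrite big_nil.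
rewrite (_ : (fun _ => _) = (F i \+ (fun x => \sum_(j <- r) F j x))); last first.
  by apply/funext => y; rewrite big_cons.
by apply: continuousD; [exact: cF|exact: IH].
Qed.

Lemma continuous_inner (R : realType) (X : topologicalType) n (f g : X -> 'rV[R]_n) :
  continuous f -> continuous g -> continuous (fun x => inner (f x) (g x)).
Proof.
move=> cf cg; apply: continuous_sum_ffun => i x; apply: continuousM.
  apply: (@continuous_comp _ _ _ f (fun v : 'rV[R]_n => v ord0 i)); first exact: cf.
  exact: coord_continuous.
apply: (@continuous_comp _ _ _ g (fun v : 'rV[R]_n => v ord0 i)); first exact: cg.
exact: coord_continuous.
Qed.

Section Sphere.
Context {R : realType} {d : nat}.
Implicit Types (x y : sphere R d).

Lemma sphereP x : inner (val x) (val x) = 1.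
Proof. by case: x => v vS; exact: (set_mem vS). Qed.

Definition mksphere (v : 'rV[R]_d.+1) (vv : inner v v = 1) : sphere R d :=
  exist _ v (mem_set vv).

Lemma continuous_val : continuous (val : sphere R d -> 'rV[R]_d.+1).
Proof. exact: initial_continuous. Qed.

Lemma inner_itv x y : -1 <= inner (val x) (val y) <= 1.
Proof.
have := inner_ge0 (val x + val y); have := inner_ge0 (val x - val y).
rewrite !innerBl !innerBr !innerDl !innerDr !sphereP (innerC (val y)).
by move=> ? ?; apply/andP; split; lra.
Qed.

Lemma continuous_to_sphere (X : topologicalType) (f : X -> sphere R d) :
  continuous (val \o f) -> continuous f.
Proof. by move=> cf; apply: continuous_comp_initial. Qed.

Lemma sphere_compact : compact [set: sphere R d].
Proof.
have cS : compact [set x : 'rV[R]_d.+1 | inner x x = 1].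
  apply: bounded_closed_compact.
    exists 1; split=> [|M M1 x /= xx]; first exact: num_real.
    apply: le_trans (ltW M1).
    rewrite [leLHS]/Num.norm /= mx_normrE; apply: bigmax_le => // -[i j] _ /=.
    rewrite ord1 -(@ler_pXn2r _ 2)// ?nnegrE// expr1n real_normK ?num_real// -xx.
    rewrite /inner (bigD1 j)//= expr2 lerDl sumr_ge0// => k _.
    by rewrite -expr2 sqr_ge0.
  rewrite (_ : [set x | _] = (fun x : 'rV[R]_d.+1 => inner x x) @^-1` [set 1]) //.
  apply: closed_comp; last exact: closed_eq.
  by move=> x _; apply: continuous_inner => y.
move=> F PF _.
have FS : (val @ F) [set x : 'rV[R]_d.+1 | inner x x = 1].
  rewrite /= /nbhs /= (_ : _ @^-1` _ = setT); first exact: filterT.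
  by apply/seteqP; split => // x _; exact: sphereP.
have [p [pS Fp]] := cS (val @ F) _ FS.
exists (mksphere pS); split => // A U FA [? /= [[B Bop <-]]] /= Bp BU.
have FA' : (val @ F) (val @` A) by apply: (@filterS _ F _ A) => // a Aa; exists a.
have [_ [[a Aa <-] Ba]] := Fp _ _ FA' (open_nbhs_nbhs (conj Bop Bp)).
by exists a; split => //; exact: BU.
Qed.

Definition srefl (a : 'rV[R]_d.+1) x : sphere R d :=
  mksphere (etrans (inner_refl a (val x) (val x)) (sphereP x)).

Lemma continuous_linear_form (w : 'rV[R]_d.+1) : continuous (fun x => inner w (val x)).
Proof.
apply: (@continuous_inner _ _ _ (fun=> w) (val : sphere R d -> _)).
  exact: cst_continuous.
exact: continuous_val.
Qed.

Lemma continuous_srefl a : continuous (srefl a).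
Proof.
apply: continuous_to_sphere => x.
have cl : {for x, continuous (fun z : sphere R d => 2 * inner (val z) a / inner a a)}.
  apply: continuousM; last exact: cst_continuous.
  apply: continuousM; first exact: cst_continuous.
  rewrite (_ : (fun z : sphere R d => _) = (fun z => inner a (val z))).
    exact: continuous_linear_form.
  by apply/funext => z; rewrite innerC.
apply: (@continuousB _ _ _ (val : sphere R d -> 'rV[R]_d.+1)
  (fun z : sphere R d => (2 * inner (val z) a / inner a a) *: a)).
  exact: continuous_val.
by apply: continuousZ => //; exact: cst_continuous.
Qed.

Lemma srefl_swap x y : srefl (val x - val y) x = y.
Proof. by apply/val_inj => /=; apply: refl_swap; rewrite !sphereP. Qed.


(* The span of the exponentials of linear forms: an algebra, since
   [exp<w, x> * exp<w', x> = exp<w + w', x>]. *)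
Definition exp_span : set (sphere R d -> R) :=
  [set f | exists s : seq (R * 'rV[R]_d.+1),
     f = fun x => \sum_(c <- s) c.1 * expR (inner c.2 (val x))].

Lemma exp_span_lin : lin_closed exp_span.
Proof.
move=> a f g [s ->] [t ->]; exists ([seq (a * c.1, c.2) | c <- s] ++ t).
apply/funext => x; rewrite big_cat big_map mulr_sumr; congr (_ + _).
by apply: eq_bigr => c _; rewrite mulrA.
Qed.

Lemma exp_span_mul f g : exp_span f -> exp_span g -> exp_span (fun x => f x * g x).
Proof.
move=> [s ->] [t ->]; exists [seq (c.1 * c'.1, c.2 + c'.2) | c <- s, c' <- t].
apply/funext => x; rewrite big_allpairs_dep mulr_suml; apply: eq_bigr => c _.
rewrite mulr_sumr; apply: eq_bigr => c' _ /=.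
by rewrite innerDl expRD mulrACA.
Qed.

Lemma exp_span_exp w : exp_span (fun x => expR (inner w (val x))).
Proof. by exists [:: (1, w)]; apply/funext => x; rewrite big_seq1 mul1r. Qed.

Lemma exp_span_continuous f : exp_span f -> continuous f.
Proof.
move=> [s ->].
apply: (@continuous_sum_ffun _ _ _ s (fun c (z : sphere R d) => c.1 * expR (inner c.2 (val z)))) => c x.
apply: (@continuousM _ _ (fun=> c.1) (fun z : sphere R d => expR (inner c.2 (val z)))); first exact: cst_continuous.
apply: (@continuous_comp _ _ _ (fun z : sphere R d => inner c.2 (val z)) expR).
  exact: continuous_linear_form.
exact: continuous_expR.
Qed.

Lemma exp_span_dense f : continuous f -> uclosure exp_span f.
Proof.
move=> cf; apply: (stone_weierstrass sphere_compact) => //.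
- exact: exp_span_lin.
- exact: exp_span_mul.
- exact: exp_span_continuous.
- have := exp_span_exp 0; congr exp_span; apply/funext => x.
  by rewrite inner0l expR0.
- move=> x y fxy.
  (* Equal values at [x] and [y] would give [<x - y, x - y> = 0]. *)
  exists (fun z => expR (inner (val x - val y) (val z))); first exact: exp_span_exp.
  apply: contra_neq fxy => /expR_inj/eqP.
  rewrite -subr_eq0 -innerBr inner_eq0 subr_eq0 => /eqP/val_inj -> //.
Qed.

End Sphere.

(** The tail of the series at [t] is dominated term by term by the tail at [B]. *)
Lemma expR_series_uniform (R : realType) (B e : R) : 0 < e ->
  exists n, forall t, `|t| <= B -> `|expR t - \sum_(k < n) t ^+ k / k`!%:R| <= e.
Proof.
move=> e0.
have /cvgrPdist_le /(_ e e0) [n _ Hn] := @is_cvg_series_exp_coeff R B.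
exists n => t tB.
have B0 : 0 <= B := le_trans (normr_ge0 t) tB.
rewrite -(big_mkord xpredT (fun k => t ^+ k / k`!%:R)).
have key N : (n <= N)%N -> `|series (exp_coeff t) N - series (exp_coeff t) n| <= e.
  move=> nN; have := Hn n (leqnn n); rewrite ger0_norm; last first.
    rewrite subr_ge0; apply: nondecreasing_cvgn_le; last exact: is_cvg_series_exp_coeff.
    apply: nondecreasing_series => k _ _; exact: exp_coeff_ge0.
  apply: le_trans.
  apply: (@le_trans _ _ (series (exp_coeff B) N - series (exp_coeff B) n)); last first.
    rewrite lerD2r; apply: nondecreasing_cvgn_le; last exact: is_cvg_series_exp_coeff.
    apply: nondecreasing_series => k _ _; exact: exp_coeff_ge0.
  rewrite !sub_series nN; apply: le_trans (ler_norm_sum _ _ _) _.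
  apply: ler_sum => k _; rewrite /exp_coeff /= normrM normfV (ger0_norm (ler0n _ _)).
  by rewrite ler_pM2r ?invr_gt0 ?ltr0n ?fact_gt0// normrX lerXn2r ?nnegrE.
rewrite [X in X <= _](_ : _ = limn (fun N => `|series (exp_coeff t) N - series (exp_coeff t) n|)).
  apply: limr_le.
    apply: is_cvg_norm; apply: is_cvgB; first exact: is_cvg_series_exp_coeff.
    exact: is_cvg_cst.
  by near=> N; apply: key; near: N; exists n.
apply/esym/cvg_lim => //; apply: cvg_norm; apply: cvgB; last exact: cvg_cst.
exact: is_cvg_series_exp_coeff.
Unshelve. all: by end_near.
Qed.

(** * Energy of finitely supported measures *)

Lemma cvg_sum_seq (R : realType) (I : Type) (r : seq I) (u : I -> nat -> R) (l : I -> R) :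
  (forall i, u i n @[n --> \oo] --> l i) ->
  (\sum_(i <- r) u i n) @[n --> \oo] --> \sum_(i <- r) l i.
Proof.
move=> ul; elim: r => [|i r IH].
  rewrite big_nil (_ : (fun _ => _) = fun=> 0); first exact: cvg_cst.
  by apply/funext => n; rewrite big_nil.
rewrite big_cons (_ : (fun _ => _) = fun n => u i n + \sum_(j <- r) u j n).
  exact: cvgD.
by apply/funext => n; rewrite big_cons.
Qed.

Section FiniteMeasure.
Context {R : realType} {T : Type}.
Implicit Types (m : seq (R * T)) (f g : T -> R).

(** The integral against the finitely supported signed measure with mass [c.1] at [c.2]. Points may
    repeat, so concatenation of lists is addition of measures. *)
Definition mean m f : R := \sum_(c <- m) c.1 * f c.2.

Definition prob_weights m := all (fun c => 0 <= c.1) m && (\sum_(c <- m) c.1 == 1).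

Definition wscale (a : R) m := [seq (a * c.1, c.2) | c <- m].

Lemma mean_cat m m' f : mean (m ++ m') f = mean m f + mean m' f.
Proof. exact: big_cat. Qed.

Lemma mean_scale a m f : mean (wscale a m) f = a * mean m f.
Proof.
by rewrite /mean big_map mulr_sumr; apply: eq_bigr => c _; rewrite mulrA.
Qed.

Lemma mean_lin m a f g : mean m (fun x => a * f x + g x) = a * mean m f + mean m g.
Proof.
rewrite /mean mulr_sumr -big_split; apply: eq_bigr => c _ /=.
by rewrite mulrDr mulrCA.
Qed.

Lemma mean_ge0 m f : prob_weights m -> (forall x, 0 <= f x) -> 0 <= mean m f.
Proof.
move=> /andP[m0 _] f0; rewrite /mean; elim: m m0 => [|c m IH] /=; first by rewrite big_nil.
by move=> /andP[c0 /IH m0]; rewrite big_cons addr_ge0// mulr_ge0.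
Qed.

Lemma mean_cst m (a : R) : prob_weights m -> mean m (fun=> a) = a.
Proof. by move=> /andP[_ /eqP m1]; rewrite /mean -mulr_suml m1 mul1r. Qed.

Lemma mean_norm_le m f (C : R) : prob_weights m -> (forall x, `|f x| <= C) -> `|mean m f| <= C.
Proof.
move=> pm fC; rewrite -[leRHS](mean_cst C pm) ler_norml.
have le u v : (forall x, u x <= v x) -> mean m u <= mean m v.
  move=> uv; rewrite -subr_ge0.
  have -> : mean m v - mean m u = mean m (fun x => (-1) * u x + v x).
    by rewrite mean_lin mulN1r addrC.
  by apply: mean_ge0 => // x; rewrite mulN1r addrC subr_ge0.
have H x : - C <= f x <= C by rewrite -ler_norml.
rewrite le ?andbT => [|x]; last by case/andP: (H x).
have -> : - mean m (fun=> C) = mean m (fun=> - C).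
  by rewrite !mean_cst.
by apply: le => x; case/andP: (H x).
Qed.

End FiniteMeasure.

Lemma mean_map (R : realType) (T U : Type) (h : T -> U) (m : seq (R * T)) (f : U -> R) :
  mean [seq (c.1, h c.2) | c <- m] f = mean m (f \o h).
Proof. by rewrite /mean big_map. Qed.

Section Energy.
Context {R : realType} {n : nat}.
Implicit Types (s t : seq (R * 'rV[R]_n)).

(** One factor [<x, y> = sum_i x_i y_i] can be absorbed in the weights, coordinate by coordinate,
    which leaves a sum of instances of lower power. *)
Lemma power_kernel_psd (k : nat) s : 0 <= mean s (fun x => mean s (fun y => inner x y ^+ k)).
Proof.
elim: k s => [|k IH] s.
  rewrite /mean (_ : \sum_(_ <- _) _ = (\sum_(c <- s) c.1) ^+ 2) ?sqr_ge0//.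
  rewrite expr2 mulr_suml; apply: eq_bigr => c _.
  by congr (_ * _); apply: eq_bigr => c' _; rewrite expr0 mulr1.
have -> : mean s (fun x => mean s (fun y => inner x y ^+ k.+1)) =
    \sum_(i < n) mean [seq (c.1 * c.2 ord0 i, c.2) | c : R * 'rV[R]_n <- s]
       (fun x => mean [seq (c.1 * c.2 ord0 i, c.2) | c : R * 'rV[R]_n <- s] (fun y => inner x y ^+ k)).
  rewrite /mean.
  under [RHS]eq_bigr do rewrite big_map.
  rewrite exchange_big; apply: eq_bigr => c _ /=.
  under [RHS]eq_bigr do rewrite big_map /= mulr_sumr.
  rewrite exchange_big mulr_sumr; apply: eq_bigr => c' _ /=.
  rewrite exprS {1}/inner mulr_suml 2!mulr_sumr; apply: eq_bigr => i _; ring.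
by apply: sumr_ge0 => i _; exact: IH.
Qed.

Definition energy s t := mean s (fun x => mean t (fun y => expR (inner x y))).

(** The truncations of the exponential series are nonnegative combinations of the power kernels. *)
Lemma energy_ge0 s : 0 <= energy s s.
Proof.
pose u k := \sum_(j < k) (j`!%:R)^-1 * mean s (fun x => mean s (fun y => inner x y ^+ j)).
have cu : u k @[k --> \oo] --> energy s s.
  have -> : u = fun k => \sum_(c <- s) \sum_(c' <- s) c.1 * c'.1 * series (exp_coeff (inner c.2 c'.2)) k.
    apply/funext => k; rewrite /u /mean.
    under eq_bigr do rewrite mulr_sumr.
    rewrite exchange_big; apply: eq_bigr => c _ /=.
    under eq_bigr do rewrite 2!mulr_sumr.
    rewrite exchange_big; apply: eq_bigr => c' _ /=.
    rewrite /series /= big_mkord mulr_sumr; apply: eq_bigr => j _.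
    by rewrite /exp_coeff /=; ring.
  have -> : energy s s = \sum_(c <- s) \sum_(c' <- s) c.1 * c'.1 * expR (inner c.2 c'.2).
    rewrite /energy /mean; apply: eq_bigr => c _; rewrite mulr_sumr.
    by apply: eq_bigr => c' _; rewrite mulrA.
  apply: cvg_sum_seq => c; apply: cvg_sum_seq => c'.
  by apply: cvgMr; exact: is_cvg_series_exp_coeff.
rewrite -(cvg_lim _ cu)//; apply: limr_ge; first exact: cvgP cu.
apply: nearW => k; apply: sumr_ge0 => j _.
by rewrite mulr_ge0 ?invr_ge0//; exact: power_kernel_psd.
Qed.

Lemma energyC s t : energy s t = energy t s.
Proof.
rewrite /energy /mean; under eq_bigr do rewrite mulr_sumr.
rewrite exchange_big; apply: eq_bigr => c _ /=; rewrite mulr_sumr.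
by apply: eq_bigr => c' _; rewrite innerC mulrCA.
Qed.

Lemma energy_catl s s' t : energy (s ++ s') t = energy s t + energy s' t.
Proof. exact: mean_cat. Qed.

Lemma energy_catr s s' t : energy t (s ++ s') = energy t s + energy t s'.
Proof. by rewrite energyC energy_catl !(energyC t). Qed.

Lemma energy_scalel a s t : energy (wscale a s) t = a * energy s t.
Proof. exact: mean_scale. Qed.

Lemma energy_scaler a s t : energy t (wscale a s) = a * energy t s.
Proof. by rewrite energyC energy_scalel energyC. Qed.

(** Cauchy-Schwarz for the kernel exp <x, y>, between the measure [s] and the unit mass at [w]. The
    mass [- B / K] added at [w] is the one that minimises the energy. *)
Lemma mean_exp_sqr_le s (w : 'rV[R]_n) :
  mean s (fun x => expR (inner w x)) ^+ 2 <= energy s s * expR (inner w w).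
Proof.
set B := mean s _; set K := expR _; have K0 : 0 < K := expR_gt0 _.
have := energy_ge0 (s ++ [:: (- B / K, w)]).
rewrite energy_catl !energy_catr [energy [:: _] s]energyC.
have -> : energy s [:: (- B / K, w)] = - B / K * B.
  by rewrite energyC /energy {1}/mean big_seq1.
have -> : energy [:: (- B / K, w)] [:: (- B / K, w)] = - B / K * (- B / K * K).
  by rewrite /energy /mean !big_seq1.
rewrite (_ : _ + _ + _ = energy s s - B ^+ 2 / K); last by field; rewrite gt_eqF.
by rewrite subr_ge0 ler_pdivrMr.
Qed.

End Energy.

(** * The rotation invariant mean *)

Lemma continuous_lin (R : realType) (X : topologicalType) (a : R) (f g : X -> R) :
  continuous f -> continuous g -> continuous (fun x => a * f x + g x).
Proof.
move=> cf cg x; apply: (@continuousD _ _ _ (fun z => a * f z) g); last exact: cg.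
by apply: (@continuousM _ _ (fun=> a) f); [exact: cst_continuous|exact: cf].
Qed.

Section InvariantMean.
Context {R : realType} {d : nat}.
Let T := sphere R d.
Implicit Types (m : seq (R * T)) (f g : T -> R).

Definition vec m : seq (R * 'rV[R]_d.+1) := [seq (c.1, val c.2) | c <- m].

Definition self_energy m := energy (vec m) (vec m).

Definition min_energy := inf [set self_energy m | m in [set m | prob_weights m]].

Lemma prob_point (x : T) : prob_weights [:: (1 : R, x)].
Proof. by rewrite /prob_weights /= ler01 big_seq1 eqxx. Qed.

Lemma min_energy_le m : prob_weights m -> min_energy <= self_energy m.
Proof.
move=> pm; apply: ge_inf; last by exists m.
by exists 0 => _ [m' _ <-]; exact: energy_ge0.
Qed.

Lemma near_min_energy (e : R) : 0 < e ->
  exists2 m, prob_weights m & self_energy m < min_energy + e.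
Proof.
move=> e0; have [|_ [m pm <-]] := @inf_adherent _ [set self_energy m | m in [set m | prob_weights m]] e e0.
  split; first by exists (self_energy [:: (1 : R, point : T)]), [:: (1 : R, point : T)] => //; exact: prob_point.
  by exists 0 => _ [m' _ <-]; exact: energy_ge0.
by move=> H; exists m.
Qed.

(* Parallelogram identity applied to [m], its mirror image and their midpoint. *)
Lemma near_min_invariant (e : R) m a w : prob_weights m -> self_energy m < min_energy + e ->
  (mean m (fun x => expR (inner w (val x)))
    - mean m (fun x => expR (inner w (val (srefl a x))))) ^+ 2 <= 4 * e * expR (inner w w).
Proof.
move=> pm me.
pose m' := [seq (c.1, srefl a c.2) | c <- m].
have pm' : prob_weights m'.
  by rewrite /prob_weights all_map big_map.
have em' : self_energy m' = self_energy m.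
  rewrite /self_energy /energy /mean !big_map; apply: eq_bigr => c _; congr (_ * _).
  by rewrite !big_map; apply: eq_bigr => c' _ /=; rewrite inner_refl.
pose mid := wscale 2^-1 (m ++ m').
have pmid : prob_weights mid.
  case/andP: pm => m0 /eqP m1; case/andP: pm' => m'0 /eqP m'1.
  rewrite /prob_weights /mid all_map big_map -mulr_sumr big_cat /= m1 m'1 mulVf// eqxx andbT.
  have h (s : seq (R * T)) : all (fun c => 0 <= c.1) s ->
      all (preim (fun c => (2^-1 * c.1, c.2)) (fun c : R * T => 0 <= c.1)) s.
    by apply: sub_all => c /= c0; rewrite mulr_ge0// invr_ge0.
  by rewrite all_cat !h.
have emid : self_energy mid =
    4^-1 * (self_energy m + 2 * energy (vec m) (vec m') + self_energy m').
  have vmid : vec mid = wscale 2^-1 (vec m ++ vec m').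
    by rewrite /vec /mid /wscale -map_cat -!map_comp.
  rewrite /self_energy vmid energy_scalel energy_scaler energy_catl !energy_catr.
  by rewrite [energy (vec m') (vec m)]energyC; field.
(* The energy of [m - m'] is [4 * self_energy m - 4 * self_energy mid], which is less than [4 * e]
   because [mid] competes for the minimum. *)
have := @mean_exp_sqr_le _ _ (vec m ++ wscale (-1) (vec m')) w.
rewrite energy_catl !energy_catr !energy_scalel !energy_scaler.
rewrite mean_cat mean_scale mean_map mean_map mean_map mulN1r => /le_trans; apply.
rewrite ler_wpM2r ?expR_ge0//.
have := min_energy_le pmid; rewrite emid em'.
rewrite [energy (vec m') (vec m)]energyC -/(self_energy m) -/(self_energy m') em'.
by move: me; lra.
Qed.

Definition near_minimisers : set_system (seq (R * T)) :=
  filter_from [set e : R | 0 < e]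
    (fun e => [set m | prob_weights m /\ self_energy m < min_energy + e]).

#[local] Instance near_minimisers_proper : ProperFilter near_minimisers.
Proof.
apply: filter_from_proper.
  apply: filter_from_filter; first by exists 1; exact: ltr01.
  move=> e e' /= e0 e'0; exists (Num.min e e'); first by rewrite /= lt_min e0.
  move=> m [pm me]; split; split => //; apply: lt_le_trans me _.
    by rewrite lerD2l ge_min lexx.
  by rewrite lerD2l ge_min lexx orbT.
by move=> e /= e0; have [m pm me] := near_min_energy e0; exists m.
Qed.

(** Along an ultrafilter every bounded quantity converges, so the means of all continuous functions
    have limits simultaneously. *)
Definition near_min_ultra := projT1 (cid (ultraFilterLemma near_minimisers_proper)).

#[local] Instance near_min_ultraP : UltraFilter near_min_ultra.
Proof. by rewrite /near_min_ultra; case: cid => ? []. Qed.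

Lemma near_minimisers_sub : near_minimisers `<=` near_min_ultra.
Proof. by rewrite /near_min_ultra; case: cid => ? []. Qed.

Lemma near_prob : \forall m \near near_min_ultra, prob_weights m.
Proof.
apply: near_minimisers_sub; exists 1; first exact: ltr01.
by move=> m [].
Qed.

(** Meaningful for continuous [f], where the limit exists; for other functions [lim] may return a
    default value. *)
Definition Imean f : R := lim (mean m f @[m --> near_min_ultra]).

Lemma cvg_bounded (u : seq (R * T) -> R) (C : R) :
  (\forall m \near near_min_ultra, `|u m| <= C) -> cvg (u m @[m --> near_min_ultra]).
Proof.
move=> uC.
have cC : compact `[- C, C]%classic := @segment_compact R _ _.
have [|p [_ up]] := cC (u @ near_min_ultra) _.
  by apply: filterS uC => m; rewrite /= in_itv /= ler_norml.
apply/cvg_ex; exists p => V pV.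
have [//|nV] := in_ultra_setVsetC (u @^-1` V) near_min_ultraP.
have [q [nVq Vq]] := up (~` V) V nV pV.
by case: (nVq Vq).
Qed.

Lemma Imean_cvg f : continuous f -> mean m f @[m --> near_min_ultra] --> Imean f.
Proof.
move=> cf; have [C C0 fC] := compact_fun_bounded sphere_compact cf.
apply: (@cvg_bounded _ C); apply: filterS near_prob => m pm.
exact: mean_norm_le.
Qed.

Lemma Imean_lin (a : R) f g : continuous f -> continuous g ->
  Imean (fun x => a * f x + g x) = a * Imean f + Imean g.
Proof.
move=> cf cg; apply/cvg_lim => //.
rewrite (_ : (fun _ => _) = fun m => a * mean m f + mean m g); last first.
  by apply/funext => m; rewrite mean_lin.
apply: cvgD; last exact: Imean_cvg.
by apply: cvgMr; exact: Imean_cvg.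
Qed.

Lemma Imean_cst (a : R) : Imean (fun=> a) = a.
Proof.
apply/cvg_lim => //; apply/cvgrPdist_le => e e0.
by apply: filterS near_prob => m pm; rewrite mean_cst// subrr normr0 ltW.
Qed.

Lemma Imean_ge0 f : continuous f -> (forall x, 0 <= f x) -> 0 <= Imean f.
Proof.
move=> cf f0; apply: limr_ge; first exact: (cvgP _ (Imean_cvg cf)).
by apply: filterS near_prob => m pm; exact: mean_ge0.
Qed.

Lemma Imean_norm_le f (C : R) : continuous f -> (forall x, `|f x| <= C) -> `|Imean f| <= C.
Proof.
move=> cf fC; have := Imean_cvg cf => /cvg_norm/cvg_lim <- //.
apply: limr_le; first by apply: is_cvg_norm; exact: (cvgP _ (Imean_cvg cf)).
by apply: filterS near_prob => m pm; exact: mean_norm_le.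
Qed.

(** Near-minimisers are nearly invariant when tested against exponentials of linear forms. These
    span a uniformly dense space, and the mean is a contraction for the supremum norm. *)
Lemma Imean_srefl a f : continuous f -> Imean (f \o srefl a) = Imean f.
Proof.
have csr g : continuous g -> continuous (g \o srefl a).
  by move=> cg x; apply: continuous_comp; [exact: continuous_srefl|exact: cg].
have Iexp w : Imean ((fun x => expR (inner w (val x))) \o srefl a) = Imean (fun x => expR (inner w (val x))).
  have ce : continuous (fun x : T => expR (inner w (val x))).
    exact: exp_span_continuous (exp_span_exp w).
  apply/cvg_lim => //; apply/cvgrPdist_le => e e0.
  have e2 : 0 < e / 2 by rewrite divr_gt0.
  have /cvgrPdist_le/(_ _ e2) H1 := Imean_cvg ce.
  (* Chosen so that the bound [4 * eta * expR (inner w w)] of [near_min_invariant] is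
     [(e / 2) ^+ 2]. *)
  pose eta := (e / 2) ^+ 2 / (4 * expR (inner w w)).
  have eta0 : 0 < eta by rewrite divr_gt0 ?exprn_gt0// mulr_gt0// expR_gt0.
  have H2 : \forall m \near near_min_ultra, prob_weights m /\ self_energy m < min_energy + eta.
    by apply: near_minimisers_sub; exists eta.
  near=> m.
  have [pm me] : prob_weights m /\ self_energy m < min_energy + eta by near: m.
  have := near_min_invariant a w pm me.
  have -> : 4 * eta * expR (inner w w) = (e / 2) ^+ 2.
    by rewrite /eta; field; rewrite gt_eqF// expR_gt0.
  rewrite -[leLHS]real_normK ?num_real// ler_pXn2r ?nnegrE ?normr_ge0 ?(ltW e2)// => H3.
  have : `|Imean (fun x => expR (inner w (val x))) - mean m (fun x => expR (inner w (val x)))| <= e / 2.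
    by near: m.
  set A := mean m _ in H3 *; move=> H4.
  rewrite (splitr e) -(subrKA A); apply: le_trans (ler_normD _ _) _.
  exact: lerD.
have Ispan g : exp_span g -> Imean (g \o srefl a) = Imean g.
  pose h (s : seq (R * 'rV[R]_d.+1)) := fun x : T => \sum_(c <- s) c.1 * expR (inner c.2 (val x)).
  move=> [s ->]; rewrite -/(h s); elim: s => [|c s IH].
    by rewrite (_ : h [::] \o _ = h [::])//; apply/funext => x /=; rewrite /h !big_nil.
  have -> : h (c :: s) = fun x => c.1 * expR (inner c.2 (val x)) + h s x.
    by apply/funext => x; rewrite /h big_cons.
  have c1 : continuous (fun x : T => expR (inner c.2 (val x))).
    exact: exp_span_continuous (exp_span_exp _).
  have c2 : continuous (h s) by apply: exp_span_continuous; exists s.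
  rewrite Imean_lin// -IH -Iexp.
  exact: (@Imean_lin _ ((fun x => expR (inner c.2 (val x))) \o srefl a)
    (h s \o srefl a) (csr _ c1) (csr _ c2)).
move=> cf; apply/eqP; rewrite -subr_eq0 -normr_le0; apply/ler_addgt0Pl => e e0.
rewrite addr0; have e2 : 0 < e / 2 by rewrite divr_gt0.
have [g Bg fg] := exp_span_dense cf e2.
have cg := exp_span_continuous Bg.
have IB u v : continuous u -> continuous v -> (forall x, `|u x - v x| <= e / 2) ->
    `|Imean u - Imean v| <= e / 2.
  move=> cu cv uv.
  have -> : Imean u - Imean v = Imean (fun x => (-1) * v x + u x).
    by rewrite Imean_lin// mulN1r addrC.
  apply: Imean_norm_le => [|x]; last by rewrite mulN1r addrC.
  exact: continuous_lin.
have -> : Imean (f \o srefl a) - Imean f =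
  (Imean (f \o srefl a) - Imean (g \o srefl a)) - (Imean f - Imean g).
  by rewrite (Ispan g)//; ring.
rewrite (splitr e); apply: le_trans (ler_normB _ _) _; apply: lerD; apply: IB => //.
- exact: csr.
- exact: csr.
- by move=> x; exact: fg.
Unshelve. all: by end_near.
Qed.

(* Near-minimisers of the energy approximate the invariant mean uniformly on
   compact equicontinuous families. *)
Lemma Imean_approx (Y : topologicalType) (F : T -> Y -> R) (e : R) :
  compact [set: Y] -> (forall y, continuous (F ^~ y)) ->
  (forall y (e : R), 0 < e -> \forall y' \near y, forall x, `|F x y' - F x y| <= e) ->
  0 < e -> exists m, forall y, `|Imean (F ^~ y) - mean m (F ^~ y)| <= e.
Proof.
move=> cY cF eqF e0.
have : \forall m \near near_min_ultra, [set: Y] `<=` (fun y => `|Imean (F ^~ y) - mean m (F ^~ y)| <= e).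
  have /compact_near_coveringP := cY; apply=> y _.
  have e3 : 0 < e / 3 by rewrite divr_gt0.
  have /cvgrPdist_le/(_ _ e3) H1 := Imean_cvg (cF y).
  have H2 := eqF y _ e3.
  near=> y' m => /=.
  have pm : prob_weights m by near: m; exact: near_prob.
  have h1 : `|Imean (F ^~ y) - mean m (F ^~ y)| <= e / 3 by near: m.
  have h2 : forall x, `|F x y' - F x y| <= e / 3 by near: y'.
  have h3 : `|Imean (F ^~ y') - Imean (F ^~ y)| <= e / 3.
    have -> : Imean (F ^~ y') - Imean (F ^~ y) = Imean (fun x => (-1) * F x y + F x y').
      by rewrite (Imean_lin _ (cF y) (cF y')) mulN1r addrC.
    apply: Imean_norm_le => [|x]; last by rewrite mulN1r addrC.
    by apply: continuous_lin; exact: cF.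
  have h4 : `|mean m (F ^~ y') - mean m (F ^~ y)| <= e / 3.
    have -> : mean m (F ^~ y') - mean m (F ^~ y) = mean m (fun x => (-1) * F x y + F x y').
      by rewrite mean_lin mulN1r addrC.
    by apply: mean_norm_le => // x; rewrite mulN1r addrC.
  rewrite !ler_norml in h1 h3 h4 *; lra.
move=> /filter_ex [m Hm]; exists m => y; exact: Hm.
Unshelve. all: by end_near.
Qed.

End InvariantMean.

(** * Moments in orthonormal frames *)

Section ContinuousFunctions.
Context {R : realType} {X : topologicalType}.
Implicit Types f g : X -> R.

Lemma continuous_mul f g : continuous f -> continuous g -> continuous (fun x => f x * g x).
Proof. by move=> cf cg x; apply: (@continuousM _ _ f g); [exact: cf|exact: cg]. Qed.

Lemma continuous_pow f n : continuous f -> continuous (fun x => f x ^+ n).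
Proof.
move=> cf; elim: n => [|n IH]; first exact: cst_continuous.
rewrite (_ : (fun x => _) = fun x => f x * f x ^+ n); first exact: continuous_mul.
by apply/funext => x; rewrite exprS.
Qed.

Lemma continuous_compR (phi : R -> R) f : continuous phi -> continuous f ->
  continuous (fun x => phi (f x)).
Proof. by move=> cp cf x; apply: (@continuous_comp _ _ _ f phi); [exact: cf|exact: cp]. Qed.

Lemma continuous_poly (p : {poly R}) f : continuous f -> continuous (fun x => p.[f x]).
Proof.
move=> cf; rewrite (_ : (fun x => _) = fun x => \sum_(i < size p) p`_i * f x ^+ i); last first.
  by apply/funext => x; rewrite horner_coef.
apply: (@continuous_sum_ffun _ _ _ _ (fun (i : 'I_(size p)) x => p`_i * f x ^+ i)) => i.
by apply: continuous_mul; [exact: cst_continuous|exact: continuous_pow].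
Qed.

End ContinuousFunctions.

Lemma poly_eq0_itv (R : realFieldType) (p : {poly R}) :
  (forall t, 0 <= t <= 1 -> p.[t] = 0) -> p = 0.
Proof.
move=> p0; apply/eqP; apply: contraT => pn0.
pose r : seq R := [seq i.+1%:R^-1 | i <- iota 0 (size p)].
have := @max_poly_roots _ p r pn0; rewrite size_map size_iota ltnn; apply.
  apply/allP => _ /mapP[i _ ->]; apply/rootP/p0.
  by rewrite invr_ge0 ler0n/= invf_le1 ?ltr0n// ler1n.
rewrite map_inj_uniq ?iota_uniq// => i j /invr_inj/eqP.
by rewrite eqr_nat eqSS => /eqP.
Qed.

Lemma poly_ext_itv (R : realFieldType) (p q : {poly R}) :
  (forall t, 0 <= t <= 1 -> p.[t] = q.[t]) -> p = q.
Proof.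
move=> pq; apply/eqP; rewrite -subr_eq0; apply/eqP/poly_eq0_itv => t t01.
by rewrite hornerD hornerN pq// subrr.
Qed.

Section Frames.
Context {R : realType} {d : nat}.
Let T := sphere R d.
Let V := 'rV[R]_d.+1.
Local Notation I := (@Imean R d).
Implicit Types (phi : R -> R) (y e z w : V) (a b : nat).

Lemma Imean_sum (J : Type) (r : seq J) (c : J -> R) (F : J -> T -> R) :
  (forall j, continuous (F j)) ->
  I (fun v => \sum_(j <- r) c j * F j v) = \sum_(j <- r) c j * I (F j).
Proof.
move=> cF; elim: r => [|j r IH].
  by rewrite big_nil -[RHS](@Imean_cst R d); congr Imean; apply/funext => v; rewrite big_nil.
rewrite big_cons -IH -Imean_lin//.
  by congr Imean; apply/funext => v; rewrite big_cons.
apply: (@continuous_sum_ffun _ _ _ _ (fun j (v : T) => c j * F j v)) => i.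
by apply: continuous_mul; [exact: cst_continuous|exact: cF].
Qed.

Lemma ImeanZ (a : R) (f : T -> R) : continuous f -> I (fun v => a * f v) = a * I f.
Proof.
move=> cf; have := @Imean_sum unit [:: tt] (fun=> a) (fun=> f) (fun=> cf).
by rewrite big_seq1 => <-; congr Imean; apply/funext => v; rewrite big_seq1.
Qed.

Definition moment (phi : R -> R) (y e z : V) (a b : nat) : R :=
  I (fun v => phi (inner y (val v)) * inner e (val v) ^+ a * inner z (val v) ^+ b).

Definition orthonormal3 (y e z : V) : Prop :=
  [/\ inner y y = 1, inner e e = 1 & inner z z = 1] /\
  [/\ inner y e = 0, inner y z = 0 & inner e z = 0].

Lemma moment_continuous phi y e z a b : continuous phi ->
  continuous (fun v : T => phi (inner y (val v)) * inner e (val v) ^+ a * inner z (val v) ^+ b).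
Proof.
move=> cphi; apply: continuous_mul; last first.
  by apply: continuous_pow; exact: continuous_linear_form.
apply: continuous_mul; last by apply: continuous_pow; exact: continuous_linear_form.
by apply: continuous_compR => //; exact: continuous_linear_form.
Qed.

Lemma moment_refl phi y e z a b w : continuous phi ->
  moment phi (refl w y) (refl w e) (refl w z) a b = moment phi y e z a b.
Proof.
move=> cphi; rewrite /moment -(Imean_srefl w (@moment_continuous phi y e z a b cphi)).
by congr Imean; apply/funext => v /=; rewrite !inner_refl_sym.
Qed.

(** Three reflections carry one frame to the other. The second and third are in vectors orthogonal
    to the frame vectors already placed, and so leave them fixed. *)
Lemma moment_frame phi y e z y' e' z' a b : continuous phi ->
  orthonormal3 y e z -> orthonormal3 y' e' z' ->
  moment phi y e z a b = moment phi y' e' z' a b.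
Proof.
move=> cphi [[yy ee zz] [ye yz ez]] [[y'y' e'e' z'z'] [y'e' y'z' e'z']].
rewrite -(moment_refl y e z a b (y - y') cphi) refl_swap ?yy//.
pose e1 := refl (y - y') e; pose z1 := refl (y - y') z.
have r1 : refl (y - y') y = y' by rewrite refl_swap ?yy.
have e1e1 : inner e1 e1 = 1 by rewrite inner_refl.
have z1z1 : inner z1 z1 = 1 by rewrite inner_refl.
have y'e1 : inner y' e1 = 0 by rewrite -r1 inner_refl.
have y'z1 : inner y' z1 = 0 by rewrite -r1 inner_refl.
have e1z1 : inner e1 z1 = 0 by rewrite inner_refl.
rewrite -/e1 -/z1 -(moment_refl y' e1 z1 a b (e1 - e') cphi).
have r2 : refl (e1 - e') y' = y' by rewrite refl_orth// innerBr y'e1 y'e' subrr.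
have r2e : refl (e1 - e') e1 = e' by rewrite refl_swap ?e1e1.
rewrite r2 r2e; pose z2 := refl (e1 - e') z1; rewrite -/z2.
have z2z2 : inner z2 z2 = 1 by rewrite inner_refl.
have y'z2 : inner y' z2 = 0 by rewrite -r2 inner_refl.
have e'z2 : inner e' z2 = 0 by rewrite -r2e inner_refl.
rewrite -(moment_refl y' e' z2 a b (z2 - z') cphi).
have r3y : refl (z2 - z') y' = y' by rewrite refl_orth// innerBr y'z2 y'z' subrr.
have r3e : refl (z2 - z') e' = e' by rewrite refl_orth// innerBr e'z2 e'z' subrr.
by rewrite r3y r3e refl_swap ?z2z2.
Qed.

Lemma moment_oddl phi y e z a b : continuous phi -> orthonormal3 y e z -> odd a ->
  moment phi y e z a b = 0.
Proof.
move=> cphi o3 oa; have [[yy ee zz] [ye yz ez]] := o3.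
have : moment phi y e z a b = moment phi y (- e) z a b.
  by apply: moment_frame => //; split; rewrite ?innerNl ?innerNr ?opprK ?ye ?ez ?oppr0.
have -> : moment phi y (- e) z a b = - moment phi y e z a b.
  rewrite /moment -mulN1r -ImeanZ; last exact: moment_continuous.
  congr Imean; apply/funext => v; rewrite innerNl exprNn -signr_odd oa expr1; ring.
by move=> H; lra.
Qed.

Lemma moment_neg phi y e z a b : continuous phi -> orthonormal3 y e z ->
  moment (fun t => phi (- t)) y e z a b = moment phi y e z a b.
Proof.
move=> cphi o3; have [[yy ee zz] [ye yz ez]] := o3.
rewrite (moment_frame a b cphi o3 (_ : orthonormal3 (- y) e z)).
  by rewrite /moment; congr Imean; apply/funext => v; rewrite innerNl.
by split; split; rewrite ?innerNl ?innerNr ?opprK ?yz ?ye ?oppr0.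
Qed.

(* Rotating in the plane of [e] and [z] shows that the mean of
   [phi * (e + u z)^(2k)] is [(1 + u^2)^k] times that of [phi * e^(2k)];
   compare the coefficients of [u^(2i)]. *)
Lemma moment_rotation phi y e z k i : continuous phi -> orthonormal3 y e z -> (i <= k)%N ->
  'C(k.*2, i.*2)%:R * moment phi y e z (k - i).*2 i.*2 = 'C(k, i)%:R * moment phi y e z k.*2 0.
Proof.
move=> cphi o3 ik; have [[yy ee zz] [ye yz ez]] := o3.
set mk := moment phi y e z k.*2 0.
pose P := \poly_(j < k.*2.+1) ('C(k.*2, j)%:R * moment phi y e z (k.*2 - j) j).
pose Q := mk *: (1 + 'X^2 : {poly R}) ^+ k.
suff PQ : P = Q.
  have : P`_i.*2 = Q`_i.*2 by rewrite PQ.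
  rewrite coef_poly ltnS leq_double ik -doubleB => ->.
  rewrite coefZ mulrC; congr (_ * _).
  rewrite exprDn coef_sum (bigD1 (Ordinal (ik : i < k.+1)%N))//= big1 ?addr0.
    by rewrite expr1n mul1r coefMn -exprM mul2n coefXn eqxx.
  move=> j ji; rewrite expr1n mul1r coefMn -exprM mul2n coefXn (inj_eq double_inj).
  by rewrite -[i]/(val (Ordinal (ik : i < k.+1)%N)) (inj_eq val_inj) eq_sym (negbTE ji) mul0rn.
apply: poly_ext_itv => u _.
have s0 : 0 < 1 + u ^+ 2 by rewrite ltr_pwDl// sqr_ge0.
pose s := Num.sqrt (1 + u ^+ 2).
have ss : s ^+ 2 = 1 + u ^+ 2 by rewrite sqr_sqrtr// ltW.
have sn : s != 0 by rewrite -sqrf_eq0 ss gt_eqF.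
have ze : inner z e = 0 by rewrite innerC.
have E1 : inner (e + u *: z) (e + u *: z) = s ^+ 2.
  by rewrite innerDl !innerDr !innerZl !innerZr ee zz ze ez ss; ring.
have E2 : inner (z - u *: e) (z - u *: e) = s ^+ 2.
  by rewrite innerBl !innerBr !innerZl !innerZr ee zz ze ez ss; ring.
have E3 : inner (e + u *: z) (z - u *: e) = 0.
  by rewrite innerDl !innerBr !innerZl !innerZr ee zz ze ez; ring.
have sK : s^-1 * (s^-1 * s ^+ 2) = 1 by field.
have o3' : orthonormal3 y (s^-1 *: (e + u *: z)) (s^-1 *: (z - u *: e)).
  split; split; rewrite ?innerZl ?innerZr ?E1 ?E2 ?E3 ?mulr0//.
    by rewrite innerDr innerZr ye yz mulr0 addr0 mulr0.
  by rewrite innerBr innerZr ye yz mulr0 subr0 mulr0.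
have := moment_frame k.*2 0 cphi o3' o3.
rewrite -/mk /Q hornerZ => <-.
rewrite horner_exp hornerD hornerXn hornerC -ss -exprM mul2n mulrC /moment -ImeanZ; last first.
  exact: moment_continuous.
rewrite horner_poly.
pose F (j : 'I_k.*2.+1) (v : T) :=
  phi (inner y (val v)) * inner e (val v) ^+ (k.*2 - j) * inner z (val v) ^+ j.
transitivity (I (fun v => \sum_(j < k.*2.+1) ('C(k.*2, j)%:R * u ^+ j) * F j v)).
  rewrite Imean_sum; last by move=> j; exact: moment_continuous.
  by apply: eq_bigr => j _; rewrite /moment mulrAC.
congr Imean; apply/funext => v.
rewrite innerZl exprMn exprVn expr0 mulr1 mulrCA [X in _ = _ * X]mulrA divff ?expf_neq0// mul1r.
rewrite innerDl innerZl exprDn mulr_sumr; apply: eq_bigr => j _.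
by rewrite /F exprMn -mulr_natl; ring.
Qed.

Context (d2 : (2 <= d)%N).

(** [inord] falls back to index 0 beyond the dimension; [d2] ensures that the axes 0, 1 and 2 are
    distinct. *)
Definition axis (i : nat) : V := delta_mx ord0 (inord i).

Lemma inner_axis i v : inner (axis i) v = v ord0 (inord i).
Proof. by rewrite innerC inner_delta. Qed.

Lemma orthonormal_delta (i j k : 'I_d.+1) : i != j -> i != k -> j != k ->
  orthonormal3 (delta_mx ord0 i) (delta_mx ord0 j) (delta_mx ord0 k).
Proof.
move=> ij ik jk; split; split; rewrite inner_delta mxE ?eqxx//=.
- by rewrite eq_sym (negbTE ij).
- by rewrite eq_sym (negbTE ik).
- by rewrite eq_sym (negbTE jk).
Qed.

Lemma orthonormal_axes : orthonormal3 (axis 0) (axis 1) (axis 2).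
Proof.
by apply: orthonormal_delta; rewrite -(inj_eq val_inj) /= !inordK// ltnS// ltnW.
Qed.

Definition axis_moment phi a b := moment phi (axis 0) (axis 1) (axis 2) a b.

(** On the sphere [1 - t ^+ 2] is the sum of the squares of the coordinates other than the first.
    Against the power [k.*2] of coordinate 1, the square of coordinate 1 raises the exponent, and
    each other square gives the same moment times the ratio [c] of [moment_rotation]. *)
Lemma axis_moment_step k : exists2 rho : R, 0 < rho & forall phi, continuous phi ->
  axis_moment (fun t => phi t * (1 - t ^+ 2)) k.*2 0 = rho * axis_moment phi k.+1.*2 0.
Proof.
pose c : R := 'C(k.+1, 1)%:R / 'C(k.+1.*2, 1.*2)%:R.
have c0 : 0 <= c by rewrite divr_ge0.
pose i0 : 'I_d.+1 := inord 0; pose i1 : 'I_d.+1 := inord 1.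
have i01 : i1 != i0 by rewrite -(inj_eq val_inj) /= !inordK// ltnS// ltnW.
exists (1 + \sum_(i | (i != i0) && (i != i1)) c).
  by rewrite ltr_pwDl// sumr_ge0.
move=> phi cphi.
pose F (i : 'I_d.+1) (v : T) :=
  phi (inner (axis 0) (val v)) * inner (axis 1) (val v) ^+ k.*2 * inner (delta_mx ord0 i) (val v) ^+ 2.
have cF i : continuous (F i) by exact: moment_continuous.
transitivity (I (fun v => \sum_i (i != i0)%:R * F i v)).
  congr Imean; apply/funext => v.
  have := sphereP v; rewrite {1}/inner (bigD1 i0)//= => /esym sv.
  rewrite (bigD1 i0)//= eqxx mul0r add0r expr0 mulr1 mulrAC.
  have -> : 1 - inner (axis 0) (val v) ^+ 2 = \sum_(i < d.+1 | i != i0) inner (delta_mx ord0 i) (val v) ^+ 2.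
    apply/eqP; rewrite subr_eq; apply/eqP; apply: (etrans sv); rewrite addrC inner_axis expr2; congr (_ + _).
    by apply: eq_bigr => i _; rewrite innerC inner_delta expr2.
  rewrite mulr_sumr; apply: eq_bigr => i ii0.
  by rewrite ii0 mul1r /F; ring.
rewrite Imean_sum// (bigD1 i0)//= eqxx mul0r add0r (bigD1 i1)//= i01 mul1r.
rewrite mulrDl mul1r mulr_suml; congr (_ + _).
  rewrite /axis_moment /moment; congr Imean; apply/funext => v.
  by rewrite /F -/(axis 1) doubleS -[k.*2.+2]addn2 (exprD _ k.*2 2) expr0 mulr1 mulrA.
apply: eq_bigr => i /andP[ii0 ii1]; rewrite ii0 mul1r.
have o3 : orthonormal3 (axis 0) (axis 1) (delta_mx ord0 i).
  by apply: orthonormal_delta; rewrite // eq_sym.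
have -> : I (F i) = axis_moment phi k.*2 2.
  exact: (moment_frame _ _ cphi o3 orthonormal_axes).
have := moment_rotation cphi orthonormal_axes (ltn0Sn k : 1 <= k.+1)%N.
rewrite subSS subn0 -/(axis_moment _ _ _) -/(axis_moment _ _ _) /c => H.
rewrite mulrAC -H mulrC mulKf//.
by rewrite pnatr_eq0 -lt0n bin_gt0 leq_double.
Qed.

Definition axis_mean phi := I (fun v => phi (inner (axis 0) (val v))).

(** At height [t] the other coordinates scale like the square root of [1 - t ^+ 2], whence the
    exponent [a + b]. What is kept of [kappa] is its positivity, which later prevents cancellation
    of leading coefficients, and its independence of [phi]. *)
Lemma axis_momentE a b : exists2 kappa : R, 0 < kappa & forall phi, continuous phi ->
  axis_moment phi a.*2 b.*2 = kappa * axis_mean (fun t => phi t * (1 - t ^+ 2) ^+ (a + b)).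
Proof.
have H k : exists2 rho : R, 0 < rho & forall phi, continuous phi ->
  axis_moment phi k.*2 0 = rho * axis_mean (fun t => phi t * (1 - t ^+ 2) ^+ k).
  elim: k => [|k [r r0 IH]].
    exists 1 => // phi _; rewrite mul1r /axis_moment /moment /axis_mean.
    by congr Imean; apply/funext => v; rewrite !expr0 !mulr1.
  have [s s0 Hs] := axis_moment_step k.
  exists (s^-1 * r) => [|phi cphi]; first by rewrite mulr_gt0// invr_gt0.
  have c1 : continuous (fun t : R => 1 - t ^+ 2).
    rewrite (_ : (fun t => _) = fun t => (1 - 'X^2 : {poly R}).[t]).
      by apply: (@continuous_poly R R _ id) => t; exact: cvg_id.
    by apply/funext => t; rewrite hornerD hornerN hornerXn hornerC.
  have cp : continuous (fun t => phi t * (1 - t ^+ 2)) by exact: continuous_mul.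
  have := Hs _ cphi; rewrite IH// => /esym H; rewrite (canRL (mulKf (lt0r_neq0 s0)) H).
  rewrite -mulrA; congr (_ * (_ * axis_mean _)).
  by apply/funext => t; rewrite -mulrA -exprS.
have [r r0 Hr] := H (a + b)%N.
exists ('C(a + b, b)%:R / 'C((a + b).*2, b.*2)%:R * r).
  by rewrite mulr_gt0// divr_gt0// ltr0n bin_gt0 ?leq_double ?leq_addl.
move=> phi cphi; rewrite -[RHS]mulrA -(Hr phi)//.
have := moment_rotation cphi orthonormal_axes (leq_addl a b).
rewrite addnK -!/(axis_moment _ _ _) => H'.
rewrite mulrAC -H' mulrC mulKf//.
by rewrite pnatr_eq0 -lt0n bin_gt0 leq_double leq_addl.
Qed.

End Frames.

(** * Leading coefficients of the zonal moments *)

(** Both sides are the multinomial coefficient [N! / (a! k! (N - a - k)!)]. *)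
Lemma bin_trinomial (N a k : nat) : (a + k <= N)%N ->
  ('C(N - k, a) * 'C(N, k) = 'C(N, a) * 'C(N - a, k))%N.
Proof.
move=> akN.
have kN : (k <= N)%N by lia.
have aN : (a <= N)%N by lia.
have akN' : (a <= N - k)%N by lia.
have kaN : (k <= N - a)%N by lia.
have f0 : (0 < a`! * k`! * (N - a - k)`!)%N by rewrite !muln_gt0 !fact_gt0.
apply/eqP; rewrite -(eqn_pmul2r f0); apply/eqP.
have E1 := bin_fact kN; have E2 := bin_fact akN'; have E3 := bin_fact aN; have E4 := bin_fact kaN.
have E : (N - k - a = N - a - k)%N by lia.
rewrite E in E2.
transitivity N`!.
  by rewrite -E1 -E2; ring.
by rewrite -E3 -E4; ring.
Qed.

Lemma coef_1DX_exp (R : comNzRingType) (n k : nat) : ((1 + 'X : {poly R}) ^+ n)`_k = 'C(n, k)%:R.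
Proof.
rewrite exprDn coef_sum; have [kn|nk] := leqP k n.
  rewrite (bigD1 (Ordinal (kn : (k < n.+1)%N)))//= big1 ?addr0.
    by rewrite expr1n mul1r coefMn coefXn eqxx.
  move=> j jk; rewrite expr1n mul1r coefMn coefXn.
  by rewrite -[k]/(val (Ordinal (kn : (k < n.+1)%N))) (inj_eq val_inj) eq_sym (negbTE jk) mul0rn.
rewrite bin_small// big1// => j _; rewrite expr1n mul1r coefMn coefXn.
by case: eqP => [kj|_]; rewrite ?mul0rn//; have := ltn_ord j; rewrite -kj ltnS leqNgt nk.
Qed.

(* The coefficient of [X^k] in [((1 + X)^2 - 1)^m = X^m (X + 2)^m]. *)
Lemma alternating_bin_sum (R : comNzRingType) (m k : nat) : (k < m)%N ->
  \sum_(j < m.+1) (-1) ^+ j * 'C(m, j)%:R * 'C(m.*2 - j.*2, k)%:R = 0 :> R.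
Proof.
move=> km.
have E : ((1 + 'X : {poly R}) ^+ 2 - 1) ^+ m = 'X^m * ('X + 2) ^+ m.
  by rewrite -exprMn; congr (_ ^+ m); ring.
have := congr1 (fun p : {poly R} => p`_k) E.
rewrite /= coefXnM km exprBn coef_sum => H; apply: etrans H; apply: eq_bigr => j _.
rewrite expr1n mulr1 coefMn -exprM mul2n doubleB.
have -> : ((-1) ^+ j : {poly R}) = ((-1) ^+ j)%:P by rewrite polyC_exp polyCN.
by rewrite coefCM coef_1DX_exp -mulr_natr; ring.
Qed.

Section ZonalMoments.
Context {R : realType} {d : nat} (d2 : (2 <= d)%N).
Let T := sphere R d.
Local Notation I := (@Imean R d).
Local Notation nu := (@axis_mean R d).
Local Notation mom := (@axis_moment R d).
Implicit Types phi : R -> R.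

Lemma axis_mean_lin (a : R) phi psi : continuous phi -> continuous psi ->
  nu (fun t => a * phi t + psi t) = a * nu phi + nu psi.
Proof.
move=> cp cq; rewrite /axis_mean -Imean_lin//.
  by apply: continuous_compR => //; exact: continuous_linear_form.
by apply: continuous_compR => //; exact: continuous_linear_form.
Qed.

Lemma axis_mean_sum (J : Type) (r : seq J) (c : J -> R) (F : J -> R -> R) :
  (forall j, continuous (F j)) ->
  nu (fun t => \sum_(j <- r) c j * F j t) = \sum_(j <- r) c j * nu (F j).
Proof.
move=> cF.
rewrite /axis_mean -(Imean_sum r c (F := fun j v => F j (inner (axis 0) (val v))))// => j.
by apply: continuous_compR; [exact: cF|exact: continuous_linear_form].
Qed.

Lemma axis_meanN phi : continuous phi -> nu (fun t => phi (- t)) = nu phi.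
Proof.
move=> cp; have := moment_neg 0 0 cp (orthonormal_axes d2).
rewrite /moment /axis_mean => H.
under eq_fun do rewrite -[phi _]mulr1 -[_ * 1]mulr1.
under [in RHS]eq_fun do rewrite -[phi _]mulr1 -[_ * 1]mulr1.
exact: H.
Qed.

(* The coefficient of [<w, y>^n] in the mean over [v] of
   [phi <y, v> * <w, v>^n * <z, v>^(2i)], see [moment_poly]; for [2j > n] the
   truncated subtraction is harmless since the binomial vanishes. *)
Definition lam (n i : nat) phi : R :=
  \sum_(j < n.+1) (-1) ^+ j * 'C(n, j.*2)%:R * mom (fun t => phi t * t ^+ (n - j.*2)) j.*2 i.*2.

Lemma coef_sub1X2_exp m : ((1 - 'X^2 : {poly R}) ^+ m)`_m.*2 = (-1) ^+ m /\
  size ((1 - 'X^2 : {poly R}) ^+ m) = m.*2.+1.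
Proof.
have mon : 'X^2 - 1 \is @monic R by rewrite -(polyC1) monicXnsubC.
have sz : size (('X^2 - 1 : {poly R}) ^+ m) = m.*2.+1.
  have := size_exp ('X^2 - 1 : {poly R}) m; rewrite -polyC1 size_XnsubC//= mul2n => <-.
  by rewrite prednK// lt0n size_poly_eq0 monic_neq0// monic_exp// polyC1.
have -> : (1 - 'X^2 : {poly R}) ^+ m = ((-1) ^+ m)%:P * ('X^2 - 1) ^+ m.
  by rewrite polyC_exp polyCN -exprMn; congr (_ ^+ m); ring.
rewrite coefCM size_Cmul ?signr_eq0//; split => //.
have := monic_exp m mon; rewrite monicE lead_coefE sz => /eqP /= ->.
by rewrite mulr1.
Qed.

(** Each term contributes [X^(n - 2j) * (1 - X^2)^(j + i)], of degree [n + 2i] with leading sign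
    [(-1)^(i + j)]. The sign [(-1)^j] in [lam] cancels the dependence on [j], so the positive
    constants [kap j] add up and the degree is exact. *)
Lemma lamE n i : exists L : {poly R}, [/\ size L = (n + i.*2).+1,
  forall t, L.[- t] = (-1) ^+ n * L.[t] &
  forall phi, continuous phi -> lam n i phi = nu (fun t => phi t * L.[t])].
Proof.
have /choice[kap kapP] : forall j, exists k : R, 0 < k /\ forall phi, continuous phi ->
    mom phi j.*2 i.*2 = k * nu (fun t => phi t * (1 - t ^+ 2) ^+ (j + i)).
  by move=> j; have [k k0 H] := @axis_momentE R d d2 j i; exists k.
pose c (j : 'I_n.+1) := (-1) ^+ j * 'C(n, j.*2)%:R * kap j.
pose Q (j : 'I_n.+1) : {poly R} := 'X^(n - j.*2) * (1 - 'X^2) ^+ (j + i).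
exists (\sum_(j < n.+1) c j *: Q j); split.
- apply/eqP; rewrite eqn_leq; apply/andP; split.
    apply: leq_trans (size_sum _ _ _) _; apply/bigmax_leqP => j _.
    have [jn|nj] := leqP j.*2 n; last first.
      by rewrite /c bin_small// mulr0 mul0r scale0r size_poly0.
    apply: leq_trans (size_scale_leq _ _) _.
    apply: leq_trans (size_polyMleq _ _) _.
    rewrite size_polyXn (coef_sub1X2_exp _).2; lia.
  rewrite ltnNge; apply/negP => /leq_sizeP/(_ _ (leqnn _)).
  rewrite coef_sum => /eqP; apply/negP.
  have -> : \sum_(j < n.+1) (c j *: Q j)`_(n + i.*2) =
      (-1) ^+ i * \sum_(j < n.+1) 'C(n, j.*2)%:R * kap j.
    rewrite mulr_sumr; apply: eq_bigr => j _; rewrite coefZ /c /Q.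
    have [jn|nj] := leqP j.*2 n; last by rewrite bin_small// mulr0 !mul0r mulr0.
    rewrite coefXnM ltnNge (leq_trans (leq_subr _ _) (leq_addr _ _)) /=.
    have -> : (n + i.*2 - (n - j.*2) = (j + i).*2)%N by lia.
    rewrite (coef_sub1X2_exp _).1 exprD.
    have : (-1) ^+ j * (-1) ^+ j = 1 :> R by rewrite -expr2 sqrr_sign.
    move=> H; transitivity ((-1) ^+ j * (-1) ^+ j * ((-1) ^+ i * ('C(n, j.*2)%:R * kap j))).
      by ring.
    by rewrite H mul1r.
  rewrite mulf_neq0// ?signr_eq0// gt_eqF// big_ord_recl /= ltr_pwDl//.
    by rewrite bin0 mul1r; case: (kapP 0%N).
  by apply: sumr_ge0 => j _; rewrite mulr_ge0// ltW//; case: (kapP (bump 0 j)).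
- move=> t; rewrite !horner_sum mulr_sumr; apply: eq_bigr => j _.
  rewrite !hornerZ /c /Q.
  have [jn|nj] := leqP j.*2 n; last by rewrite bin_small// mulr0 !mul0r mulr0.
  rewrite !hornerM !hornerXn !horner_exp !hornerD !hornerN !hornerC !hornerXn sqrrN.
  rewrite [(- t) ^+ _]exprNn -(signr_odd _ n) -(signr_odd _ (n - _)) oddB// odd_double addbF.
  by ring.
- move=> phi cphi.
  have cQ (q : {poly R}) : continuous (fun t : R => q.[t]).
    by apply: (@continuous_poly R R q id) => t; exact: cvg_id.
  have -> : (fun t => phi t * (\sum_(j < n.+1) c j *: Q j).[t]) =
      fun t => \sum_(j < n.+1) c j * (phi t * (Q j).[t]).
    apply/funext => t; rewrite horner_sum mulr_sumr; apply: eq_bigr => j _.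
    by rewrite hornerZ mulrCA.
  rewrite (axis_mean_sum _ _ (F := fun (j : 'I_n.+1) t => phi t * (Q j).[t])); last first.
    by move=> j; exact: continuous_mul.
  apply: eq_bigr => j _; rewrite (kapP j).2; last first.
    apply: continuous_mul => //.
    rewrite (_ : (fun t => _) = fun t => ('X^(n - j.*2) : {poly R}).[t]); first exact: cQ.
    by apply/funext => t; rewrite hornerXn.
  rewrite mulrA; congr (_ * axis_mean _); apply/funext => t.
  by rewrite /Q hornerM hornerXn horner_exp hornerD hornerN hornerC hornerXn mulrA.
Qed.

Lemma continuous_exprn k : continuous (fun t : R => t ^+ k).
Proof. by apply: (@continuous_pow R R id) => t; exact: cvg_id. Qed.

(** The alternating sum in [lam] is the real part of the n-th power of the complex number with
    coordinates [x_0, x_1], that is [cos (n theta)] times a power of the radius. In the same plane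
    [x_0^k] is a trigonometric polynomial of degree [k < n], hence orthogonal to it;
    [alternating_bin_sum] is the algebraic form of this orthogonality. *)
Lemma lam_monomial n i k : (k < n)%N -> lam n i (fun t => t ^+ k) = 0.
Proof.
move=> kn; have oa := @orthonormal_axes R d d2.
have cpow j : continuous (fun t : R => t ^+ k * t ^+ (n - j)).
  by apply: continuous_mul; exact: continuous_exprn.
have [onk|enk] := boolP (odd (n + k)).
  apply: big1 => j _; have [jn|nj] := leqP j.*2 n; last by rewrite bin_small// mulr0 mul0r.
  have := moment_neg j.*2 i.*2 (cpow j.*2) oa; rewrite -/(mom _ _ _).
  have -> : (fun t : R => (- t) ^+ k * (- t) ^+ (n - j.*2)) = fun t => (-1) * (t ^+ k * t ^+ (n - j.*2)).
    apply/funext => t; rewrite -!exprD exprNn -signr_odd oddD oddB// odd_double addbF.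
    by rewrite addbC -oddD onk expr1.
  rewrite /mom /moment.
  have -> : (fun v : T => -1 * (inner (axis 0) (val v) ^+ k * inner (axis 0) (val v) ^+ (n - j.*2)) *
      inner (axis 1) (val v) ^+ j.*2 * inner (axis 2) (val v) ^+ i.*2) =
     fun v => -1 * (inner (axis 0) (val v) ^+ k * inner (axis 0) (val v) ^+ (n - j.*2) *
      inner (axis 1) (val v) ^+ j.*2 * inner (axis 2) (val v) ^+ i.*2).
    by apply/funext => v; rewrite !mulrA.
  rewrite ImeanZ; last exact: (moment_continuous (cpow j.*2)).
  by move=> H; apply/eqP; rewrite mulf_eq0; apply/orP; right; apply/eqP; move: H; lra.
pose m := (n + k)./2.
have nk2 : (n + k = m.*2)%N by rewrite -[LHS]odd_double_half (negbTE enk).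
have mn : (m < n)%N by lia.
have km : (k < m)%N by lia.
(* The frame is permuted: axis 2 carries the function, so that [moment_rotation] acts in the plane
   of axes 0 and 1. *)
pose c := @moment R d (fun t => t ^+ i.*2) (axis 2) (axis 0) (axis 1) m.*2 0.
have key (j : 'I_n.+1) : 'C(n, j.*2)%:R * mom (fun t => t ^+ k * t ^+ (n - j.*2)) j.*2 i.*2 =
    c / 'C(m.*2, k)%:R * ('C(m, j)%:R * 'C(m.*2 - j.*2, k)%:R).
  have [jn|nj] := leqP j.*2 n; last first.
    rewrite bin_small// mul0r; have [mj|jm] := ltnP m j.
      by rewrite (bin_small mj) mul0r mulr0.
    by rewrite [X in _ * (_ * X%:R)]bin_small ?mulr0//; lia.
  have oa' : @orthonormal3 R d (axis 2) (axis 0) (axis 1) 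
    by case: oa => -[? ? ?] [? xz yz]; split; split=> //; rewrite innerC ?xz ?yz.
  have jm : (j <= m)%N by lia.
  have ci : continuous (fun t : R => t ^+ i.*2) by exact: continuous_exprn.
  have := moment_rotation ci oa' jm; rewrite -/c.
  have -> : @moment R d (fun t => t ^+ i.*2) (axis 2) (axis 0) (axis 1) (m - j).*2 j.*2 =
      mom (fun t => t ^+ k * t ^+ (n - j.*2)) j.*2 i.*2.
    rewrite /mom /moment; congr Imean; apply/funext => v.
    have -> : ((m - j).*2 = k + (n - j.*2))%N by lia.
    by rewrite exprD; ring.
  move=> H.
  have b0 : 'C(m.*2, k)%:R != 0 :> R by rewrite pnatr_eq0 -lt0n bin_gt0; lia.
  apply: (mulfI b0); apply: (mulfI (_ : 'C(m.*2, j.*2)%:R != 0 :> R)).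
    by rewrite pnatr_eq0 -lt0n bin_gt0 leq_double.
  have tri := @bin_trinomial m.*2 j.*2 k ltac:(lia).
  have nE : (n = m.*2 - k)%N by lia.
  have triR : 'C(n, j.*2)%:R * 'C(m.*2, k)%:R = 'C(m.*2, j.*2)%:R * 'C(m.*2 - j.*2, k)%:R :> R.
    by rewrite -!natrM -tri; congr (_ * _)%:R; congr binomial.
  rewrite [LHS](_ : _ = ('C(n, j.*2)%:R * 'C(m.*2, k)%:R) *
     ('C(m.*2, j.*2)%:R * mom (fun t => t ^+ k * t ^+ (n - j.*2)) j.*2 i.*2)); last by ring.
  by rewrite triR H; field.
rewrite /lam.
under eq_bigr do rewrite -mulrA key mulrCA.
rewrite -mulr_sumr [X in _ * X](_ : _ = 0) ?mulr0//.
rewrite -[RHS](alternating_bin_sum R km).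
under eq_bigr do rewrite mulrA.
rewrite -(big_mkord xpredT (fun j => (-1) ^+ j * 'C(m, j)%:R * 'C(m.*2 - j.*2, k)%:R)).
(* The sum runs up to [n], the identity up to [m]; beyond [m] the binomials ['C(m, j)] vanish. *)
rewrite (@big_cat_nat _ _ _ m.+1)//=; last by rewrite ltnS ltnW.
rewrite big_mkord [X in _ + X]big_nat_cond [X in _ + X]big1 ?addr0// => j.
by rewrite andbT => /andP[mj _]; rewrite bin_small// mulr0 mul0r.
Qed.

End ZonalMoments.

(** * Faithfulness of the mean and projection to polynomials *)

(** If [f x > 0], compactness gives finitely many reflected copies of [f] whose sum exceeds
    [f x / 2] everywhere; by invariance the mean of that sum is 0. *)
Lemma Imean_faithful (R : realType) (d : nat) (f : sphere R d -> R) :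
  continuous f -> (forall x, 0 <= f x) -> Imean f = 0 -> forall x, f x = 0.
Proof.
move=> cf f0 If x; apply/eqP; apply: contraT => fx.
have fx0 : 0 < f x by rewrite lt_def fx f0.
pose g (b : sphere R d) := f \o srefl (val b - val x).
have cg b : continuous (g b).
  by move=> v; apply: continuous_comp; [exact: continuous_srefl|exact: cf].
have := @sphere_compact R d; rewrite compact_cover.
case/(_ _ setT (fun b => [set v | f x / 2 < g b v])) => [b _|b _|D _ Dc].
- rewrite (_ : [set v | _] = g b @^-1` [set y | f x / 2 < y]) //.
  by apply: open_comp; [move=> v _; exact: cg|exact: open_gt].
- exists b => //=; rewrite /g /= srefl_swap ltr_pdivrMr// ltr_pMr// ltr1n //.
have : 0 <= Imean (fun v => 1 * (\sum_(b <- enum_fset D) 1 * g b v) + (- (f x / 2))).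
  apply: Imean_ge0.
    apply: continuous_lin; last exact: cst_continuous.
    apply: (@continuous_sum_ffun _ _ _ _ (fun b v => 1 * g b v)) => b.
    by apply: continuous_mul; [exact: cst_continuous|exact: cg].
  move=> v; have [b Db /ltW gb] := Dc v I.
  rewrite mul1r subr_ge0 (le_trans gb)//.
  rewrite (big_rem b)//= mul1r lerDl sumr_ge0// => c _.
  by rewrite mul1r; exact: f0.
rewrite Imean_lin; last 2 first.
- apply: (@continuous_sum_ffun _ _ _ _ (fun b v => 1 * g b v)) => b.
  by apply: continuous_mul; [exact: cst_continuous|exact: cg].
- exact: cst_continuous.
rewrite Imean_sum// big1 => [|b _]; last by rewrite Imean_srefl// If mulr0.
by rewrite mulr0 add0r Imean_cst oppr_ge0 leNgt divr_gt0.
Qed.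

Section ZonalDensity.
Context {R : realType} {d : nat} (d2 : (2 <= d)%N).
Let T := sphere R d.
Local Notation I := (@Imean R d).
Local Notation nu := (@axis_mean R d).
Implicit Types phi : R -> R.

Lemma axis_surj (t : R) : -1 <= t <= 1 -> exists v : T, inner (axis 0) (val v) = t.
Proof.
move=> /andP[t1 t2].
have [[a00 a11 _] [a01 _ _]] := @orthonormal_axes R d d2.
have s0 : 0 <= 1 - t ^+ 2 by nra.
pose v : 'rV[R]_d.+1 := t *: axis 0 + Num.sqrt (1 - t ^+ 2) *: axis 1.
have vv : inner v v = 1.
  rewrite /v innerDl !innerDr !innerZl !innerZr (innerC (axis 1)) a00 a11 a01.
  by have := sqr_sqrtr s0; move: (Num.sqrt _) => s ss; rewrite !mulr0 !mulr1 addr0 add0r -!expr2 ss; ring.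
exists (mksphere vv); rewrite /= /v innerDr !innerZr a00 a01; ring.
Qed.

(** As a function on the sphere, [phi] of the first coordinate is a uniform limit of polynomials in
    that coordinate. Being orthogonal to them, it is orthogonal to itself, and the mean is
    faithful. *)
Lemma axis_mean_eq0 phi : continuous phi ->
  (forall k, nu (fun t => phi t * t ^+ k) = 0) -> forall t, -1 <= t <= 1 -> phi t = 0.
Proof.
move=> cphi phi0.
pose f (v : T) := phi (inner (axis 0) (val v)).
have ca : continuous (fun v : T => inner (axis 0) (val v)) by exact: continuous_linear_form.
have cf : continuous f by exact: continuous_compR.
pose B : set (T -> R) := [set g | exists p : {poly R}, g = fun v => p.[inner (axis 0) (val v)]].
have cB g : B g -> continuous g by move=> [p ->]; exact: continuous_poly.
have If g : B g -> I (fun v => f v * g v) = 0.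
  move=> [p ->].
  transitivity (nu (fun t => \sum_(i < size p) p`_i * (phi t * t ^+ i))).
    rewrite /axis_mean; congr Imean; apply/funext => v.
    by rewrite horner_coef mulr_sumr; apply: eq_bigr => i _; rewrite mulrCA.
  rewrite (axis_mean_sum _ _ (F := fun (i : 'I_(size p)) t => phi t * t ^+ i)); last first.
    by move=> i; apply: continuous_mul => //; exact: continuous_exprn.
  by apply: big1 => i _; rewrite phi0 mulr0.
have [C C0 fC] := compact_fun_bounded (@sphere_compact R d) cf.
have Bf : uclosure B f.
  apply: (stone_weierstrass (@sphere_compact R d)) => //.
  - move=> a g h [p ->] [q ->]; exists (a *: p + q); apply/funext => v.
    by rewrite hornerD hornerZ.
  - move=> g h [p ->] [q ->]; exists (p * q); apply/funext => v.
    by rewrite hornerM.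
  - by exists 1; apply/funext => v; rewrite hornerC.
  - move=> x y fxy; exists (fun v => inner (axis 0) (val v)).
      by exists 'X; apply/funext => v; rewrite hornerX.
    by apply: contra_neq fxy => xy; rewrite /f xy.
have Iff : I (fun v => f v * f v) = 0.
  apply/eqP; rewrite -normr_le0; apply/ler_addgt0Pl => e e0; rewrite addr0.
  have [g Bg fg] := Bf (e / C) (divr_gt0 e0 C0).
  have cfg : continuous (fun v => f v * g v) by apply: continuous_mul => //; exact: cB.
  have cff : continuous (fun v => f v * f v) by exact: continuous_mul.
  have -> : I (fun v => f v * f v) = I (fun v => (-1) * (f v * g v) + f v * f v).
    by rewrite (Imean_lin _ cfg cff) (If g Bg) mulr0 add0r.
  apply: Imean_norm_le; first exact: continuous_lin.
  move=> v; have -> : -1 * (f v * g v) + f v * f v = f v * (f v - g v) by ring.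
  rewrite normrM; apply: le_trans (_ : C * (e / C) <= _).
    by rewrite ler_pM.
  by rewrite mulrCA divff ?mulr1// gt_eqF.
move=> t /axis_surj[v <-].
have := @Imean_faithful _ _ _ (continuous_mul cf cf) _ Iff v.
rewrite -/(f v) -expr2 => H; apply/eqP; rewrite -sqrf_eq0; apply/eqP/H => x.
by rewrite -expr2 sqr_ge0.
Qed.

(** Orthogonal projection to the polynomials of degree less than [n]. The Gram matrix of the
    monomials is invertible: a kernel vector is a polynomial [q] whose square has mean 0, so [q = 0]
    by faithfulness. *)
Lemma axis_projection n phi : continuous phi -> exists2 p : {poly R}, (size p <= n)%N &
  forall k, (k < n)%N -> nu (fun t => (phi t - p.[t]) * t ^+ k) = 0.
Proof.
move=> cphi.
pose G : 'M[R]_n := \matrix_(k < n, l < n) nu (fun t => t ^+ k * t ^+ l).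
have cX (k l : nat) : continuous (fun t : R => t ^+ k * t ^+ l).
  by apply: continuous_mul; exact: continuous_exprn.
have GU : G \in unitmx.
  rewrite -row_free_unit -kermx_eq0; apply/eqP/row_matrixP => i; rewrite row0.
  have : row i (kermx G) *m G = 0 by rewrite -row_mul mulmx_ker row0.
  move: (row i (kermx G)) => u uG.
  pose q := \poly_(k < n) (if insub k is Some k' then u 0 k' else 0).
  have qE t : q.[t] = \sum_(k < n) u 0 k * t ^+ k.
    by rewrite horner_poly; apply: eq_bigr => k _; rewrite valK.
  have cq : continuous (fun t : R => q.[t]).
    by apply: (@continuous_poly R R q id) => t; exact: cvg_id.
  have q2 : I (fun v => q.[inner (axis 0) (val v)] * q.[inner (axis 0) (val v)]) = 0.
    rewrite -[LHS]/(nu (fun t => q.[t] * q.[t])).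
    have -> : (fun t => q.[t] * q.[t]) = fun t => \sum_(l < n) u 0 l * (q.[t] * t ^+ l).
      by apply/funext => t; rewrite {2}qE mulr_sumr; apply: eq_bigr => l _; rewrite mulrCA.
    rewrite (axis_mean_sum _ _ (F := fun (l : 'I_n) t => q.[t] * t ^+ l)); last first.
      by move=> l; apply: continuous_mul => //; exact: continuous_exprn.
    apply: big1 => l _.
    have -> : (fun t => q.[t] * t ^+ l) = fun t => \sum_(k < n) u 0 k * (t ^+ k * t ^+ l).
      by apply/funext => t; rewrite qE mulr_suml; apply: eq_bigr => k _; rewrite mulrA.
    rewrite (axis_mean_sum _ _ (F := fun (k : 'I_n) t => t ^+ k * t ^+ l))//.
    have := congr1 (fun M : 'rV_n => M 0 l) uG; rewrite !mxE => H.
    rewrite [X in _ * X](_ : _ = 0) ?mulr0//; apply: etrans H.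
    by apply: eq_bigr => k _; rewrite mxE.
  have q0 : q = 0.
    apply: poly_eq0_itv => t /andP[t0 t1].
    have [|v <-] := @axis_surj t; first by rewrite t1 andbT (le_trans _ t0)// oppr_le0.
    have cqv : continuous (fun v : T => q.[inner (axis 0) (val v)]).
      by apply: continuous_poly; exact: continuous_linear_form.
    apply/eqP; rewrite -sqrf_eq0 expr2; apply/eqP.
    apply: (Imean_faithful (continuous_mul cqv cqv) _ q2) => w.
    by rewrite -expr2 sqr_ge0.
  apply/rowP => k; rewrite mxE.
  have : q`_k = 0 by rewrite q0 coef0.
  by rewrite coef_poly ltn_ord valK.
pose b : 'rV[R]_n := \row_k nu (fun t => phi t * t ^+ k).
pose c := b *m invmx G.
have cG : c *m G = b by rewrite mulmxKV.
pose p := \poly_(k < n) (if insub k is Some k' then c 0 k' else 0).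
exists p; first exact: size_poly.
move=> k kn.
have pE t : p.[t] = \sum_(k < n) c 0 k * t ^+ k.
  by rewrite horner_poly; apply: eq_bigr => l _; rewrite valK.
have -> : (fun t => (phi t - p.[t]) * t ^+ k) =
    fun t => (-1) * (\sum_(l < n) c 0 l * (t ^+ l * t ^+ k)) + phi t * t ^+ k.
  apply/funext => t; rewrite mulrBl mulN1r addrC pE mulr_suml; congr (- _ + _).
  by apply: eq_bigr => l _; rewrite mulrA.
rewrite axis_mean_lin; last 2 first.
- apply: (@continuous_sum_ffun _ _ _ _ (fun (l : 'I_n) (t : R) => c 0 l * (t ^+ l * t ^+ k))) => l.
  by apply: continuous_mul; [exact: cst_continuous|exact: cX].
- by apply: continuous_mul => //; exact: continuous_exprn.
rewrite (axis_mean_sum _ _ (F := fun (l : 'I_n) t => t ^+ l * t ^+ k))//.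
have := congr1 (fun M : 'rV_n => M 0 (Ordinal kn)) cG; rewrite !mxE => <-.
rewrite mulN1r addrC; apply/eqP; rewrite subr_eq0; apply/eqP.
by apply: eq_bigr => l _; congr (_ * _); rewrite mxE.
Qed.

Local Notation lam := (@lam R d).

(** Once the projection [p] is removed from [phi], the part of parity [n] has no moments at all:
    those of the wrong parity cancel, those of order below [n] are killed by the projection, and the
    rest vanish by strong induction. *)
Theorem lam_eq0_poly n phi : continuous phi -> (forall i, lam n i phi = 0) ->
  exists2 p : {poly R}, (size p <= n)%N &
    forall t, -1 <= t <= 1 -> phi t + (-1) ^+ n * phi (- t) = p.[t].
Proof.
move=> cphi lphi.
have [p sp pP] := axis_projection n cphi.
have cX k : continuous (fun t : R => t ^+ k) by exact: continuous_exprn.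
have cpoly (q : {poly R}) : continuous (fun t : R => q.[t]).
  by apply: (@continuous_poly R R q id) => t; exact: cvg_id.
pose h t := phi t - p.[t].
have ch : continuous h.
  rewrite (_ : h = fun t => (-1) * p.[t] + phi t); first exact: continuous_lin.
  by apply/funext => t; rewrite mulN1r addrC.
have cneg (g : R -> R) : continuous g -> continuous (fun t => g (- t)).
  move=> cg; apply: (@continuous_compR _ _ g (fun t : R => - t)) => // t.
  exact: continuousN.
(* [h] is orthogonal to [L]: [phi] by assumption, and [p], of degree less than [n], by
   [lam_monomial]. *)
have nuhL i L : (forall psi, continuous psi -> lam n i psi = nu (fun t => psi t * L.[t])) ->
    nu (fun t => h t * L.[t]) = 0.
  move=> HL.
  have pL : nu (fun t => p.[t] * L.[t]) = 0.
    have -> : (fun t => p.[t] * L.[t]) = fun t => \sum_(k < size p) p`_k * (t ^+ k * L.[t]).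
      by apply/funext => t; rewrite horner_coef mulr_suml; apply: eq_bigr => k _; rewrite mulrA.
    rewrite (axis_mean_sum _ _ (F := fun (k : 'I_(size p)) t => t ^+ k * L.[t])); last first.
      by move=> k; exact: continuous_mul.
    apply: big1 => k _; rewrite -HL// lam_monomial ?mulr0//.
    exact: leq_trans (ltn_ord k) sp.
  have -> : (fun t => h t * L.[t]) = fun t => (-1) * (p.[t] * L.[t]) + phi t * L.[t].
    by apply/funext => t; rewrite /h; ring.
  by rewrite axis_mean_lin ?pL -?HL ?lphi ?mulr0 ?addr0//; exact: continuous_mul.
pose f t := h t + (-1) ^+ n * h (- t).
have cf : continuous f.
  rewrite (_ : f = fun t => (-1) ^+ n * h (- t) + h t); last by apply/funext => t; rewrite addrC.
  by apply: continuous_lin => //; exact: cneg.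
have nufq (q : {poly R}) : nu (fun t => f t * q.[t]) =
    nu (fun t => h t * q.[t]) + (-1) ^+ n * nu (fun t => h t * q.[- t]).
  have cq' : continuous (fun t => q.[- t]) by apply: (cneg (fun t => q.[t])).
  have -> : nu (fun t => h t * q.[- t]) = nu (fun t => h (- t) * q.[t]).
    rewrite -(axis_meanN d2 (phi := fun t => h t * q.[- t])); last exact: continuous_mul.
    by congr axis_mean; apply/funext => t; rewrite opprK.
  rewrite addrC -axis_mean_lin; last 2 first.
  - by apply: continuous_mul => //; exact: cneg.
  - exact: continuous_mul.
  by congr axis_mean; apply/funext => t; rewrite /f; ring.
have nuf k : nu (fun t => f t * t ^+ k) = 0.
  have [m] := ubnP k; elim: m k => // m IH k km.
  have E : nu (fun t => f t * t ^+ k) = (1 + (-1) ^+ (n + k)) * nu (fun t => h t * t ^+ k).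
    have := nufq 'X^k.
    under eq_fun do rewrite hornerXn.
    move=> ->; rewrite exprD mulrDl mul1r -mulrA; congr (_ + _ * _).
      by congr axis_mean; apply/funext => t; rewrite hornerXn.
    rewrite /axis_mean -ImeanZ; last first.
      apply: (@continuous_compR _ _ (fun t => h t * t ^+ k)); last exact: continuous_linear_form.
      exact: continuous_mul.
    by congr Imean; apply/funext => v; rewrite hornerXn [X in _ * X = _]exprNn mulrCA.
  have [onk|enk] := boolP (odd (n + k)).
    by rewrite E -signr_odd onk expr1 subrr mul0r.
  have [kn|nk] := ltnP k n; first by rewrite E pP// mulr0.
  (* Now [k] is the exact degree of a polynomial [L] of [lamE]. Its lower terms have zero moments by
     induction, so orthogonality to [L] leaves the leading term alone. *)
  pose i := (k - n)./2.
  have ki : (k = n + i.*2)%N.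
    have ekn : ~~ odd (k - n) by rewrite oddB// addbC -oddD.
    by have := odd_double_half (k - n); rewrite (negbTE ekn) add0n -/i => ->; rewrite subnKC.
  have [L [sL LN HL]] := @lamE R d d2 n i.
  have hL0 := nuhL _ _ HL.
  have : nu (fun t => f t * L.[t]) = 0.
    rewrite nufq hL0 add0r.
    under eq_fun do rewrite LN mulrCA.
    rewrite /axis_mean ImeanZ; last first.
      apply: (@continuous_compR _ _ (fun t => h t * L.[t])); last exact: continuous_linear_form.
      exact: continuous_mul.
    by rewrite -/(nu (fun t => h t * L.[t])) hL0 !mulr0.
  have -> : (fun t => f t * L.[t]) = fun t => \sum_(l < k.+1) L`_l * (f t * t ^+ l).
    apply/funext => t; rewrite horner_coef sL -ki mulr_sumr.
    by apply: eq_bigr => l _; rewrite mulrCA.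
  rewrite (axis_mean_sum _ _ (F := fun (l : 'I_k.+1) t => f t * t ^+ l)); last first.
    by move=> l; exact: continuous_mul.
  rewrite big_ord_recr /= big1 ?add0r => [|l _]; last first.
    by rewrite IH ?mulr0// (leq_trans (ltn_ord l)).
  move=> /eqP; rewrite mulf_eq0 => /orP[|/eqP//].
  have : lead_coef L != 0 by rewrite lead_coef_eq0 -size_poly_eq0 sL.
  by rewrite lead_coefE sL -ki => /negbTE ->.
have f0 := axis_mean_eq0 cf nuf.
exists (p + (-1) ^+ n *: (p \Po (- 'X))).
  apply: leq_trans (size_polyD _ _) _; rewrite geq_max sp /=.
  apply: leq_trans (size_scale_leq _ _) _.
  by rewrite size_comp_poly2// size_polyN size_polyX.
move=> t t1; have := f0 t t1.
rewrite /f /h hornerD hornerZ horner_comp hornerN hornerX => H.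
by apply/eqP; rewrite -subr_eq0; apply/eqP; rewrite -[RHS]H; ring.
Qed.

End ZonalDensity.

(** * Kernel sections on the suspension of the sphere *)

Section Suspension.
Context {R : realType} {d : nat}.

Definition suspend (a : R) (v : 'rV[R]_d.+1) : 'rV[R]_d.+2 :=
  \row_i (if unlift ord0 i is Some j then v ord0 j else a).

Lemma inner_suspend a b u v : inner (suspend a u) (suspend b v) = a * b + inner u v.
Proof.
rewrite /inner big_ord_recl !mxE unlift_none; congr (_ + _).
by apply: eq_bigr => i _; rewrite !mxE liftK.
Qed.

Lemma suspendD a b u v : suspend a u + suspend b v = suspend (a + b) (u + v).
Proof. by apply/rowP => i; rewrite !mxE; case: unliftP => [j|] _ //; rewrite mxE. Qed.

Lemma suspendZ c a u : c *: suspend a u = suspend (c * a) (c *: u).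
Proof. by apply/rowP => i; rewrite !mxE; case: unliftP => [j|] _ //; rewrite mxE. Qed.

Lemma emb_subproof (y : sphere R d) : inner (suspend 0 (val y)) (suspend 0 (val y)) = 1.
Proof. by rewrite inner_suspend mul0r add0r sphereP. Qed.

Definition emb (y : sphere R d) : sphere R d.+1 := mksphere (emb_subproof y).

Lemma inner_emb (x y : sphere R d) : inner (val (emb x)) (val (emb y)) = inner (val x) (val y).
Proof. by rewrite /= inner_suspend mul0r add0r. Qed.

Lemma continuous_emb : continuous emb.
Proof.
apply: continuous_to_sphere.
have cs : continuous (fun v : 'rV[R]_d.+1 => suspend 0 v).
  move=> v; apply/(@cvgrPdist_lt R _ _ _ (nbhs_filter v)) => e e0.
  have /(@cvgrPdist_lt R _ _ _ (nbhs_filter v))/(_ _ e0) :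
    (fun u : 'rV[R]_d.+1 => u) @ v --> v by exact: cvg_id.
  apply: (@filterS _ _ (nbhs_filter v)) => u.
  have -> : suspend 0 v - suspend 0 u = suspend 0 (v - u).
    by rewrite -scaleN1r suspendZ suspendD scaleN1r mulr0 addr0.
  rewrite /Num.norm /= !mx_normrE => /bigmax_ltP[_ H].
  apply/bigmax_ltP; split => // -[i j] _ /=; rewrite mxE ord1.
  case: unliftP => [k _|_]; last by rewrite normr0.
  exact: (H (ord0, k)).
move=> y; apply: (@continuous_comp _ _ _ (val : sphere R d -> _)); first exact: continuous_val.
exact: cs.
Qed.

End Suspension.

(** Compactness of [X] makes the continuity in [y] uniform in [x]. This supplies the equicontinuity
    for [Imean_approx] and the continuity of infima over [X]. *)
Lemma tube_continuity (R : realType) (X Y : topologicalType) (G : X -> Y -> R) :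
  compact [set: X] -> continuous (fun p : X * Y => G p.1 p.2) ->
  forall y (e : R), 0 < e -> \forall y' \near y, forall x, `|G x y' - G x y| <= e.
Proof.
move=> cX cG y e e0.
have H : \forall y' \near y, [set: X] `<=` (fun x => `|G x y' - G x y| <= e).
  have /compact_near_coveringP := cX; apply => x _.
  have e2 : 0 < e / 2 by rewrite divr_gt0.
  have /cvgrPdist_le/(_ _ e2) [[U V] /= [Ux Vy] UV] := cG (x, y).
  exists (U, V) => //= -[x' y'] /= [Ux' Vy'].
  have h1 := UV (x', y') (conj Ux' Vy').
  have h2 := UV (x', y) (conj Ux' (nbhs_singleton Vy)).
  rewrite /= !ler_norml in h1 h2 *; lra.
by apply: filterS H => y' H x; exact: H.
Qed.

Lemma kernel_seq_ge0 (R : realType) (X : Type) (k : X -> X -> R) (s : seq (R * X)) :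
  is_kernel k -> 0 <= mean s (fun x => mean s (k x)).
Proof.
move=> [_ kpsd]; case: s => [|c0 s']; first by rewrite /mean big_nil.
set s := c0 :: s'.
have := kpsd (size s) (fun i => (nth c0 s i).1) (fun i => (nth c0 s i).2).
congr (0 <= _); rewrite /mean (big_nth c0) big_mkord; apply: eq_bigr => i _.
rewrite (big_nth c0) big_mkord mulr_sumr; apply: eq_bigr => j _.
by rewrite mulrA.
Qed.

Section KernelSections.
Context {R : realType} {d : nat} (g : R -> R).
Context (g_psd : is_kernel (fun x y : sphere R d.+1 => g (inner (val x) (val y)))).
Context (B : set (sphere R d -> R)) (linB : lin_closed B).
Context (Bk : forall y : sphere R d, B (fun x => g (inner (val x) (val y)))).

(* Minimise the distance, in the Hilbert space of the kernel on the larger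
   sphere, from the section at [x] to the span of the sections at points of
   the equator. *)
Lemma section_in_closure (x : sphere R d.+1) :
  uclosure B (fun y => g (inner (val x) (val (emb y)))).
Proof.
pose f y := g (inner (val x) (val (emb y))).
pose h (s : seq (R * sphere R d)) (y : sphere R d) := mean s (fun y' => g (inner (val y) (val y'))).
(* The squared Hilbert distance from the section at [x] to the combination [h s]; it equals the
   quadratic form of the signed measure [E s]. *)
pose q s := g 1 - 2 * mean s f + mean s (h s).
pose E (s : seq (R * sphere R d)) := (1, x) :: [seq (- c.1, emb c.2) | c <- s].
have gC := g_psd.1.
have q_ge0 s : 0 <= q s.
  have := kernel_seq_ge0 (E s) g_psd.
  have ms F : mean (E s) F = F x - mean s (F \o emb).
    rewrite /mean big_cons big_map mul1r; congr (_ + _).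
    by rewrite -sumrN; apply: eq_bigr => c _; rewrite mulNr.
  rewrite ms ms sphereP.
  have -> : mean s ((fun y => mean (E s) (fun y' => g (inner (val y) (val y')))) \o emb) =
      mean s f - mean s (h s).
    rewrite -[RHS]addrC -[- _]mulN1r -mean_lin; congr mean; apply/funext => y.
    apply: etrans (ms _) _; rewrite mulN1r addrC gC; congr (- _ + _).
    by congr mean; apply/funext => y'; rewrite /= inner_suspend mul0r add0r.
  congr (0 <= _); rewrite /q (_ : mean s (_ \o emb) = mean s f)//; ring.
have q_add s t y : q (rcons s (t, y)) = q s - 2 * t * (f y - h s y) + t ^+ 2 * g 1.
  have mr F : mean (rcons s (t, y)) F = mean s F + t * F y by rewrite /mean -cats1 big_cat big_seq1.
  have hr y' : h (rcons s (t, y)) y' = t * g (inner (val y') (val y)) + h s y'.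
    by rewrite /h mr addrC.
  have -> : q (rcons s (t, y)) = g 1 - 2 * (mean s f + t * f y) +
      (t * h s y + mean s (h s) + t * (t * g 1 + h s y)).
    rewrite /q !mr hr sphereP; congr (_ + (_ + _)).
    rewrite (_ : h (rcons s (t, y)) = fun y' => t * g (inner (val y') (val y)) + h s y'); last first.
      by apply/funext => y'; exact: hr.
    rewrite mean_lin; congr (_ * _ + _).
    by congr mean; apply/funext => y'; rewrite innerC.
  rewrite /q; ring.
pose i := inf (range q).
have hi : has_inf (range q).
  by split; [exists (q [::]), [::]|exists 0 => _ [s _ <-]].
move=> e e0; pose G := `|g 1| + 1.
have G0 : 0 < G by rewrite ltr_wpDl.
have [_ [s _ <-] qs] := inf_adherent (divr_gt0 (exprn_gt0 2 e0) G0) hi.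
exists (h s).
  have B0 : B (fun=> 0).
    exact: lin_closed0 linB (Bk point).
  rewrite (_ : h s = fun y => \sum_(c <- s) c.1 * g (inner (val y) (val c.2)))//.
  exact: (lin_closed_sum s (fun c => c.1) (F := fun c y => g (inner (val y) (val c.2)))).
move=> y; rewrite -(@ler_pXn2r _ 2)// ?nnegrE ?(ltW e0)// real_normK ?num_real//.
(* Adding this mass at [y] lowers [q] by at least [(f y - h s y) ^+ 2 / G], whereas [q s] is within
   [e ^+ 2 / G] of the infimum. [G] bounds [g 1] and is positive even if [g 1 = 0]. *)
pose t := (f y - h s y) / G.
have : i <= q (rcons s (t, y)) by apply: ge_inf; [case: hi|exists (rcons s (t, y))].
rewrite q_add => it.
have gG : t ^+ 2 * g 1 <= t ^+ 2 * G.
  by rewrite ler_wpM2l ?sqr_ge0// /G ler_wpDr// ler_norm.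
have tE : - 2 * t * (f y - h s y) + t ^+ 2 * G = - ((f y - h s y) ^+ 2 / G).
  by rewrite /t; field; rewrite gt_eqF.
rewrite -(ler_pM2r (_ : 0 < G^-1)) ?invr_gt0//.
rewrite -/(f y); move: qs it gG tE; rewrite -/i; lra.
Qed.

End KernelSections.

Lemma sum_even_bin (R : comNzRingType) (n : nat) (G : nat -> R) :
  (forall k, odd k -> G k = 0) ->
  \sum_(k < n.+1) 'C(n, k)%:R * G k = \sum_(j < n.+1) 'C(n, j.*2)%:R * G j.*2.
Proof.
move=> G0.
have H N : \sum_(k < N.*2) 'C(n, k)%:R * G k = \sum_(j < N) 'C(n, j.*2)%:R * G j.*2.
  elim: N => [|N IH]; first by rewrite !big_ord0.
  rewrite doubleS !big_ord_recr /= IH -addrA (G0 N.*2.+1) ?mulr0 ?addr0//=.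
  by rewrite odd_double.
rewrite -H -!(big_mkord xpredT (fun k => 'C(n, k)%:R * G k)).
rewrite [RHS](@big_cat_nat _ _ _ n.+1)//=; last by rewrite -addnn leq_addr.
rewrite [X in _ = _ + X]big_nat_cond [X in _ = _ + X]big1 ?addr0// => k.
by rewrite andbT => /andP[nk _]; rewrite bin_small// mul0r.
Qed.

(** If [w] is a multiple of [y], then [r = 0] and [e] is any unit vector orthogonal to [y]; it is
    found by projecting coordinate vector 0 when [y] has zero first coordinate, and coordinate
    vector 1 otherwise. *)
Lemma orthogonal_decomposition (R : realType) (d : nat) (y w : 'rV[R]_d.+1) :
  (1 <= d)%N -> inner y y = 1 ->
  exists e r, [/\ inner e e = 1, inner y e = 0 & w = inner w y *: y + r *: e].
Proof.
move=> d1 yy.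
have unit u : u != inner u y *: y ->
    exists e r, [/\ inner e e = 1, inner y e = 0 & u = inner u y *: y + r *: e].
  move=> uy; pose p := u - inner u y *: y.
  have p0 : 0 < inner p p by rewrite inner_gt0 subr_eq0.
  pose r := Num.sqrt (inner p p).
  have r0 : r != 0 by rewrite gt_eqF// sqrtr_gt0.
  have rr : r ^+ 2 = inner p p by rewrite sqr_sqrtr// ltW.
  exists (r^-1 *: p), r; split.
  - by rewrite innerZl innerZr -rr; field.
  - by rewrite innerZr /p innerBr innerZr yy (innerC y) mulr1 subrr mulr0.
  - by rewrite scalerA divff// scale1r addrC subrK.
have [wy|] := eqVneq w (inner w y *: y); last exact: unit.
suff [u /unit [e [r [ee ye _]]]] : exists u, u != inner u y *: y.
  by exists e, 0; rewrite scale0r addr0.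
pose i0 : 'I_d.+1 := ord0; pose i1 : 'I_d.+1 := inord 1.
have i01 : i1 != i0 by rewrite -(inj_eq val_inj) /= inordK.
have [y0|y0] := eqVneq (y ord0 i0) 0.
  exists (delta_mx ord0 i0); rewrite innerC inner_delta y0 scale0r.
  by apply/eqP => /rowP/(_ i0)/eqP; rewrite !mxE !eqxx oner_eq0.
exists (delta_mx ord0 i1); rewrite innerC inner_delta.
apply/eqP => H; have := congr1 (fun v : 'rV[R]_d.+1 => v ord0 i0) H.
rewrite !mxE eqxx /= eq_sym (negbTE i01) => /esym/eqP; rewrite mulf_eq0 (negbTE y0) orbF => /eqP y1.
have := congr1 (fun v : 'rV[R]_d.+1 => v ord0 i1) H.
by rewrite !mxE !eqxx y1 mul0r => /eqP; rewrite oner_eq0.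
Qed.

(** * Powers of linear forms in the closure *)

Section PowersInClosure.
Context {R : realType} {d : nat} (d1 : (1 <= d)%N) (g : R -> R) (cg : continuous g).
Context (g_psd : is_kernel (fun x y : sphere R d.+1 => g (inner (val x) (val y)))).
Context (B : set (sphere R d -> R)) (linB : lin_closed B).
Context (Bk : forall y : sphere R d, B (fun x => g (inner (val x) (val y)))).

Let pole : 'rV[R]_d.+2 := suspend 1 0.

(** By [Imean_approx] the mean is, uniformly in [y], a limit of finite weighted sums, and these are
    combinations of sections at points of the larger sphere. *)
Lemma moment_in_closure (w : 'rV[R]_d.+1) (a b : nat) :
  uclosure B (fun y : sphere R d => moment g (val (emb y)) (suspend 0 w) pole a b).
Proof.
pose F (v : sphere R d.+1) (y : sphere R d) :=
  g (inner (val (emb y)) (val v)) * inner (suspend 0 w) (val v) ^+ a * inner pole (val v) ^+ b.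
have cF y : continuous (F ^~ y) by exact: moment_continuous.
have cF2 : continuous (fun p : sphere R d.+1 * sphere R d => F p.1 p.2).
  have c1 : continuous (fun p : sphere R d.+1 * sphere R d => val p.1).
    move=> p; apply: (@continuous_comp _ _ _ (fun p : sphere R d.+1 * sphere R d => p.1) val).
      exact: cvg_fst.
    exact: continuous_val.
  have c2 : continuous (fun p : sphere R d.+1 * sphere R d => val (emb p.2)).
    move=> p; apply: (@continuous_comp _ _ _ (fun p : sphere R d.+1 * sphere R d => p.2) (val \o emb)).
      exact: cvg_snd.
    by apply: continuous_comp; [exact: continuous_emb|exact: continuous_val].
  have cc (u : 'rV[R]_d.+2) : continuous (fun p : sphere R d.+1 * sphere R d => u).
    exact: cst_continuous.
  apply: continuous_mul; last by apply: continuous_pow; exact: continuous_inner.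
  apply: continuous_mul; last by apply: continuous_pow; exact: continuous_inner.
  by apply: continuous_compR => //; exact: continuous_inner.
apply: uclosure_id => e e0.
have [m Hm] := Imean_approx (@sphere_compact R d) cF (tube_continuity (@sphere_compact R d.+1) cF2) e0.
exists (fun y => mean m (F ^~ y)); last exact: Hm.
pose c (p : R * sphere R d.+1) := p.1 * (inner (suspend 0 w) (val p.2) ^+ a * inner pole (val p.2) ^+ b).
rewrite (_ : (fun y => _) = fun y => \sum_(p <- m) c p * g (inner (val p.2) (val (emb y)))); last first.
  by apply/funext => y; apply: eq_bigr => p _; rewrite /F /c innerC; ring.
have B0 : uclosure B (fun=> 0).
  by apply: sub_uclosure; exact: lin_closed0 linB (Bk point).
apply: (lin_closed_sum m c (F := fun p y => g (inner (val p.2) (val (emb y)))) (uclosure_lin linB) B0).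
by move=> p _; exact: section_in_closure.
Qed.

(** Write [w = s y + r e] with [s = <w, y>] and expand the n-th power. Odd powers of [<e, v>] have
    mean 0, and [r ^+ 2 = <w, w> - s ^+ 2], so the result is a polynomial in [s]. The summand [Q j]
    has coefficient [(-1) ^+ j] in degree [n], which yields [lam]. *)
Lemma moment_poly (n i : nat) (w : 'rV[R]_d.+1) : exists P : {poly R},
  [/\ (size P <= n.+1)%N, P`_n = @lam R d.+1 n i g &
  forall y : sphere R d, moment g (val (emb y)) (suspend 0 w) pole n i.*2 = P.[inner w (val y)]].
Proof.
have d2 : (2 <= d.+1)%N by rewrite ltnS.
have oa := @orthonormal_axes R d.+1 d2.
pose gm k t := g t * t ^+ (n - k).
have cgm k : continuous (gm k) by apply: continuous_mul => //; exact: continuous_exprn.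
pose M k := @axis_moment R d.+1 (gm k) k i.*2.
pose Q j : {poly R} := 'X^(n - j.*2) * ((inner w w)%:P - 'X^2) ^+ j.
have qE : (inner w w)%:P - 'X^2 = (-1)%:P * ('X^2 - (inner w w)%:P) :> {poly R}.
  by rewrite polyCN; ring.
have sQ j : (j.*2 <= n)%N -> (size (Q j) <= n.+1)%N /\ (Q j)`_n = (-1) ^+ j.
  move=> jn; rewrite /Q qE exprMn -polyC_exp mulrCA mul_polyC.
  have mon : 'X^(n - j.*2) * ('X^2 - (inner w w)%:P) ^+ j \is @monic R.
    by rewrite monicMl ?monicXn// monic_exp// monicXnsubC.
  have sz : size ('X^(n - j.*2) * ('X^2 - (inner w w)%:P) ^+ j) = n.+1.
    rewrite size_Mmonic ?monic_exp ?monicXnsubC// -?size_poly_eq0 ?size_polyXn//.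
    have := size_exp ('X^2 - (inner w w)%:P : {poly R}) j; rewrite size_XnsubC//= mul2n => E.
    have : (0 < size (('X^2 - (inner w w)%:P : {poly R}) ^+ j))%N.
      by rewrite lt0n size_poly_eq0 monic_neq0// monic_exp// monicXnsubC.
    move: E; move: (size _) => s; lia.
  split; first by rewrite (leq_trans (size_scale_leq _ _))// sz.
  by have := mon; rewrite coefZ monicE lead_coefE sz => /eqP /= ->; rewrite mulr1.
exists (\sum_(j < n.+1) ('C(n, j.*2)%:R * M j.*2) *: Q j); split.
- apply: leq_trans (size_sum _ _ _) _; apply/bigmax_leqP => j _.
  have [jn|nj] := leqP j.*2 n; last by rewrite bin_small// mul0r scale0r size_poly0.
  by apply: leq_trans (size_scale_leq _ _) _; case: (sQ _ jn).
- rewrite coef_sum /lam; apply: eq_bigr => j _; rewrite coefZ.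
  have [jn|nj] := leqP j.*2 n; last by rewrite bin_small// mulr0 !mul0r.
  by rewrite (sQ _ jn).2 mulrC mulrA.
move=> y; set s := inner w (val y).
have [e [r [ee ye wE]]] := orthogonal_decomposition w d1 (sphereP y).
have rr : r ^+ 2 = inner w w - s ^+ 2.
  have : inner w w = s ^+ 2 + r ^+ 2.
    rewrite {1 2}wE -/s innerDl !innerDr !innerZl !innerZr sphereP ee ye (innerC e) ye; ring.
  by move=> ->; ring.
pose e' : 'rV[R]_d.+2 := suspend 0 e.
have o3 : orthonormal3 (val (emb y)) e' pole.
  by split; split; rewrite ?sphereP//= !inner_suspend ?ee ?ye ?inner0r; ring.
have w'E : suspend 0 w = s *: val (emb y) + r *: e'.
  by rewrite /= !suspendZ suspendD !mulr0 addr0 -wE.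
have gM k : moment (gm k) (val (emb y)) e' pole k i.*2 = M k by exact: moment_frame.
transitivity (\sum_(k < n.+1) 'C(n, k)%:R * (s ^+ (n - k) * r ^+ k * M k)).
  pose F (k : 'I_n.+1) (v : sphere R d.+1) := gm k (inner (val (emb y)) (val v)) *
     inner e' (val v) ^+ k * inner pole (val v) ^+ i.*2.
  transitivity (Imean (fun v => \sum_(k < n.+1) ('C(n, k)%:R * (s ^+ (n - k) * r ^+ k)) * F k v)).
    rewrite /moment; congr Imean; apply/funext => v.
    rewrite w'E innerDl !innerZl exprDn mulr_sumr mulr_suml; apply: eq_bigr => k _.
    by rewrite /F /gm !exprMn -mulr_natl; ring.
  rewrite Imean_sum; last by move=> k; exact: moment_continuous.
  by apply: eq_bigr => k _; rewrite -gM !mulrA.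
rewrite (sum_even_bin n (G := fun k => s ^+ (n - k) * r ^+ k * M k)) => [|k ok]; last first.
  by rewrite /M /axis_moment (moment_oddl _ (cgm k) oa ok) mulr0.
rewrite horner_sum; apply: eq_bigr => j _.
rewrite hornerZ /Q hornerM hornerXn horner_exp hornerD hornerN hornerC hornerXn.
by rewrite -mul2n exprM rr mul2n; ring.
Qed.

(** Strong induction: the lower powers are subtracted from the polynomial of [moment_poly] and the
    rest is divided by its nonzero leading coefficient. *)
Lemma power_in_closure (n : nat) :
  (forall n, exists i, @lam R d.+1 n i g != 0) ->
  forall w : 'rV[R]_d.+1, uclosure B (fun y : sphere R d => inner w (val y) ^+ n).
Proof.
move=> lam0 w; have [m] := ubnP n; elim: m n => // m IH n nm.
have [i li] := lam0 n.
have [P [sP Pn PE]] := moment_poly n i w.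
have linL := uclosure_lin linB.
have L0 : uclosure B (fun=> 0).
  by apply: sub_uclosure; exact: lin_closed0 linB (Bk point).
have H1 : uclosure B (fun y : sphere R d => P.[inner w (val y)]).
  rewrite (_ : (fun y => _) = fun y : sphere R d => moment g (val (emb y)) (suspend 0 w) pole n i.*2).
    exact: moment_in_closure.
  by apply/funext => y; rewrite PE.
have H2 : uclosure B (fun y : sphere R d => \sum_(k < n) P`_k * inner w (val y) ^+ k).
  apply: (lin_closed_sum _ (fun k : 'I_n => P`_k) (F := fun (k : 'I_n) (y : sphere R d) => inner w (val y) ^+ k)) => //.
  by move=> k _; apply: IH; exact: leq_trans (ltn_ord k) nm.
have H3 := linL (-1) _ _ H2 H1.
have := linL (P`_n)^-1 _ _ H3 L0; congr (_ _ _); apply/funext => y.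
have -> : P.[inner w (val y)] = \sum_(k < n.+1) P`_k * inner w (val y) ^+ k.
  exact: horner_coef_wide.
by rewrite big_ord_recr /= addr0 mulN1r addKr mulKf// Pn.
Qed.

(** The powers of a linear form give its exponential, by a uniformly convergent series, and the
    exponentials span a dense space. *)
Theorem sections_dense : (forall n, exists i, @lam R d.+1 n i g != 0) ->
  forall f : sphere R d -> R, continuous f -> uclosure B f.
Proof.
move=> lam0 f cf; apply: uclosure_id.
have linL := uclosure_lin linB.
have L0 : uclosure B (fun=> 0).
  by apply: sub_uclosure; exact: lin_closed0 linB (Bk point).
have Lexp (w : 'rV[R]_d.+1) : uclosure B (fun y : sphere R d => expR (inner w (val y))).
  apply: uclosure_id => e e0.
  have [C C0 HC] := compact_fun_bounded (@sphere_compact R d) (@continuous_linear_form R d w).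
  have [n Hn] := expR_series_uniform C e0.
  exists (fun y : sphere R d => \sum_(k < n) (k`!%:R)^-1 * inner w (val y) ^+ k).
    apply: (lin_closed_sum _ (fun k : 'I_n => (k`!%:R)^-1)
      (F := fun (k : 'I_n) (y : sphere R d) => inner w (val y) ^+ k)) => //.
    by move=> k _; exact: power_in_closure.
  move=> y; under eq_bigr do rewrite mulrC.
  by apply: Hn.
move=> e e0; have [h [s ->] fh] := exp_span_dense cf e0.
exists (fun x => \sum_(c <- s) c.1 * expR (inner c.2 (val x))) => //.
apply: (lin_closed_sum s (fun c => c.1)
  (F := fun (c : R * 'rV[R]_d.+1) (x : sphere R d) => expR (inner c.2 (val x)))) => //.
Qed.

End PowersInClosure.

(** * Finite rank on a great circle *)

Section Arc.
Context {R : realType} {d : nat} (d1 : (1 <= d)%N).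

Lemma arc_subproof (t : R) :
  let v : 'rV[R]_d.+1 := (Num.sqrt (1 + t ^+ 2))^-1 *: (delta_mx ord0 (inord 0) + t *: delta_mx ord0 (inord 1)) in
  inner v v = 1.
Proof.
have s0 : 0 < 1 + t ^+ 2 by rewrite ltr_pwDl// sqr_ge0.
have ss : Num.sqrt (1 + t ^+ 2) ^+ 2 = 1 + t ^+ 2 by rewrite sqr_sqrtr// ltW.
have sn : Num.sqrt (1 + t ^+ 2) != 0 by rewrite gt_eqF// sqrtr_gt0.
have i01 : (inord 1 : 'I_d.+1) != inord 0 by rewrite -(inj_eq val_inj) /= !inordK.
rewrite /= innerZl innerZr innerDl !innerDr !innerZl !innerZr !inner_delta !mxE !eqxx /=.
rewrite (negbTE i01) (eq_sym (inord 0)) (negbTE i01) /=.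
rewrite mulr0 !addr0 add0r mulr1 -expr2.
by move: (Num.sqrt _) ss sn => s <- sn; field.
Qed.

(** An open half of a great circle, parametrised by the slope [t]. Its first coordinate is positive,
    so its points and their antipodes are all distinct. *)
Definition arc (t : R) : sphere R d := mksphere (arc_subproof t).

Lemma arc0 t : val (arc t) ord0 (inord 0) = (Num.sqrt (1 + t ^+ 2))^-1.
Proof.
have i01 : (inord 1 : 'I_d.+1) != inord 0 by rewrite -(inj_eq val_inj) /= !inordK.
by rewrite /= !mxE !eqxx (eq_sym (inord 0)) (negbTE i01) /= mulr0 addr0 mulr1.
Qed.

Lemma arc1 t : val (arc t) ord0 (inord 1) = (Num.sqrt (1 + t ^+ 2))^-1 * t.
Proof.
have i01 : (inord 1 : 'I_d.+1) != inord 0 by rewrite -(inj_eq val_inj) /= !inordK.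
by rewrite /= !mxE !eqxx (negbTE i01) /= mulr1 add0r.
Qed.

Lemma arc0_gt0 t : 0 < val (arc t) ord0 (inord 0).
Proof. by rewrite arc0 invr_gt0 sqrtr_gt0 ltr_pwDl// sqr_ge0. Qed.

Lemma arc_inj : injective arc.
Proof.
move=> t u tu; have e0 := arc0 t; have e1 := arc1 t.
have := arc0_gt0 t; rewrite -e0 in e1; rewrite {}tu in e0 e1 *.
rewrite arc1 -arc0 in e1 => p0.
by move: e1 => /(mulfI (lt0r_neq0 p0)).
Qed.

Lemma inner_arc t (y : 'rV[R]_d.+1) : inner (val (arc t)) y =
  val (arc t) ord0 (inord 0) * y ord0 (inord 0) + val (arc t) ord0 (inord 1) * y ord0 (inord 1).
Proof.
by rewrite arc0 arc1 /= innerZl innerDl innerZl ![inner (delta_mx _ _) y]innerC !inner_delta; ring.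
Qed.

Definition opp_sphere (x : sphere R d) : sphere R d :=
  mksphere (etrans (etrans (innerNl (val x) (- val x)) (congr1 -%R (innerNr (val x) (val x))))
    (etrans (opprK _) (sphereP x))).

(* A polynomial of degree less than [n] in [<x, y>], with [x] on a great
   circle, involves fewer than [n * n] functions of [x]. *)
Lemma zonal_poly_dependent (n : nat) (p : {poly R}) : (size p <= n)%N ->
  exists2 u : 'rV[R]_(n * n).+1, u != 0 &
    forall y : sphere R d, \sum_l u ord0 l * p.[inner (val (arc (l : nat)%:R)) (val y)] = 0.
Proof.
move=> sp.
pose X (l a b : nat) : R := val (arc l%:R) ord0 (inord 0) ^+ a * val (arc l%:R) ord0 (inord 1) ^+ b.
(* Column [c] stands for the pair of exponents [c %/ n], [c %% n]; having one more row than columns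
   forces a linear relation between rows. *)
pose M : 'M[R]_((n * n).+1, n * n) := \matrix_(l, c) X l (c %/ n)%N (c %% n)%N.
have : kermx M != 0.
  rewrite kermx_eq0 /row_free; apply/eqP => rM.
  by have := rank_leq_col M; rewrite rM ltnn.
case/rowV0Pn => u /sub_kermxP uM u0; exists u => // y.
have uX a b : (a < n)%N -> (b < n)%N -> \sum_l u ord0 l * X l a b = 0.
  move=> an bn.
  have cn : (a * n + b < n * n)%N.
    by apply: leq_trans (_ : a.+1 * n <= _)%N; [rewrite mulSn addnC ltn_add2r|rewrite leq_mul2r an orbT].
  have := congr1 (fun v : 'rV_(n * n) => v ord0 (Ordinal cn)) uM; rewrite !mxE => H.
  apply: etrans H; apply: eq_bigr => l _; rewrite mxE /=; congr (_ * X _ _ _).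
    by rewrite divnMDl ?divn_small ?addn0//; exact: leq_ltn_trans bn.
  by rewrite modnMDl modn_small.
pose y0 := val y ord0 (inord 0); pose y1 := val y ord0 (inord 1).
transitivity (\sum_(l < (n * n).+1) \sum_(k < n) \sum_(j < k.+1)
    (p`_k * 'C(k, j)%:R * y0 ^+ (k - j) * y1 ^+ j) * (u ord0 l * X l (k - j)%N j)).
  apply: eq_bigr => l _; rewrite (horner_coef_wide _ sp) mulr_sumr; apply: eq_bigr => k _.
  rewrite inner_arc exprDn !mulr_sumr; apply: eq_bigr => j _.
  by rewrite !exprMn -mulr_natl /X -/y0 -/y1; ring.
rewrite exchange_big big1// => k _; rewrite exchange_big big1// => j _ /=.
rewrite -mulr_sumr uX ?mulr0//; last exact: leq_trans (ltn_ord j) (ltn_ord k).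
exact: leq_ltn_trans (leq_subr _ _) (ltn_ord k).
Qed.

(** The nodes are the points of the arc with weights [u] and their antipodes with weights
    [(-1) ^+ n * u]. Pairing antipodes turns [g] into [p], so this nonzero combination of sections
    vanishes at every point, hence at each node. *)
Lemma zonal_poly_not_spd (g : R -> R) (n : nat) (p : {poly R}) : (size p <= n)%N ->
  (forall t, -1 <= t <= 1 -> g t + (-1) ^+ n * g (- t) = p.[t]) ->
  ~ strictly_positive_definite (fun x y : sphere R d => g (inner (val x) (val y))).
Proof.
move=> sp gp [[gsym _] spd].
have [u u0 up] := zonal_poly_dependent sp.
pose N := (n * n).+1.
pose x (i : 'I_(N + N)) := match fintype.split i with
  inl l => arc (l : nat)%:R | inr l => opp_sphere (arc (l : nat)%:R) end.
pose a (i : 'I_(N + N)) := match fintype.split i with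
  inl l => u ord0 l | inr l => (-1) ^+ n * u ord0 l end.
have xl l : x (lshift N l) = arc (l : nat)%:R by rewrite /x (unsplitK (inl l)).
have xr l : x (rshift N l) = opp_sphere (arc (l : nat)%:R) by rewrite /x (unsplitK (inr l)).
have al l : a (lshift N l) = u ord0 l by rewrite /a (unsplitK (inl l)).
have ar l : a (rshift N l) = (-1) ^+ n * u ord0 l by rewrite /a (unsplitK (inr l)).
have opp_arc t s : arc t <> opp_sphere (arc s).
  move=> ts; have := arc0_gt0 t; rewrite ts /= mxE oppr_gt0 => H.
  by have := lt_trans (arc0_gt0 s) H; rewrite ltxx.
have opp_inj v w : opp_sphere v = opp_sphere w -> v = w.
  by move=> /(congr1 val)/= /oppr_inj vw; exact: val_inj.
have nat_inj (l m : 'I_N) : arc (l : nat)%:R = arc (m : nat)%:R -> l = m.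
  by move=> /arc_inj/eqP; rewrite eqr_nat => /eqP/val_inj.
have x_inj : injective x.
  move=> i j; case: (split_ordP i) => l ->; case: (split_ordP j) => m ->; rewrite ?xl ?xr.
  - by move=> /nat_inj ->.
  - by move=> /opp_arc.
  - by move=> /esym/opp_arc.
  - by move=> /opp_inj/nat_inj ->.
suff H : \sum_i \sum_j a i * a j * g (inner (val (x i)) (val (x j))) = 0.
  have a0 := spd _ a x x_inj H; case/negP: u0; apply/eqP/rowP => l.
  by rewrite mxE -al a0.
apply: big1 => i _.
rewrite (eq_bigr (fun j => a i * (a j * g (inner (val (x i)) (val (x j)))))); last first.
  by move=> j _; rewrite mulrA.
rewrite -mulr_sumr big_split_ord /= -big_split /=.
rewrite (eq_bigr (fun l : 'I_N => u ord0 l * p.[inner (val (arc (l : nat)%:R)) (val (x i))])) ?up ?mulr0//.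
move=> l _; rewrite al ar xl xr -gp ?inner_itv//= innerNr [inner _ (val (x i))]innerC; ring.
Qed.

End Arc.

(** * Isotropic kernels and reproducing kernel Hilbert spaces *)

Section Profile.
Context {R : realType}.

Lemma within_continuous_acos : {within `[(-1), 1], continuous (@acos R)}.
Proof.
have pi0 : (0 : R) <= pi := pi_ge0 R.
have cc : {within `[0, pi], continuous (@cos R)}.
  by apply: continuous_subspaceT; exact: continuous_cos.
have acos0pi : acos (-1 : R) = pi := acosN1 R.
apply: segment_dec_surj_continuous.
  have := segment_can_ge pi0 cc (@cosK R).
  by rewrite cos0 cospi.
rewrite acos1 acosN1 => t; rewrite /= in_itv /= => t0pi.
by exists (cos t); rewrite ?cosK//= in_itv /= cos_geN1 cos_le1.
Qed.

Definition clip (t : R) := Num.max (-1) (Num.min t 1).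

Lemma clip_itv t : clip t \in [set` `[-1 : R, 1]].
Proof.
apply/mem_set; rewrite /= in_itv /= /clip le_max lexx /= ge_max ge_min lexx orbT andbT.
by lra.
Qed.

Lemma clip_id t : -1 <= t <= 1 -> clip t = t.
Proof. by case/andP => t1 t2; rewrite /clip min_l// max_r. Qed.

(** [psi \o acos] extended by constants beyond [-1, 1], so that it is continuous on the whole line
    as the moment arguments require. *)
Definition profile (psi : R -> R) (t : R) : R := psi (acos (clip t)).

Lemma continuous_profile psi : {within `[0, pi], continuous psi} -> continuous (profile psi).
Proof.
move=> /subspace_sigL_continuousP cpsi.
have /subspace_sigL_continuousP cacos := within_continuous_acos.
have acosP (t : set_type [set` `[-1 : R, 1]]) : acos (val t) \in [set` `[0 : R, pi]].
  have := set_mem (valP t); rewrite /= in_itv /= => t1.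
  by apply/mem_set; rewrite /= in_itv /= acos_ge0// acos_lepi.
(* Factoring through the subtypes of the two intervals turns continuity within them into plain
   continuity. *)
pose clipS (t : R) : set_type [set` `[-1 : R, 1]] := exist _ (clip t) (clip_itv t).
pose acosS (t : set_type [set` `[-1 : R, 1]]) : set_type [set` `[0 : R, pi]] := exist _ (acos (val t)) (acosP t).
have c1 : continuous clipS.
  apply: continuous_comp_initial => t.
  rewrite (_ : _ \o _ = fun t : R => Num.max (-1) (Num.min t 1))//.
  apply: (@continuous_max _ _ (fun=> -1) (fun t : R => Num.min t 1)); first exact: cst_continuous.
  by apply: (@continuous_min _ _ (fun t : R => t) (fun=> 1)); [exact: cvg_id|exact: cst_continuous].
have c2 : continuous acosS by exact: continuous_comp_initial.
move=> t; apply: (@continuous_comp _ _ _ (acosS \o clipS) (sigL _ psi)); last exact: cpsi.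
by apply: continuous_comp; [exact: c1|exact: c2].
Qed.

Lemma isotropic_profile d psi (x y : sphere R d) :
  isotropic_kernel psi x y = profile psi (inner (val x) (val y)).
Proof. by rewrite /isotropic_kernel /geodesic /profile clip_id// inner_itv. Qed.

Lemma isotropic_profileE d psi :
  @isotropic_kernel R d psi = fun x y => profile psi (inner (val x) (val y)).
Proof. by apply/funext => x; apply/funext => y; exact: isotropic_profile. Qed.

Lemma Psi_restrict d psi : @Psi R d.+1 psi -> @Psi R d psi.
Proof.
rewrite /Psi /= !isotropic_profileE => -[cpsi [ksym kpsd]]; split => //; split.
  by move=> x y; rewrite innerC.
move=> n a x; have := kpsd n a (emb \o x); congr (0 <= _).
by apply: eq_bigr => i _; apply: eq_bigr => j _; rewrite inner_emb.
Qed.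

End Profile.

Section RKHS.
Context {R : realType} {X : Type} {k : X -> X -> R} (H : rkhs k).
Implicit Types f g h : X -> R.
Local Notation C := (rkhs_carrier H).
Local Notation dot := (rkhs_dot H).

Lemma rkhs_lin : lin_closed C.
Proof. by move=> a f g; exact: rkhs_linear. Qed.

Lemma dot_linear_r a f g h : C f -> C g -> C h ->
  dot h (fun x => a * f x + g x) = a * dot h f + dot h g.
Proof.
move=> Cf Cg Ch; rewrite rkhs_dotC//; last exact: rkhs_linear.
by rewrite rkhs_dot_linear// [dot f h]rkhs_dotC// [dot g h]rkhs_dotC.
Qed.

Lemma dot_cauchy_schwarz f g : C f -> C g -> dot f g ^+ 2 <= dot f f * dot g g.
Proof.
move=> Cf Cg.
have q a : 0 <= a ^+ 2 * dot f f + 2 * a * dot f g + dot g g.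
  have := rkhs_dot_ge0 (rkhs_linear a Cf Cg).
  rewrite rkhs_dot_linear ?dot_linear_r//; last exact: rkhs_linear.
  by rewrite (rkhs_dotC Cg Cf); congr (0 <= _); ring.
have [f0|f0] := eqVneq (dot f f) 0.
  rewrite f0 mul0r.
  have -> : dot f g = 0; last by rewrite expr0n.
  have [->|fg0] := eqVneq (dot f g) 0; first by [].
  (* With [dot f f = 0] the quadratic is affine in [a]; this value of [a] makes it equal to -1. *)
  have := q (- (dot g g + 1) / (2 * dot f g)).
  rewrite f0 mulr0 add0r (_ : 2 * _ * _ = - (dot g g + 1)); last by field.
  by move=> ?; exfalso; lra.
have ff : 0 < dot f f by rewrite lt_def f0 rkhs_dot_ge0.
have := q (- dot f g / dot f f).
rewrite (_ : _ + _ + _ = dot g g - dot f g ^+ 2 / dot f f); last by field.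
by rewrite subr_ge0 ler_pdivrMr// mulrC.
Qed.

Lemma kernel_section_diff x y : C (fun z => (-1) * k z y + k z x).
Proof. by apply: rkhs_linear; exact: rkhs_kernel. Qed.

Lemma dot_section_diff h x y : C h -> dot h (fun z => (-1) * k z y + k z x) = h x - h y.
Proof.
move=> Ch; rewrite dot_linear_r//; do ?exact: rkhs_kernel.
by rewrite !rkhs_reproducing// mulN1r addrC.
Qed.

Lemma dot_diff_diff x y :
  dot (fun z => (-1) * k z y + k z x) (fun z => (-1) * k z y + k z x) =
  k x x - k x y - k y x + k y y.
Proof. by rewrite dot_section_diff; [ring|exact: kernel_section_diff]. Qed.

Lemma rkhs_sum_sections n (a : 'I_n -> R) (x : 'I_n -> X) :
  C (fun z => \sum_i a i * k z (x i)) /\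
  forall h, C h -> dot h (fun z => \sum_i a i * k z (x i)) = \sum_i a i * h (x i).
Proof.
suff P (r : seq 'I_n) : C (fun z => \sum_(i <- r) a i * k z (x i)) /\
  forall h, C h -> dot h (fun z => \sum_(i <- r) a i * k z (x i)) = \sum_(i <- r) a i * h (x i).
  exact: P.
have C0 := rkhs_zero H.
elim: r => [|i r [Cr dr]].
  rewrite (_ : (fun z => _) = fun=> 0); last by apply/funext => z; rewrite big_nil.
  split => // h Ch; rewrite big_nil.
  have -> : (fun=> 0) = (fun x : X => (-1) * h x + h x) by apply/funext => z; ring.
  by rewrite dot_linear_r//; ring.
rewrite (_ : (fun z => _) = fun z => a i * k z (x i) + \sum_(i <- r) a i * k z (x i)); last first.
  by apply/funext => z; rewrite big_cons.
have Ck := rkhs_kernel H (x i).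
split; first exact: rkhs_linear.
by move=> h Ch; rewrite dot_linear_r// dr// rkhs_reproducing// big_cons.
Qed.

(** The quadratic form is the squared norm of the combination of sections. *)
Lemma null_combination n (a : 'I_n -> R) (x : 'I_n -> X) :
  \sum_i \sum_j a i * a j * k (x i) (x j) = 0 -> forall z, \sum_i a i * k z (x i) = 0.
Proof.
move=> q0 z; have [Cf df] := rkhs_sum_sections a x.
suff f0 : (fun z => \sum_i a i * k z (x i)) = fun=> 0 by have := congr1 (fun f => f z) f0.
apply: (rkhs_dot_eq0 Cf); rewrite df// -[RHS]q0; apply: eq_bigr => i _.
by rewrite mulr_sumr; apply: eq_bigr => j _; rewrite mulrA.
Qed.

End RKHS.

(** The squared distance between the sections at [x] and [y] is [w y], which is continuous and
    vanishes at [x]: the feature map is continuous into H. *)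
Lemma rkhs_continuous (R : realType) (X : topologicalType) (k : X -> X -> R) (H : rkhs k) (L : (X -> R) -> R) :
  continuous (fun p : X * X => k p.1 p.2) -> continuous_functional H L ->
  continuous (fun x => L (fun z => k z x)).
Proof.
move=> ck [Llin [D LD]] x; apply/cvgrPdist_le => e e0.
pose w y := k x x - k x y - k y x + k y y.
have cw : w y @[y --> x] --> (0 : R).
  have -> : 0 = w x by rewrite /w; ring.
  have cp (p : X -> X * X) : continuous p -> continuous (fun y => k (p y).1 (p y).2).
    by move=> cp y; apply: (@continuous_comp _ _ _ p (fun p => k p.1 p.2)); [exact: cp|exact: ck].
  have c1 : continuous (fun y => k x y).
    by apply: (cp (fun y => (x, y))) => y; apply: cvg_pair => //=; exact: cvg_cst.
  have c2 : continuous (fun y => k y x).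
    by apply: (cp (fun y => (y, x))) => y; apply: cvg_pair => //=; exact: cvg_cst.
  have c3 : continuous (fun y => k y y).
    by apply: (cp (fun y => (y, y))) => y; apply: cvg_pair.
  have cW : continuous w.
    rewrite (_ : w = fun y => 1 * ((-1) * k x y + ((-1) * k y x + k y y)) + k x x).
      apply: continuous_lin; last exact: cst_continuous.
      by apply: continuous_lin => //; exact: continuous_lin.
    by apply/funext => y; rewrite /w; ring.
  exact: cW.
have G0 : 0 < `|D| + 1 by rewrite ltr_wpDl.
have d0 : 0 < (e / (`|D| + 1)) ^+ 2 by rewrite exprn_gt0// divr_gt0.
have /cvgrPdist_le/(_ _ d0) := cw; apply: filterS => y.
rewrite sub0r normrN => wy.
have -> : L (fun z => k z x) - L (fun z => k z y) = L (fun z => (-1) * k z y + k z x).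
  by rewrite Llin ?mulN1r 1?addrC//; exact: rkhs_kernel.
apply: le_trans (LD _ (kernel_section_diff H x y)) _.
rewrite /rkhs_norm dot_diff_diff -/(w y).
have s1 : Num.sqrt (w y) <= e / (`|D| + 1).
  have E0 : 0 <= e / (`|D| + 1) by rewrite divr_ge0// ltW.
  rewrite -[leRHS](ger0_norm E0) -sqrtr_sqr; apply: ler_wsqrtr.
  exact: le_trans (ler_norm _) wy.
apply: le_trans (_ : (`|D| + 1) * (e / (`|D| + 1)) <= _).
  apply: le_trans (_ : `|D| * Num.sqrt (w y) <= _).
    by rewrite ler_wpM2r ?sqrtr_ge0// ler_norm.
  by apply: ler_pM; rewrite ?sqrtr_ge0// lerDl.
by rewrite mulrCA divff ?mulr1// gt_eqF.
Qed.

Lemma dot_functional (R : realType) (X : Type) (k : X -> X -> R) (H : rkhs k) f :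
  rkhs_carrier H f -> continuous_functional H (rkhs_dot H f).
Proof.
move=> Cf; split; first by move=> a g h Cg Ch; rewrite dot_linear_r.
exists (rkhs_norm H f) => g Cg; rewrite /rkhs_norm -sqrtrM ?rkhs_dot_ge0//.
by rewrite -sqrtr_sqr ler_wsqrtr// dot_cauchy_schwarz.
Qed.

Lemma rkhs_member_continuous (R : realType) (X : topologicalType) (k : X -> X -> R) (H : rkhs k) f :
  continuous (fun p : X * X => k p.1 p.2) -> rkhs_carrier H f -> continuous f.
Proof.
move=> ck Cf; rewrite (_ : f = fun x => rkhs_dot H f (fun z => k z x)).
  exact: rkhs_continuous ck (dot_functional Cf).
by apply/funext => x; rewrite rkhs_reproducing.
Qed.

Lemma continuous_isotropic (R : realType) d psi : {within `[0, pi], continuous psi} ->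
  continuous (fun p : sphere R d * sphere R d => isotropic_kernel psi p.1 p.2).
Proof.
move=> cpsi; rewrite isotropic_profileE.
apply: (@continuous_compR _ _ (profile psi)); first exact: continuous_profile.
apply: continuous_inner => p.
  by apply: (@continuous_comp _ _ _ (fun p : sphere R d * sphere R d => p.1) val); [exact: cvg_fst|exact: continuous_val].
by apply: (@continuous_comp _ _ _ (fun p : sphere R d * sphere R d => p.2) val); [exact: cvg_snd|exact: continuous_val].
Qed.

(** * Strict positive definiteness and universality *)

Theorem spd_universal (R : realType) d psi (d1 : (1 <= d)%N) (H : rkhs (@isotropic_kernel R d psi)) :
  Psi d.+1 psi -> strictly_positive_definite (@isotropic_kernel R d psi) -> universal H.
Proof.
move=> psiP spd; have [cpsi psd] := psiP.
have ck := continuous_isotropic (d := d) cpsi.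
split=> //; split; first by move=> h; exact: rkhs_member_continuous.
have cg := continuous_profile cpsi.
have dense := @sections_dense R d d1 _ cg _ (rkhs_carrier H); apply: dense.
- by move: psd; rewrite isotropic_profileE.
- exact: rkhs_lin.
- by move=> y; have := rkhs_kernel H y; congr (rkhs_carrier H _); apply/funext => x; exact: isotropic_profile.
move=> n; apply: contrapT => nlam.
have d2 : (2 <= d.+1)%N by rewrite ltnS.
have [|p sp gp] := @lam_eq0_poly R d.+1 d2 n _ cg.
  by move=> i; apply/eqP; apply: contraT => li; exfalso; apply: nlam; exists i.
apply: (zonal_poly_not_spd d1 sp gp).
by move: spd; rewrite isotropic_profileE.
Qed.

(** A null combination is orthogonal to H, so [sum_j a_j h(x_j) = 0] for every [h] in H and, by
    density, for every continuous function. The function [phi] vanishes at every node except [x i],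
    since [1 - <x, v>] is 0 only at [v = x]. *)
Lemma universal_spd (R : realType) d (k : sphere R d -> sphere R d -> R) (H : rkhs k) :
  is_kernel k -> universal H -> strictly_positive_definite k.
Proof.
move=> kk [ck [_ dense]]; split => // n a x x_inj q0 i.
have f0 := null_combination H q0.
have Hh h : rkhs_carrier H h -> \sum_j a j * h (x j) = 0.
  move=> Ch; have [_ <-//] := rkhs_sum_sections H a x.
  have -> : (fun z => \sum_j a j * k z (x j)) = fun z => (-1) * h z + h z.
    by apply/funext => z; rewrite f0; ring.
  by rewrite dot_linear_r//; ring.
pose phi (v : sphere R d) := \prod_(j | j != i) (1 - inner (val (x j)) (val v)).
have cphi : continuous phi.
  rewrite /phi; elim: (index_enum _) => [|j r IH].
    rewrite (_ : (fun v => _) = fun=> 1); first exact: cst_continuous.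
    by apply/funext => v; rewrite big_nil.
  have [ji|ji] := boolP (j != i); last first.
    rewrite (_ : (fun v => _) = fun v => \prod_(j <- r | j != i) (1 - inner (val (x j)) (val v)))//.
    by apply/funext => v; rewrite big_cons (negbTE ji).
  rewrite (_ : (fun v => _) = fun v => ((-1) * inner (val (x j)) (val v) + 1) *
     \prod_(j <- r | j != i) (1 - inner (val (x j)) (val v))).
    apply: continuous_mul => //; apply: continuous_lin; last exact: cst_continuous.
    exact: continuous_linear_form.
  by apply/funext => v; rewrite big_cons ji mulN1r addrC.
have phi_j j : j != i -> phi (x j) = 0.
  by move=> ji; rewrite /phi (bigD1 j)//= sphereP subrr mul0r.
have phi_i : phi (x i) != 0.
  rewrite /phi; apply/prodf_neq0 => j ji; rewrite subr_eq0.
  apply: contra ji => /eqP xji; apply/eqP/x_inj/val_inj/eqP.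
  rewrite -subr_eq0 -inner_eq0 innerBl !innerBr !sphereP (innerC (val (x i))) -xji.
  by rewrite subrr.
have : a i * phi (x i) = 0.
  apply/eqP; rewrite -normr_le0; apply/ler_addgt0Pl => e e0; rewrite addr0.
  pose A := \sum_j `|a j| + 1.
  have A0 : 0 < A by rewrite ltr_wpDl// sumr_ge0.
  have [h Ch hphi] := dense phi cphi _ (divr_gt0 e0 A0).
  have -> : a i * phi (x i) = \sum_j a j * (phi (x j) - h (x j)).
    under eq_bigr do rewrite mulrBr.
    rewrite sumrB (Hh h Ch) subr0 (bigD1 i)//= big1 ?addr0// => j ji.
    by rewrite phi_j// mulr0.
  apply: le_trans (ler_norm_sum _ _ _) _.
  apply: le_trans (_ : \sum_j `|a j| * (e / A) <= _).
    by apply: ler_sum => j _; rewrite normrM ler_wpM2l.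
  rewrite -mulr_suml mulrCA ger_pMr// ler_pdivrMr// mul1r /A.
  by rewrite lerDl.
by move=> /eqP; rewrite mulf_eq0 (negbTE phi_i) orbF => /eqP.
Qed.

(** * Borel probability measures on the sphere *)

Section FiniteSupport.
Context {disp : measure_display} {T : measurableType disp} {R : realType}.

Lemma finite_support_measure (s : seq (R * T)) : all (fun c => 0 <= c.1) s ->
  exists mu : {measure set T -> \bar R}, forall f : T -> R, measurable_fun setT f ->
    (forall x, 0 <= f x) -> (\int[mu]_x (f x)%:E = (mean s f)%:E)%E.
Proof.
elim: s => [|[a x] s IH] /=.
  move=> _; exists (@mzero _ T R) => f mf f0.
  by rewrite integral_measure_zero /mean big_nil.
move=> /andP[a0 /IH[mu Hmu]].
exists (measure_add (mscale (NngNum a0) (@dirac _ T x R)) mu) => f mf f0.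
have mf' : measurable_fun [set: T] (fun x => (f x)%:E) by exact/measurable_EFinP.
rewrite ge0_integral_measure_add//= => [|y _]; last by rewrite lee_fin.
rewrite ge0_integral_mscale// => [|y _]; last by rewrite lee_fin.
by rewrite integral_dirac// diracT mul1e Hmu// /mean big_cons EFinD EFinM.
Qed.

Lemma finite_support_probability (s : seq (R * T)) : prob_weights s ->
  exists P : probability T R,
    (forall A, measurable A -> P A = (mean s \1_A)%:E) /\
    forall f : T -> R, measurable_fun setT f ->
      P.-integrable setT (fun x => (f x)%:E) /\ \int[P]_x f x = mean s f.
Proof.
move=> ps; have /andP[s0 _] := ps.
have [mu Hmu] := finite_support_measure s0.
have muA A : measurable A -> mu A = (mean s \1_A)%:E.
  by move=> mA; rewrite -Hmu// integral_indic// setIT.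
have mu1 : mu setT = 1%E.
  rewrite muA// indicT; congr EFin; exact: mean_cst.
have [x0 _] : exists x0 : T, True.
  case: (s) ps => [|[a x] s' _]; last by exists x.
  by move=> /andP[_]; rewrite big_nil eq_sym oner_eq0.
(* Since [mu] has mass 1, normalisation leaves it unchanged and only packages it as a probability;
   the point mass is the fallback for degenerate total mass. *)
pose P : probability T R := mnormalize mu (@dirac _ T x0 R).
have PA A : P A = mu A.
  by rewrite /P /= /mnormalize mu1 /= onee_eq0 /= invr1 mule1.
have PE (f : T -> R) : measurable_fun setT f ->
    (forall x, 0 <= f x) -> (\int[P]_x (f x)%:E = (mean s f)%:E)%E.
  move=> mf f0; rewrite -Hmu//; apply: eq_measure_integral => A mA _.
  exact: PA.
exists P; split; first by move=> A mA; rewrite PA muA.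
move=> f mf.
have mf' : measurable_fun [set: T] (fun x => (f x)%:E) by exact/measurable_EFinP.
have iP : P.-integrable setT (fun x => (f x)%:E).
  apply/integrableP; split => //.
  under eq_integral do rewrite abse_EFin.
  rewrite PE ?ltry//; first exact: measurableT_comp.
split => //.
have mmax (h : T -> R) : measurable_fun setT h -> measurable_fun setT (fun x => Num.max (h x) 0).
  by move=> mh; exact: measurable_maxr.
rewrite /Rintegral integralE.
have -> : (\int[P]_x ((fun x => (f x)%:E)^\+ x) = (mean s (fun x => Num.max (f x) 0))%:E)%E.
  rewrite -PE; [|exact: mmax|by move=> x; rewrite le_max lexx orbT].
  by apply: eq_integral => x _; rewrite funeposE EFin_max.
have -> : (\int[P]_x ((fun x => (f x)%:E)^\- x) = (mean s (fun x => Num.max (- f x) 0))%:E)%E.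
  rewrite -PE; [|apply: mmax; exact: measurable_funN|by move=> x; rewrite le_max lexx orbT].
  by apply: eq_integral => x _; rewrite funenegE EFin_max.
rewrite -EFinB /= /mean -sumrB; apply: eq_bigr => c _.
rewrite -mulrBr; congr (_ * _).
by case: (lerP (f c.2) 0); case: (lerP (- f c.2) 0); lra.
Qed.

End FiniteSupport.

Section BorelSphere.
Context {R : realType} {d : nat}.
Local Notation S := (borel_sphere R d).

Lemma measurable_continuous (f : sphere R d -> R) : continuous f -> measurable_fun setT (f : S -> R).
Proof.
move=> /continuousP cf; apply: (measurability _ (RGenOpens.measurableE R)).
move=> _ [_ [a [b ->] <-]]; rewrite setTI; apply: sub_sigma_algebra.
exact/cf/interval_open.
Qed.

Lemma measurable_point (x : sphere R d) : measurable ([set x] : set S).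
Proof.
have mf : measurable_fun setT ((fun v => inner (val x) (val v)) : S -> R).
  by apply: measurable_continuous; exact: continuous_linear_form.
have := mf measurableT [set 1] (measurable_set1 1); rewrite setTI; congr measurable.
apply/seteqP; split => [v /= xv|v -> /=]; last exact: sphereP.
apply/esym/val_inj/eqP; rewrite -subr_eq0 -inner_eq0 innerBl !innerBr !sphereP (innerC (val v)).
by rewrite xv subrr.
Qed.

(** Pairs carry the product sigma-algebra, so measurability is built from the coordinates of each
    factor instead of joint continuity. *)
Lemma measurable_isotropic psi : {within `[0, pi], continuous psi} ->
  measurable_fun setT (fun p : S * S => @isotropic_kernel R d psi p.1 p.2).
Proof.
move=> cpsi; rewrite isotropic_profileE.
apply: (@measurableT_comp _ _ _ _ _ _ (profile psi)).
  by apply: continuous_measurable_fun; exact: continuous_profile.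
rewrite /inner.
apply: (@measurable_sum _ _ _ setT 'I_d.+1 (index_enum _)
  (fun i (p : S * S) => (val (p.1 : sphere R d)) ord0 i * (val (p.2 : sphere R d)) ord0 i)) => i.
have mc : measurable_fun setT ((fun v : sphere R d => val v ord0 i) : S -> R).
  apply: measurable_continuous => v.
  apply: (@continuous_comp _ _ _ (val : sphere R d -> _) (fun v : 'rV[R]_d.+1 => v ord0 i)).
    exact: continuous_val.
  exact: coord_continuous.
apply: measurable_funM.
  exact: (measurableT_comp mc measurable_fst).
exact: (measurableT_comp mc measurable_snd).
Qed.

(** The function is half the squared distance to the complement of [O], as [1 - <x, c>] is half of
    [|x - c|^2]; if the complement is empty, the constant 1 serves. *)
Lemma open_positive (O : set (sphere R d)) : open O ->
  exists f : sphere R d -> R, [/\ continuous f, forall x, 0 <= f x & forall x, O x <-> 0 < f x].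
Proof.
move=> oO.
have [[c0 Cc0]|C0] := pselect ((~` O) !=set0); last first.
  exists (fun=> 1); split => //; first exact: cst_continuous.
  by move=> x; split => // _; apply: contrapT => nOx; apply: C0; exists x.
pose D (x : sphere R d) := [set 1 - inner (val x) (val c) | c in ~` O].
have Dinf x : has_inf (D x).
  split; first by exists (1 - inner (val x) (val c0)), c0.
  by exists 0 => _ [c _ <-]; rewrite subr_ge0; case/andP: (inner_itv x c).
pose f x := inf (D x).
have fle x c : ~ O c -> f x <= 1 - inner (val x) (val c).
  by move=> Oc; apply: ge_inf; [case: (Dinf x)|exists c].
have lef x (a : R) : (forall c, ~ O c -> a <= 1 - inner (val x) (val c)) -> a <= f x.
  by move=> H; apply: lb_le_inf; [case: (Dinf x)|move=> _ [c Oc <-]; exact: H].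
have f0 x : 0 <= f x.
  by apply: lef => c _; rewrite subr_ge0; case/andP: (inner_itv x c).
exists f; split => //.
  have ci : continuous (fun p : sphere R d * sphere R d => 1 - inner (val p.2) (val p.1)).
    rewrite (_ : (fun p => _) = fun p => (-1) * inner (val p.2) (val p.1) + 1); last first.
      by apply/funext => p; rewrite mulN1r addrC.
    apply: continuous_lin; last exact: cst_continuous.
    apply: continuous_inner => p.
      by apply: (@continuous_comp _ _ _ (fun p : sphere R d * sphere R d => p.2) val); [exact: cvg_snd|exact: continuous_val].
    by apply: (@continuous_comp _ _ _ (fun p : sphere R d * sphere R d => p.1) val); [exact: cvg_fst|exact: continuous_val].
  move=> x; apply/(@cvgrPdist_le R _ _ _ (nbhs_filter x)) => e e0.
  have := @tube_continuity R _ _ (fun c x : sphere R d => 1 - inner (val x) (val c)) (@sphere_compact R d) ci x e e0.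
  apply: filterS => y H.
  have h1 : f y - e <= f x.
    by apply: lef => c Oc; have := fle y c Oc; have := H c; rewrite ler_norml => /andP[]; lra.
  have h2 : f x - e <= f y.
    by apply: lef => c Oc; have := fle x c Oc; have := H c; rewrite ler_norml => /andP[]; lra.
  by rewrite ler_norml; apply/andP; split; lra.
move=> x; split => [Ox|fx]; last first.
  apply: contrapT => nOx; have := fle x x nOx; rewrite sphereP subrr leNgt.
  by rewrite fx.
have cO : compact (~` O).
  by apply: subclosed_compact (@sphere_compact R d) _ => //; exact: open_closedC.
(* The distances from [x] to the compact complement have a positive lower bound. *)
have : \forall e \near (0 : R)^'+, ~` O `<=` (fun c => e <= 1 - inner (val x) (val c)).
  move/compact_near_coveringP: cO; apply => c Oc.
  have xc : 0 < (1 - inner (val x) (val c)) / 2.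
    rewrite divr_gt0// lt_def subr_ge0; case/andP: (inner_itv x c) => _ ->; rewrite andbT subr_eq0.
    apply/eqP => xc1; apply: Oc; suff -> : c = x by [].
    apply/esym/val_inj/eqP; rewrite -subr_eq0 -inner_eq0 innerBl !innerBr !sphereP (innerC (val c)).
    by rewrite -xc1 subrr.
  have /cvgrPdist_le/(_ _ xc) H := @continuous_linear_form R d (val x) c.
  near=> c' e => /=.
  have : `|inner (val x) (val c) - inner (val x) (val c')| <= (1 - inner (val x) (val c)) / 2 by near: c'.
  have : e <= (1 - inner (val x) (val c)) / 2 by near: e; exact: nbhs_right_le.
  by rewrite ler_norml => ? /andP[]; lra.
move=> H; have : \forall e \near (0 : R)^'+, 0 < e /\ ~` O `<=` (fun c => e <= 1 - inner (val x) (val c)).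
  by near=> e; split; near: e => //; exact: nbhs_right_gt.
move=> /filter_ex [e [e0 He]]; apply: lt_le_trans e0 _.
by apply: lef => c Oc; exact: He.
Unshelve. all: by end_near.
Qed.

Lemma continuous_integrable (P : probability S R) (f : sphere R d -> R) :
  continuous f -> P.-integrable setT (fun x : S => (f x)%:E).
Proof.
move=> cf; have [C C0 fC] := compact_fun_bounded (@sphere_compact R d) cf.
apply: measurable_bounded_integrable => //.
- exact: le_lt_trans (probability_le1 P measurableT) (ltry 1).
- exact: measurable_continuous.
- exists C; split; first exact: num_real.
  by move=> M CM x _; exact: le_trans (fC x) (ltW CM).
Qed.

(** Open sets are stable under intersection and generate the sigma-algebra. The indicator of an open
    set is the increasing limit of [min (n f, 1)], with [f] from [open_positive]. *)
Lemma probability_ext (P Q : probability S R) :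
  (forall f : sphere R d -> R, continuous f -> \int[P]_x f x = \int[Q]_x f x) ->
  forall A : set S, measurable A -> P A = Q A.
Proof.
move=> PQ E mE; apply: (@measure_unique _ R S (@open (sphere R d)) (fun=> setT) _ _ _ _ P Q _ _ E mE).
- by [].
- by move=> A B; exact: openI.
- by move=> _; exact: openT.
- by rewrite bigcup_const//; exists 0%N.
- move=> O oO; have [f [cf f0 fO]] := open_positive oO.
  pose g n (x : sphere R d) := Num.min (n%:R * f x) 1.
  have cg n : continuous (g n).
    move=> x; apply: (@continuous_min _ _ (fun x => n%:R * f x) (fun=> 1)); last exact: cst_continuous.
    by apply: continuous_mul; [exact: cst_continuous|exact: cf].
  have lim_g (x : S) : (limn (fun n => (g n x)%:E) = (\1_O x)%:E)%E.
    apply/cvg_lim => //; apply: cvg_EFin; first exact: nearW.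
    rewrite indicE; have [Ox|Ox] := boolP (x \in O).
      have fx : 0 < f x by apply/fO; exact: set_mem.
      apply: cvg_near_cst; exists (Num.truncn (f x)^-1).+1 => // n /= nf.
      rewrite /g min_r// -ler_pdivrMr// mul1r ltW//.
      by apply: lt_le_trans (truncnS_gt _) _; rewrite ler_nat.
    apply: cvg_near_cst; apply: nearW => n; rewrite /g /=.
    have -> : f x = 0.
      apply/eqP; rewrite eq_le f0 andbT leNgt; apply/negP => /fO/mem_set.
      exact/negP.
    by rewrite mulr0 min_l// (negbTE Ox).
  have key (M : probability S R) :
      (\int[M]_x (g n x)%:E)%E @[n --> \oo] --> M O.
    have := @cvg_monotone_convergence _ S R M setT measurableT (fun n x => (g n x)%:E).
    have -> : (\int[M]_x limn (fun n => (g n x)%:E) = M O)%E.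
      under eq_integral do rewrite lim_g.
      by rewrite integral_indic// ?setIT//; exact: sub_sigma_algebra.
    apply.
    + by move=> n; apply/measurable_EFinP; exact: measurable_continuous.
    + by move=> n x _; rewrite lee_fin /g le_min ler01 andbT mulr_ge0.
    + move=> x _ n m nm; rewrite lee_fin /g le_min ge_min ge_min lexx orbT andbT.
      by rewrite ler_wpM2r ?ler_nat.
  apply: cvg_unique (key P) _.
    exact: ereal_hausdorff.
  have -> : (fun n => \int[P]_x (g n x)%:E)%E = (fun n => \int[Q]_x (g n x)%:E)%E.
    apply/funext => n; have := PQ _ (cg n); rewrite /Rintegral => H.
    by rewrite -[LHS]fineK ?H ?fineK//; exact: integrable_fin_num (continuous_integrable _ (cg n)).
  exact: key.
- by move=> _; exact: le_lt_trans (probability_le1 P measurableT) (ltry 1).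
Qed.

End BorelSphere.

(** * Universal and characteristic kernels *)

Lemma embedding_integral (R : realType) (disp : measure_display) (X : measurableType disp)
    (k : X -> X -> R) (H : rkhs k) (P : probability X R) (h f : X -> R) :
  is_kernel_embedding H P h -> rkhs_carrier H f -> \int[P]_x f x = rkhs_dot H f h.
Proof.
move=> [_ Hh] Cf; have [_ ->] := Hh _ (dot_functional Cf).
by congr Rintegral; apply/funext => x; rewrite rkhs_reproducing.
Qed.

(** Measures with the same embedding integrate the elements of H alike, hence by density all
    continuous functions, and these determine a Borel probability. *)
Theorem universal_characteristic (R : realType) d psi (H : rkhs (@isotropic_kernel R d psi)) :
  {within `[0, pi], continuous psi} -> universal H ->
  @characteristic R _ (borel_sphere R d) (@isotropic_kernel R d psi) H.
Proof.
move=> cpsi [ck [Hc dense]]; split; [|split].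
(* Cauchy-Schwarz between two sections; [profile psi 1] is the constant diagonal value of the
   kernel. *)
- exists `|profile psi 1| => x y.
  have Ck z : rkhs_carrier H (fun y => isotropic_kernel psi y z) by exact: rkhs_kernel.
  have := dot_cauchy_schwarz (Ck y) (Ck x).
  rewrite !rkhs_reproducing// !isotropic_profile !sphereP -expr2.
  rewrite -[leLHS]real_normK ?num_real// -[leRHS]real_normK ?num_real//.
  by rewrite ler_pXn2r// ?nnegrE.
- exact: measurable_isotropic.
move=> P Q h HP HQ; apply: probability_ext => f cf.
apply/eqP; rewrite -subr_eq0 -normr_le0; apply/ler_addgt0Pl => e e0; rewrite addr0.
have e2 : 0 < e / 2 by rewrite divr_gt0.
have [u Cu fu] := dense f cf _ e2.
have cu := Hc u Cu.
have key (M : probability (borel_sphere R d) R) :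
    `|\int[M]_x f x - \int[M]_x u x| <= e / 2.
  have iu := continuous_integrable M cu; have if_ := continuous_integrable M cf.
  rewrite -RintegralB//.
  have cfu : continuous (fun x => f x - u x).
    rewrite (_ : (fun x => _) = fun x => (-1) * u x + f x); first exact: continuous_lin.
    by apply/funext => x; rewrite mulN1r addrC.
  apply: le_trans (le_normr_Rintegral _ (continuous_integrable M cfu)) _ => //.
  have -> : e / 2 = \int[M]_x (e / 2).
    rewrite Rintegral_cst// [X in fine X](_ : _ = 1%E) ?mulr1//.
    exact: probability_setT.
  apply: le_Rintegral => //.
  - have := continuous_integrable M (fun x => cvg_norm (cfu x)); exact.
  - by have := continuous_integrable M (@cst_continuous (sphere R d) R (e / 2)).
have -> : \int[P]_x f x - \int[Q]_x f x =
    (\int[P]_x f x - \int[P]_x u x) - (\int[Q]_x f x - \int[Q]_x u x).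
  by rewrite (embedding_integral HP Cu) (embedding_integral HQ Cu); ring.
by rewrite (splitr e); apply: le_trans (ler_normB _ _) _; apply: lerD; exact: key.
Qed.

Lemma finite_embedding (R : realType) d psi (H : rkhs (@isotropic_kernel R d psi))
    (s : seq (R * borel_sphere R d)) (P : probability (borel_sphere R d) R) :
  {within `[0, pi], continuous psi} ->
  (forall f : borel_sphere R d -> R, measurable_fun setT f ->
      P.-integrable setT (fun x => (f x)%:E) /\ \int[P]_x f x = mean s f) ->
  @is_kernel_embedding R _ (borel_sphere R d) (@isotropic_kernel R d psi) H P
    (fun z => mean s (fun x => isotropic_kernel psi z x)).
Proof.
move=> cpsi HP; have ck := continuous_isotropic (d := d) cpsi.
have Ck x : rkhs_carrier H (fun z => isotropic_kernel psi z x) by exact: rkhs_kernel.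
split.
  exact: (lin_closed_sum s (fun c => c.1) (F := fun c z => isotropic_kernel psi z c.2)
    (rkhs_lin (H := H)) (rkhs_zero H)).
move=> L HL; have cL := rkhs_continuous ck HL.
have [iL ->] := HP _ (measurable_continuous cL); split => //.
have [Llin _] := HL; rewrite {1}/mean.
elim: s {HP} => [|c s IH].
  have := Llin (-1) _ _ (rkhs_zero H) (rkhs_zero H).
  rewrite (_ : (fun x => -1 * 0 + 0) = fun=> 0) => [H0|]; last by apply/funext => x; ring.
  rewrite (_ : (fun z => \sum_(c <- [::]) _) = fun=> 0); last by apply/funext => z; rewrite big_nil.
  by rewrite /mean big_nil H0; ring.
rewrite (_ : (fun z => \sum_(c <- _ :: _) _) =
   fun z => c.1 * isotropic_kernel psi z c.2 + mean s (fun x => isotropic_kernel psi z x)); last first.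
  by apply/funext => z; rewrite big_cons.
rewrite Llin//; last first.
  exact: (lin_closed_sum s (fun c => c.1) (F := fun c z => isotropic_kernel psi z c.2)
    (rkhs_lin (H := H)) (rkhs_zero H)).
by rewrite IH /mean big_cons.
Qed.

(* If a finite signed measure has zero embedding, then so does its image under
   a reflection; hence characteristic kernels force it to be invariant under
   reflections, and no nonzero finite measure is. *)
Theorem characteristic_spd (R : realType) d psi (d1 : (1 <= d)%N)
    (H : rkhs (@isotropic_kernel R d psi)) :
  @Psi R d psi -> @characteristic R _ (borel_sphere R d) (@isotropic_kernel R d psi) H ->
  strictly_positive_definite (@isotropic_kernel R d psi).
Proof.
move=> [cpsi psd] [_ [_ inj]]; split => // n a x x_inj q0 i.
(* The arc has more than [n] points. *)
have [b xb] : exists b, forall j, x j <> b.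
  apply: contrapT => nb.
  have /choice[h hP] : forall l : 'I_n.+1, exists j, x j = arc d1 (l : nat)%:R.
    move=> l; apply: contrapT => nl; apply: nb; exists (arc d1 (l : nat)%:R) => j xj.
    by apply: nl; exists j.
  have h_inj : injective h.
    move=> l m hlm; have := hP l; rewrite hlm hP => /arc_inj/eqP.
    by rewrite eqr_nat => /eqP/val_inj.
  by have := leq_card h h_inj; rewrite !card_ord ltnn.
(* [U] exchanges [x i] with a point that is not a node, so no reflected node falls on [x i]. *)
pose U := srefl (val (x i) - val b).
have Uxi : U (x i) = b by exact: srefl_swap.
have UU v : U (U v) = v by apply: val_inj; exact: refl_invol.
have Uxj j : U (x j) <> x i by move=> Uxj; apply: (xb j); rewrite -Uxi -Uxj UU.
pose ap j := Num.max (a j) 0; pose am j := Num.max (- a j) 0.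
have ap0 j : 0 <= ap j by rewrite le_max lexx orbT.
have am0 j : 0 <= am j by rewrite le_max lexx orbT.
have apm j : ap j - am j = a j.
  by rewrite /ap /am; case: (lerP (a j) 0); case: (lerP (- a j) 0); lra.
pose Z := \sum_j ap j + \sum_j am j.
have [Z0|Zn0] := eqVneq Z 0.
  have : ap i + am i <= 0.
    rewrite -Z0 /Z (bigD1 i)//= [X in _ <= _ + X](bigD1 i)//=.
    have : 0 <= \sum_(j < n | j != i) ap j by exact: sumr_ge0.
    have : 0 <= \sum_(j < n | j != i) am j by exact: sumr_ge0.
    lra.
  by have := apm i; have := ap0 i; have := am0 i; lra.
have Zp : 0 < Z by rewrite lt_def Zn0 addr_ge0// sumr_ge0.
(* [P] puts the positive parts on the nodes and the negative parts on their mirror images; [Q]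
   exchanges the two. Both have mass 1 after division by [Z], whatever the sum of the [a j], and
   [P - Q] is [1 / Z] times the signed measure minus its mirror image. *)
pose s (u v : 'I_n -> R) : seq (R * borel_sphere R d) :=
  [seq (u j / Z, x j) | j <- index_enum 'I_n] ++ [seq (v j / Z, U (x j)) | j <- index_enum 'I_n].
have ms u v f : mean (s u v) f = \sum_j u j / Z * f (x j) + \sum_j v j / Z * f (U (x j)).
  by rewrite /s mean_cat /mean !big_map.
have ps u v : (forall j, 0 <= u j) -> (forall j, 0 <= v j) ->
    \sum_j u j + \sum_j v j = Z -> prob_weights (s u v).
  move=> u0 v0 uv; apply/andP; split.
    rewrite /s all_cat !all_map; apply/andP; split; apply/allP => j _ /=; exact: divr_ge0 (ltW Zp).
  have := ms u v (fun=> 1); rewrite /mean.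
  under eq_bigr do rewrite mulr1.
  move=> ->; under eq_bigr do rewrite mulr1.
  under [X in _ + X]eq_bigr do rewrite mulr1.
  by rewrite -!mulr_suml -mulrDl uv divff.
have [P [PA Pf]] := finite_support_probability (ps ap am ap0 am0 erefl).
have [|Q [QA Qf]] := finite_support_probability (ps am ap am0 ap0 _); first by rewrite addrC.
have EP := finite_embedding H cpsi Pf.
have EQ := finite_embedding H cpsi Qf.
have hE : (fun z => mean (s am ap) (fun x => isotropic_kernel psi z x)) =
    (fun z => mean (s ap am) (fun x => isotropic_kernel psi z x)).
  apply/funext => z; rewrite !ms; apply/eqP; rewrite -subr_eq0; apply/eqP.
  have f0 := null_combination H q0.
  have fU : \sum_j a j * isotropic_kernel psi z (U (x j)) = 0.
    rewrite -[RHS](f0 (U z)); apply: eq_bigr => j _; congr (_ * _).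
    by rewrite !isotropic_profile /= inner_refl_sym.
  have split_a F : \sum_j ap j / Z * F j - \sum_j am j / Z * F j = Z^-1 * \sum_j a j * F j.
    by rewrite mulr_sumr -sumrB; apply: eq_bigr => j _; rewrite -(apm j); ring.
  rewrite opprD addrACA addrC split_a fU mulr0 add0r -opprB split_a f0 mulr0 oppr0 //.
rewrite hE in EQ.
(* On this singleton [P] and [Q] have the masses [ap i / Z] and [am i / Z]; their equality gives
   [a i = 0]. *)
have := inj P Q _ EP EQ [set x i] (measurable_point (x i)).
rewrite PA ?QA; try exact: measurable_point.
move=> -[]; rewrite !ms.
have i1 u : \sum_j u j / Z * \1_[set x i] (x j) = u i / Z :> R.
  rewrite (bigD1 i)//= indicE mem_set// mulr1 big1 ?addr0// => j ji.
  rewrite indicE memNset ?mulr0//= => /x_inj ij.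
  by rewrite ij eqxx in ji.
have i2 u : \sum_j u j / Z * \1_[set x i] (U (x j)) = 0 :> R.
  by apply: big1 => j _; rewrite indicE memNset ?mulr0//=; exact: Uxj.
rewrite !i1 !i2 !addr0 => /(mulIf (invr_neq0 Zn0)) apam.
by rewrite -apm apam subrr.
Qed.

Theorem theorem4p5 (R : realType) (d : nat) (psi : R -> R)
  (d_ge1 : (1 <= d)%N)
  (psiP : Psi d.+2 psi \/ Psi_plus d.+1 psi)
  (H : rkhs (@isotropic_kernel R d psi)) :
  [<-> @characteristic R _ (borel_sphere R d) (@isotropic_kernel R d psi) H;
       @universal R (sphere R d) (@isotropic_kernel R d psi) H;
       strictly_positive_definite (@isotropic_kernel R d psi);
       Psi_plus d psi].
Proof.
have psi1 : Psi d.+1 psi by case: psiP => [/Psi_restrict//|[]].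
have psi0 := Psi_restrict psi1; have [cpsi psd] := psi0.
tfae.
- by move=> chi; apply: spd_universal => //; exact: characteristic_spd chi.
- exact: universal_spd.
- by move=> spd.
- by move=> [_ spd]; apply: universal_characteristic => //; exact: spd_universal.
Qed.
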